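(* Let $\gamma\ge1$. Let $(h,u,v)$ be a classical solution of $$\partial_t h+h^2\partial_\xi u=0,\qquad \partial_t u+\partial_\xi\big(h^\gamma/\gamma\big)-v=0,\qquad \partial_t v+u=0,$$ with initial data $(h_0,u_0,v_0)$ such that $(h_0-1,u_0,v_0)\in C_0^1(\mathbb{R})$ and $\inf_\xi h_0>0$, and suppose $$-\sqrt{2\omega_0^\sharp}<\inf_\xi\min\{Z_1,Z_2\}\Big|_{t=0}<-\sqrt2\,\sqrt{\omega_0^\sharp-\Big[\mathcal{F}_\gamma^{-1}\big(G_0E_0\big)+1\Big]^{-\frac2\gamma}}.$$ Then there is a finite time $T_*$, bounded by a continuous function of $G_0$, $E_0$, $\omega_0^\sharp$ and $\inf_\xi\min\{Z_1,Z_2\}|_{t=0}$, such that if the classical solution exists on $[0,T)$ with $T>T_*$, then $\inf_\xi\min\{Z_1,Z_2\}(t)$ reaches $-\sqrt{2\omega_0^\sharp}$ at some time $t\le T_*$.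
   Context: A classical solution is a $C^1$ solution with $h>0$; $C_0^1$ means compactly supported $C^1$. $Z_j=\sqrt{h}\,\big[\partial_\xi u+(-1)^j h^{\frac{\gamma-3}{2}}\partial_\xi h\big]$ ($j=1,2$), $\omega_0(\xi)=\frac{1}{h_0(\xi)}+v_0'(\xi)$, $\omega_0^\sharp=\sup_\xi\omega_0$, $Z_0^\sharp=\sup_\xi\max_{i=1,2}Z_i(0,\xi)$. Energy: $E(t)=\int_{\mathbb{R}}\frac12(u^2+v^2)(t,\xi)+\mathcal{Q}(h(t,\xi))\,d\xi$ with $\mathcal{Q}(h)=\frac1\gamma\int_1^h(s^{\gamma-2}-s^{-2})\,ds$, $E_0=E(0)$. $G_0=\sqrt{2\omega_0^\sharp}+\max\{Z_0^\sharp,\sqrt{2\omega_0^\sharp}\}$. $\mathcal{F}_\gamma(\alpha)=\frac{16}{3\gamma^3}\frac{\alpha^3}{(\alpha+1)^3}\big\{(\alpha+1)^{3-\frac2\gamma}+(\alpha+1)^{2-\frac2\gamma}\big\}$, an increasing bijection of $(0,\infty)$, with inverse $\mathcal{F}_\gamma^{-1}$. *)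

(* Defs.v *)
From Stdlib Require Import Reals.
From Coquelicot Require Import Coquelicot.
Open Scope R_scope.

Definition d_t (f : R -> R -> R) (t x : R) : R := Derive (fun s => f s x) t.
Definition d_x (f : R -> R -> R) (t x : R) : R := Derive (fun y => f t y) x.

Definition inf_xi (f : R -> R) : Rbar := Glb_Rbar (fun y => exists x, y = f x).
Definition sup_xi (f : R -> R) : Rbar := Lub_Rbar (fun y => exists x, y = f x).

Definition cont_within (D : R * R -> Prop) (g : R -> R -> R) (t x : R) : Prop :=
  filterlim (fun p : R * R => g (fst p) (snd p)) (within D (locally (t, x)))
            (locally (g t x)).

Definition slab (T : R) (p : R * R) : Prop := 0 <= fst p < T.
Definition open_slab (T : R) (p : R * R) : Prop := 0 < fst p < T.

Definition C1_slab (T : R) (f : R -> R -> R) : Prop :=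
  (forall t x, 0 <= t < T -> ex_derive (fun y => f t y) x) /\
  (forall t x, 0 < t < T -> ex_derive (fun s => f s x) t) /\
  (forall t x, 0 <= t < T ->
      cont_within (slab T) f t x /\ cont_within (slab T) (d_x f) t x) /\
  (forall t x, 0 < t < T -> cont_within (open_slab T) (d_t f) t x).

Definition classical_solution (gamma T : R) (h u v : R -> R -> R)
    (h0 u0 v0 : R -> R) : Prop :=
  C1_slab T h /\ C1_slab T u /\ C1_slab T v /\
  (forall t x, 0 <= t < T -> 0 < h t x) /\
  (forall x, h 0 x = h0 x /\ u 0 x = u0 x /\ v 0 x = v0 x) /\
  (forall t x, 0 < t < T ->
     d_t h t x + (h t x) ^ 2 * d_x u t x = 0 /\
     d_t u t x + d_x (fun s y => Rpower (h s y) gamma / gamma) t x - v t x = 0 /\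
     d_t v t x + u t x = 0).

Definition C01 (f : R -> R) : Prop :=
  (forall x, ex_derive f x) /\ (forall x, continuous (Derive f) x) /\
  (exists M, forall x, M < Rabs x -> f x = 0).

Definition Zfun (gamma : R) (j : nat) (hv uxi hxi : R) : R :=
  sqrt hv * (uxi + (-1) ^ j * Rpower hv ((gamma - 3) / 2) * hxi).

Definition minZ (gamma : R) (h u : R -> R -> R) (t x : R) : R :=
  Rmin (Zfun gamma 1 (h t x) (d_x u t x) (d_x h t x))
       (Zfun gamma 2 (h t x) (d_x u t x) (d_x h t x)).

Definition Z0j (gamma : R) (j : nat) (h0 u0 : R -> R) (x : R) : R :=
  Zfun gamma j (h0 x) (Derive u0 x) (Derive h0 x).

Definition infZ0 (gamma : R) (h0 u0 : R -> R) : R :=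
  real (inf_xi (fun x => Rmin (Z0j gamma 1 h0 u0 x) (Z0j gamma 2 h0 u0 x))).

Definition Z0sharp (gamma : R) (h0 u0 : R -> R) : R :=
  real (sup_xi (fun x => Rmax (Z0j gamma 1 h0 u0 x) (Z0j gamma 2 h0 u0 x))).

Definition omega0sharp (h0 v0 : R -> R) : R :=
  real (sup_xi (fun x => / h0 x + Derive v0 x)).

Definition G0 (gamma : R) (h0 u0 v0 : R -> R) : R :=
  sqrt (2 * omega0sharp h0 v0) +
  Rmax (Z0sharp gamma h0 u0) (sqrt (2 * omega0sharp h0 v0)).

Definition Qpot (gamma hv : R) : R :=
  / gamma * RInt (fun s => Rpower s (gamma - 2) - Rpower s (-2)) 1 hv.

Definition E0 (gamma : R) (h0 u0 v0 : R -> R) : R :=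
  RInt_gen (fun x => / 2 * (u0 x ^ 2 + v0 x ^ 2) + Qpot gamma (h0 x))
           (Rbar_locally m_infty) (Rbar_locally p_infty).

Definition Fgamma (gamma a : R) : R :=
  16 / (3 * gamma ^ 3) * (a ^ 3 / (a + 1) ^ 3) *
  (Rpower (a + 1) (3 - 2 / gamma) + Rpower (a + 1) (2 - 2 / gamma)).

(* inverse of the increasing bijection Fgamma of (0,oo):
   Finv y = sup { a > 0 | Fgamma a <= y } *)
Definition Fgamma_inv (gamma y : R) : R :=
  real (Lub_Rbar (fun a => 0 < a /\ Fgamma gamma a <= y)).

Definition admissible (gamma G E w m : R) : Prop :=
  0 < w /\ - sqrt (2 * w) < m /\
  m < - sqrt 2 * sqrt (w - Rpower (Fgamma_inv gamma (G * E) + 1) (- 2 / gamma)).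

Definition continuous_on_admissible (gamma : R) (B : R -> R -> R -> R -> R) : Prop :=
  forall G E w m, admissible gamma G E w m ->
  forall eps, 0 < eps -> exists delta, 0 < delta /\
  forall G' E' w' m', admissible gamma G' E' w' m' ->
    Rabs (G' - G) < delta -> Rabs (E' - E) < delta ->
    Rabs (w' - w) < delta -> Rabs (m' - m) < delta ->
    Rabs (B G' E' w' m' - B G E w m) < eps.

(* Main.v *)
Require Import Defs.
From Stdlib Require Import Reals Lra Psatz Classical ClassicalEpsilon FunctionalExtensionality.
From Coquelicot Require Import Coquelicot.
Open Scope R_scope.

(* Along the characteristics of the Riemann invariants u + e K(h), e = 1 or -1, the weighted
   gradients Z_e solve Riccati equations whose only favourable term is w - 1/h, where
   w = v_x + 1/h is transported.  Hence Z_e stays below M = max (sup Z_e(0), s), s = sqrt (2 sup w).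
   Suppose that Z_e > -s up to the bound of the theorem.  Then y = h^(g/2) is Lipschitz, so a large
   value of h at a point forces energy on each side of it.

   Comparing h at the minimum of the Z_e directly with the total energy loses a factor up to 2 with
   respect to the threshold in the theorem.  Instead one follows the minimum of Z_e - N E_e^2, where E_e is the energy lying
   behind the point with respect to the direction of the characteristic.  Since E_e increases along the
   characteristic at the rate given by the energy flux, the points where little of the energy has been
   swept, and h may be large, are compensated by the weight, and the points where most of it has
   been swept have little energy ahead of them.  With N chosen suitably the minimum decreases at
   a uniform rate, which contradicts Z_e > -s after a time that is controlled by the data. *)

(** The solution is only of class C^1, so Z_e is merely continuous and its Riccati equation has no
    pointwise meaning. It is used through difference quotients in [x]; no characteristic curve is
    constructed, and the comparison arguments take place at extrema over compact rectangles.
    Compactness comes from finite speed of propagation, which has to be bootstrapped because the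
    wave speed h^((g+1)/2) has no a priori bound.

    With p = 2/g, y = h^(g/2), 1/h = y^(-p), nu = e g u/2, and x the energy E_e in units where the
    total is at most 2, the decline becomes the scalar inequality [weight_bound]. Its factor 1/2 +
    3p/4 is p times the coefficient (g+3)/4 of the Riccati estimate.

    The possible factor 2 comes from y near 1: a value y forces only the energy [Qint p y], about
    [Ffun p y / 2], on each side, whereas the threshold allows [Ffun p (1 + a)] per side on average.
    The other delicate region is y < 1, where energy may flow the wrong way; there the velocity must
    be controlled by the energy as well. *)

Ltac toR := match goal with |- ?a = ?b => change (@eq R a b) end.

(** * Elementary calculus for real functions *)

Lemma is_derive_continuity_pt (f : R -> R) (x l : R) :
  is_derive f x l -> continuity_pt f x.
Proof.
  intros H; apply derivable_continuous_pt; exists l; now apply is_derive_Reals.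
Qed.

Lemma D_mult (f g : R -> R) (x a b : R) : is_derive f x a -> is_derive g x b ->
  is_derive (fun z => f z * g z) x (a * g x + f x * b).
Proof. intros; now apply (is_derive_mult f g x a b H H0 Rmult_comm). Qed.

Lemma D_minus (f g : R -> R) (x a b : R) : is_derive f x a -> is_derive g x b ->
  is_derive (fun z => f z - g z) x (a - b).
Proof. intros; now apply (is_derive_minus f g x a b). Qed.

Lemma D_plus (f g : R -> R) (x a b : R) : is_derive f x a -> is_derive g x b ->
  is_derive (fun z => f z + g z) x (a + b).
Proof. intros; now apply (is_derive_plus f g x a b). Qed.

Lemma D_scal (f : R -> R) (k x a : R) : is_derive f x a ->
  is_derive (fun z => k * f z) x (k * a).
Proof. intros; now apply (is_derive_scal f x k a). Qed.

Lemma D_id (x : R) : is_derive (fun z : R => z) x 1.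
Proof. apply (is_derive_id (K := R_AbsRing)). Qed.

Lemma D_const (k x : R) : is_derive (fun _ : R => k) x 0.
Proof. apply (is_derive_const (V := R_NormedModule)). Qed.

Lemma D_comp (f g : R -> R) (x a b : R) : is_derive f (g x) a -> is_derive g x b ->
  is_derive (fun z => f (g z)) x (b * a).
Proof. intros; now apply (is_derive_comp f g x a b). Qed.

Lemma derive_nonneg_le (f df : R -> R) (a b : R) :
  a <= b -> (forall x, a <= x <= b -> is_derive f x (df x)) ->
  (forall x, a <= x <= b -> 0 <= df x) -> f a <= f b.
Proof.
  intros ab Hd Hp.
  destruct (MVT_gen f a b df) as [c [Hc He]];
    rewrite ?Rmin_left, ?Rmax_right in * by lra.
  - intros x Hx; apply Hd; lra.
  - intros x Hx; eapply is_derive_continuity_pt, Hd; lra.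
  - specialize (Hp c Hc); nra.
Qed.

Lemma is_derive_Rpower (a x : R) :
  0 < x -> is_derive (fun z => Rpower z a) x (a * Rpower x a / x).
Proof.
  intros Hx. apply is_derive_Reals.
  replace (a * Rpower x a / x) with (a * Rpower x (a - 1)).
  - now apply derivable_pt_lim_power.
  - unfold Rminus; rewrite Rpower_plus, Rpower_Ropp, Rpower_1 by lra. now field; lra.
Qed.

Lemma Rpower_pos (x a : R) : 0 < Rpower x a.
Proof. apply exp_pos. Qed.

Lemma continuous_Rpower (a x : R) : 0 < x -> continuous (fun z => Rpower z a) x.
Proof.
  intros Hx; apply (ex_derive_continuous (fun z => Rpower z a)).
  eexists; now apply is_derive_Rpower.
Qed.

Lemma is_derive_RInt_from1 (f : R -> R) (y : R) :
  0 < y -> (forall z, 0 < z -> continuous f z) ->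
  is_derive (fun t => RInt f 1 t) y (f y).
Proof.
  intros Hy Hc. apply (is_derive_RInt f (fun t => RInt f 1 t) 1 y).
  - exists (mkposreal _ Hy); intros t Ht.
    assert (0 < t).
    { change (Rabs (t - y) < y) in Ht. apply Rabs_def2 in Ht; lra. }
    apply (RInt_correct (V := R_CompleteNormedModule) f 1 t),
      (ex_RInt_continuous (V := R_CompleteNormedModule) f 1 t).
    intros z Hz; apply Hc. revert Hz; unfold Rmin; destruct (Rle_dec 1 t); lra.
  - now apply Hc.
Qed.

(** * One-variable inequalities *)

(** All functions are written in y = h^(g/2) with p = 2/g. Up to the factor 2/g^2, [qint] is the
    potential energy density and [Qint] is what the energy on one side controls when y is Lipschitz.
    [jfun] is the minimum over the velocity of the rescaled rate at which energy is swept by a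
    characteristic. [Ffun] is the threshold function: [Fgamma g a] equals 16/g^3 times
    [Ffun (2 / g) (1 + a)]. *)
Definition qden (p z : R) : R := Rpower z (1 - p) - Rpower z (- 1 - p).
Definition qint (p y : R) : R := RInt (qden p) 1 y.
Definition Qint (p y : R) : R := RInt (qint p) 1 y.
Definition jfun (p y : R) : R := y * qint p y - (y ^ 2 - 1) ^ 2 * Rpower y (- p) / (4 * y).
Definition Ffun (p y : R) : R := (y - 1) ^ 3 * Rpower y (- p) * (1 + / y) / 3.

Lemma qden_eq (p z : R) : 0 < z -> qden p z = (z ^ 2 - 1) * Rpower z (- p) / z.
Proof.
  intros Hz; unfold qden.
  replace (1 - p) with (1 + - p) by ring.
  replace (- 1 - p) with (- (1) + - p) by ring.
  rewrite !Rpower_plus, (Rpower_Ropp z 1), Rpower_1 by lra. field; lra.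
Qed.

Lemma qden_continuous (p z : R) : 0 < z -> continuous (qden p) z.
Proof.
  intros Hz; apply (continuous_minus (V := R_NormedModule)
    (fun z => Rpower z (1 - p)) (fun z => Rpower z (- 1 - p))); now apply continuous_Rpower.
Qed.

Lemma is_derive_qint (p y : R) : 0 < y -> is_derive (qint p) y (qden p y).
Proof. intros; apply is_derive_RInt_from1; auto using qden_continuous. Qed.

Lemma qint_continuous (p z : R) : 0 < z -> continuous (qint p) z.
Proof.
  intros Hz; apply (ex_derive_continuous (qint p)).
  eexists; now apply is_derive_qint.
Qed.

Lemma is_derive_Qint (p y : R) : 0 < y -> is_derive (Qint p) y (qint p y).
Proof. intros; apply is_derive_RInt_from1; auto using qint_continuous. Qed.

Lemma qint_1 (p : R) : qint p 1 = 0.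
Proof. apply (RInt_point (V := R_CompleteNormedModule)). Qed.

Lemma Qint_1 (p : R) : Qint p 1 = 0.
Proof. apply (RInt_point (V := R_CompleteNormedModule)). Qed.

Lemma is_derive_weighted (p : R) (g : R -> R) (y dg : R) :
  0 < y -> is_derive g y dg ->
  is_derive (fun z => g z * Rpower z (- p)) y (Rpower y (- p) * (dg - p * g y / y)).
Proof.
  intros Hy Hg.
  replace (Rpower y (- p) * (dg - p * g y / y))
    with (dg * Rpower y (- p) + g y * (- p * Rpower y (- p) / y)) by (field; lra).
  exact (is_derive_mult g (fun z => Rpower z (- p)) y dg _ Hg
    (is_derive_Rpower (- p) y Hy) Rmult_comm).
Qed.

(** Both sides vanish at 1, and the derivative of the difference is a positive multiple of a
    polynomial in z - 1 with nonnegative coefficients. The correction p/6 (1 - 1/y), dropped in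
    [qint_lower_half], is used in [jder_lower]. *)
Lemma qint_lower (p y : R) : 0 < p <= 2 -> 1 <= y ->
  (y - 1) ^ 2 * (1 + / y) * (/ 2 + p / 6 * (1 - / y)) * Rpower y (- p) <= qint p y.
Proof.
  intros Hp Hy.
  set (g := fun y => (y - 1) ^ 2 * (1 + / y) * (/ 2 + p / 6 * (1 - / y))).
  set (dg := fun y : R => 2 * (y - 1) * (1 + / y) * (/ 2 + p / 6 * (1 - / y))
     + (y - 1) ^ 2 * (- / y ^ 2) * (/ 2 + p / 6 * (1 - / y))
     + (y - 1) ^ 2 * (1 + / y) * (p / 6 * / y ^ 2)).
  assert (Hg : forall y, 1 <= y -> is_derive g y (dg y)).
  { intros z Hz; unfold g, dg; auto_derive; [ lra | field; lra ]. }
  enough (qint p 1 - g 1 * Rpower 1 (- p) <= qint p y - g y * Rpower y (- p)).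
  { revert H; rewrite qint_1. unfold g; nra. }
  apply (derive_nonneg_le (fun z => qint p z - g z * Rpower z (- p))
    (fun z => qden p z - Rpower z (- p) * (dg z - p * g z / z))); auto.
  - intros z Hz. apply (is_derive_minus (qint p) (fun z => g z * Rpower z (- p))).
    + apply is_derive_qint; lra.
    + apply is_derive_weighted; [ lra | apply Hg; lra ].
  - intros z Hz. rewrite qden_eq by lra.
    assert (H := Rpower_pos z (- p)).
    replace ((z ^ 2 - 1) * Rpower z (- p) / z - Rpower z (- p) * (dg z - p * g z / z))
      with (Rpower z (- p) * ((z - 1) ^ 2 * (/ 2 + (/ 2 + p / 2 + p ^ 2 / 3) * (z - 1)
            + (p / 6 + p ^ 2 / 6) * (z - 1) ^ 2) / z ^ 3))
      by (unfold g, dg; field; lra).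
    apply Rmult_le_pos; [ lra | apply Rdiv_le_0_compat; [ | apply pow_lt; lra ] ].
    apply Rmult_le_pos; [ apply pow2_ge_0 | ].
    assert (0 <= p ^ 2) by apply pow2_ge_0. assert (0 <= (z - 1) ^ 2) by apply pow2_ge_0.
    assert (0 <= (/ 2 + p / 2 + p ^ 2 / 3) * (z - 1)) by (apply Rmult_le_pos; lra).
    assert (0 <= (p / 6 + p ^ 2 / 6) * (z - 1) ^ 2) by (apply Rmult_le_pos; lra).
    lra.
Qed.

Lemma is_derive_Ffun (p y : R) : 1 <= y ->
  is_derive (Ffun p) y (Rpower y (- p) *
    ((y - 1) ^ 2 * (1 + / y) - (y - 1) ^ 3 / (3 * y ^ 2)
     - p / 3 * (y - 1) ^ 3 * (1 + / y) / y)).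
Proof.
  intros Hy.
  set (g := fun y => (y - 1) ^ 3 * (1 + / y) / 3).
  set (dg := (y - 1) ^ 2 * (1 + / y) - (y - 1) ^ 3 / (3 * y ^ 2)).
  assert (Hg : is_derive g y dg).
  { unfold g, dg; auto_derive; [ lra | field; lra ]. }
  apply (is_derive_ext (fun z => g z * Rpower z (- p))).
  { intros z; unfold g, Ffun, Rdiv; toR; ring. }
  replace (p / 3 * (y - 1) ^ 3 * (1 + / y) / y) with (p * g y / y)
    by (unfold g; field; lra).
  apply is_derive_weighted; [ lra | exact Hg ].
Qed.

Lemma qint_lower_half (p y : R) : 0 < p <= 2 -> 1 <= y ->
  (y - 1) ^ 2 * (1 + / y) / 2 * Rpower y (- p) <= qint p y.
Proof.
  intros Hp Hy. eapply Rle_trans; [ | now apply qint_lower ].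
  assert (H1 := Rpower_pos y (- p)).
  assert (0 < / y <= 1).
  { split; [ apply Rinv_0_lt_compat; lra | rewrite <- Rinv_1; apply Rinv_le_contravar; lra ]. }
  assert (0 <= (y - 1) ^ 2) by apply pow2_ge_0.
  apply Rmult_le_compat_r; [ lra | ].
  unfold Rdiv; apply Rmult_le_compat_l; [ apply Rmult_le_pos; lra | nra ].
Qed.

Lemma qint_nonneg (p y : R) : 0 < p <= 2 -> 1 <= y -> 0 <= qint p y.
Proof.
  intros Hp Hy. eapply Rle_trans; [ | now apply qint_lower_half ].
  assert (H1 := Rpower_pos y (- p)).
  assert (0 < / y) by (apply Rinv_0_lt_compat; lra).
  apply Rmult_le_pos; [ unfold Rdiv; repeat apply Rmult_le_pos; lra | lra ].
Qed.

Lemma qint_incr (p y z : R) : 0 < y -> 1 <= y <= z -> qint p y <= qint p z.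
Proof.
  intros _ Hyz. apply (derive_nonneg_le (qint p) (qden p)); [ lra | | ].
  - intros x Hx; apply is_derive_qint; lra.
  - intros x Hx; rewrite qden_eq by lra.
    apply Rdiv_le_0_compat; [ apply Rmult_le_pos; [ nra | ] | lra ].
    left; apply Rpower_pos.
Qed.

(** The factor 1/2 cannot be improved: near y = 1 both sides behave like (y - 1)^3 / 3. *)
Lemma Qint_lower (p y : R) : 0 < p <= 2 -> 1 <= y -> Ffun p y / 2 <= Qint p y.
Proof.
  intros Hp Hy.
  enough (Qint p 1 - / 2 * Ffun p 1 <= Qint p y - / 2 * Ffun p y).
  { rewrite Qint_1 in H. unfold Ffun at 1 in H. lra. }
  eapply (derive_nonneg_le (fun z => Qint p z - / 2 * Ffun p z) _ _ _ Hy).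
  - intros z Hz. apply (D_minus (Qint p) (fun z => / 2 * Ffun p z)).
    + apply is_derive_Qint; lra.
    + apply D_scal, is_derive_Ffun; lra.
  - intros z Hz; cbv beta.
    assert (H := qint_lower_half p z Hp ltac:(lra)).
    assert (H1 := Rpower_pos z (- p)).
    assert (0 < / z) by (apply Rinv_0_lt_compat; lra).
    assert (0 <= (z - 1) ^ 3) by (apply pow_le; lra).
    assert (0 <= (z - 1) ^ 3 / (3 * z ^ 2)) by (apply Rdiv_le_0_compat; nra).
    assert (0 <= p / 3 * (z - 1) ^ 3 * (1 + / z) / z).
    { apply Rdiv_le_0_compat; [ | lra ]. repeat apply Rmult_le_pos; lra. }
    nra.
Qed.

Definition jder (p y : R) : R :=
  qint p y + (1 + p) / 4 * ((y ^ 2 - 1) ^ 2 * Rpower y (- p) / y ^ 2).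

Lemma is_derive_jfun (p y : R) : 0 < y -> is_derive (jfun p) y (jder p y).
Proof.
  intros Hy.
  set (g := fun y => (y ^ 2 - 1) ^ 2 / (4 * y)).
  apply (is_derive_ext (fun z => z * qint p z - g z * Rpower z (- p))).
  { intros z; unfold g, jfun, Rdiv; toR; ring. }
  set (dg := (y ^ 2 - 1) - (y ^ 2 - 1) ^ 2 / (4 * y ^ 2)).
  assert (Hg : is_derive g y dg).
  { unfold g, dg; auto_derive; [ lra | field; lra ]. }
  replace (jder p y) with ((1 * qint p y + y * qden p y)
     - Rpower y (- p) * (dg - p * g y / y)).
  - apply (D_minus (fun z => z * qint p z) (fun z => g z * Rpower z (- p))).
    + apply (D_mult (fun z => z) (qint p)); [ apply D_id | now apply is_derive_qint ].
    + now apply is_derive_weighted.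
  - rewrite qden_eq by lra. unfold jder, dg, g; field; lra.
Qed.

Lemma jfun_1 (p : R) : jfun p 1 = 0.
Proof. unfold jfun; rewrite qint_1; field. Qed.

Lemma Ffun_1 (p : R) : Ffun p 1 = 0.
Proof. unfold Ffun; field. Qed.

(** Same method: after [qint_lower_half], the derivative of the difference is a polynomial in z - 1
    whose coefficients are nonnegative for p <= 2. For p = 2 the two sides have the same leading
    term at y = 1, so the constant 1/2 + 3p/4 required by the Riccati estimate is just reached. *)
Lemma jfun_lower (p y : R) : 0 < p <= 2 -> 1 <= y ->
  (/ 2 + 3 / 4 * p) * Ffun p y <= jfun p y.
Proof.
  intros Hp Hy. set (H0 := / 2 + 3 / 4 * p).
  enough (jfun p 1 - H0 * Ffun p 1 <= jfun p y - H0 * Ffun p y)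
    by (rewrite jfun_1, Ffun_1 in H; lra).
  eapply (derive_nonneg_le (fun z => jfun p z - H0 * Ffun p z) _ _ _ Hy).
  - intros z Hz. apply (D_minus (jfun p) (fun z => H0 * Ffun p z)).
    + apply is_derive_jfun; lra.
    + apply D_scal, is_derive_Ffun; lra.
  - intros z Hz; cbv beta. unfold jder.
    assert (H := qint_lower_half p z Hp ltac:(lra)).
    assert (H1 := Rpower_pos z (- p)).
    set (Y := Rpower z (- p)) in *.
    match goal with |- 0 <= ?r => enough (E : 0 <= (z - 1) ^ 2 * (1 + / z) / 2 * Y + (r - qint p z)) by lra end.
    assert (E : (z - 1) ^ 2 * (1 + / z) / 2 * Y + (qint p z +
      (1 + p) / 4 * ((z ^ 2 - 1) ^ 2 * Y / z ^ 2) - H0 * (Y * ((z - 1) ^ 2 * (1 + / z)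
       - (z - 1) ^ 3 / (3 * z ^ 2) - p / 3 * (z - 1) ^ 3 * (1 + / z) / z)) - qint p z)
      = Y * ((z - 1) ^ 2 * ((1 - p / 2) + (7 / 6 - 2 / 3 * p + p ^ 2 / 2) * (z - 1)
          + (/ 4 - p / 3 + p ^ 2 / 4) * (z - 1) ^ 2) / z ^ 2)).
    { unfold H0; field; lra. }
    rewrite E.
    apply Rmult_le_pos; [ lra | apply Rdiv_le_0_compat; [ | nra ] ].
    apply Rmult_le_pos; [ apply pow2_ge_0 | ].
    assert (0 <= (7 / 6 - 2 / 3 * p + p ^ 2 / 2) * (z - 1)) by (apply Rmult_le_pos; nra).
    assert (0 <= (/ 4 - p / 3 + p ^ 2 / 4) * (z - 1) ^ 2)
      by (apply Rmult_le_pos; [ nra | apply pow2_ge_0 ]).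
    lra.
Qed.

(** This is convexity of [jfun] on y >= 1, needed to stay above its tangent lines. *)
Lemma jder_incr (p y z : R) : 0 < p <= 2 -> 1 <= y <= z -> jder p y <= jder p z.
Proof.
  intros Hp Hyz; unfold jder.
  assert (qint p y <= qint p z) by (apply qint_incr; lra).
  enough ((y ^ 2 - 1) ^ 2 * Rpower y (- p) / y ^ 2 <= (z ^ 2 - 1) ^ 2 * Rpower z (- p) / z ^ 2)
    by nra.
  set (g := fun y => (y ^ 2 - 1) ^ 2 / y ^ 2).
  set (dg := fun y : R => 4 * (y ^ 2 - 1) / y - 2 * (y ^ 2 - 1) ^ 2 / y ^ 3).
  enough (g y * Rpower y (- p) <= g z * Rpower z (- p))
    by (unfold g, Rdiv in *; nra).
  apply (derive_nonneg_le (fun z => g z * Rpower z (- p))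
    (fun z => Rpower z (- p) * (dg z - p * g z / z))); [ lra | | ].
  - intros x Hx; apply is_derive_weighted; [ lra | ].
    unfold g, dg; auto_derive; [ nra | field; lra ].
  - intros x Hx. apply Rmult_le_pos; [ left; apply Rpower_pos | ].
    replace (dg x - p * g x / x)
      with ((x ^ 2 - 1) * (4 * x ^ 2 - (2 + p) * (x ^ 2 - 1)) / x ^ 3)
      by (unfold dg, g; field; lra).
    apply Rdiv_le_0_compat; [ | apply pow_lt; lra ]. apply Rmult_le_pos; nra.
Qed.

(** The constant 19/8 is the largest one that [qint_lower] allows: the remainder 17/48 (1 - p/2) +
    (3 + p)/12 / b tends to 0 for p = 2 and b going to infinity. *)
Lemma jder_lower (p b : R) : 0 < p <= 2 -> 1 <= b ->
  19 / 8 * (/ 2 + 3 / 4 * p) * Ffun p b <= (b - 1) * jder p b.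
Proof.
  intros Hp Hb. unfold jder, Ffun.
  assert (H := qint_lower p b Hp Hb). assert (H1 := Rpower_pos b (- p)).
  set (Y := Rpower b (- p)) in *.
  apply (Rmult_le_compat_l (b - 1)) in H; [ | lra ].
  assert (E : (b - 1) * ((b - 1) ^ 2 * (1 + / b) * (/ 2 + p / 6 * (1 - / b)) * Y)
     + (b - 1) * ((1 + p) / 4 * ((b ^ 2 - 1) ^ 2 * Y / b ^ 2))
     - 19 / 8 * (/ 2 + 3 / 4 * p) * ((b - 1) ^ 3 * Y * (1 + / b) / 3)
     = (b - 1) ^ 3 * (1 + / b) * Y * (17 / 48 * (1 - p / 2) + (3 + p) / 12 * / b)).
  { field; lra. }
  assert (0 < / b) by (apply Rinv_0_lt_compat; lra).
  assert (0 <= (b - 1) ^ 3 * (1 + / b) * Y * (17 / 48 * (1 - p / 2) + (3 + p) / 12 * / b)).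
  { repeat apply Rmult_le_pos; try lra.
    assert (0 <= (3 + p) / 12 * / b) by (apply Rmult_le_pos; lra). lra. }
  nra.
Qed.

Lemma tangent_le (f df : R -> R) (b y : R) : b <= y ->
  (forall x, b <= x <= y -> is_derive f x (df x)) ->
  (forall x, b <= x <= y -> df b <= df x) -> f b + (y - b) * df b <= f y.
Proof.
  intros Hby Hd Hm.
  enough (f b - df b * b <= f y - df b * y) by lra.
  apply (derive_nonneg_le (fun x => f x - df b * x) (fun x => df x - df b)); auto.
  - intros x Hx. apply (D_minus f (fun x => df b * x)); auto.
    auto_derive; [ trivial | ring ].
  - intros x Hx; specialize (Hm x Hx); lra.
Qed.

Lemma jfun_tangent (p b y : R) : 0 < p <= 2 -> 1 < b <= y ->
  (/ 2 + 3 / 4 * p) * Ffun p b * (1 + 19 / 8 * ((y - b) / (b - 1))) <= jfun p y.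
Proof.
  intros Hp Hb.
  assert (H := tangent_le (jfun p) (jder p) b y ltac:(lra)
    ltac:(intros; apply is_derive_jfun; lra) ltac:(intros; apply jder_incr; lra)).
  assert (H1 := jfun_lower p b Hp ltac:(lra)).
  assert (H2 := jder_lower p b Hp ltac:(lra)).
  apply (Rmult_le_compat_l ((y - b) / (b - 1))) in H2;
    [ | apply Rdiv_le_0_compat; lra ].
  replace ((y - b) / (b - 1) * ((b - 1) * jder p b)) with ((y - b) * jder p b) in H2
    by (field; lra).
  nra.
Qed.

(** The tangent at b has slope [qint p b], and [qint_lower_half] says exactly that (b - 1) times
    this slope is at least 3/2 [Ffun p b]. *)
Lemma Qint_tangent (p b y : R) : 0 < p <= 2 -> 1 < b <= y ->
  Ffun p b * (/ 2 + 3 / 2 * ((y - b) / (b - 1))) <= Qint p y.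
Proof.
  intros Hp Hb.
  assert (H := tangent_le (Qint p) (qint p) b y ltac:(lra)
    ltac:(intros; apply is_derive_Qint; lra) ltac:(intros; apply qint_incr; lra)).
  assert (H1 := Qint_lower p b Hp ltac:(lra)).
  assert (H2 := qint_lower_half p b Hp ltac:(lra)).
  apply (Rmult_le_compat_l (y - b)) in H2; [ | lra ].
  replace ((y - b) * ((b - 1) ^ 2 * (1 + / b) / 2 * Rpower b (- p)))
    with (Ffun p b * (3 / 2 * ((y - b) / (b - 1)))) in H2
    by (unfold Ffun; field; lra).
  lra.
Qed.

Lemma Rpower_neg_le (p x y : R) : 0 <= p -> 0 < x <= y -> Rpower y (- p) <= Rpower x (- p).
Proof.
  intros Hp Hxy. rewrite !Rpower_Ropp.
  apply Rinv_le_contravar; [ apply Rpower_pos | now apply Rle_Rpower_l ].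
Qed.

(** The quotient of [Ffun p (1 + a)] by a^3 decreases in a. *)
Lemma Ffun_scale (p a t : R) : 0 < p -> 0 < a -> 0 <= t <= 1 ->
  t ^ 3 * Ffun p (1 + a) <= Ffun p (1 + t * a).
Proof.
  intros Hp Ha Ht; unfold Ffun.
  assert (1 + t * a <= 1 + a) by nra. assert (0 <= t * a) by nra.
  assert (K1 := Rpower_neg_le p (1 + t * a) (1 + a) ltac:(lra) ltac:(lra)).
  assert (K2 : / (1 + a) <= / (1 + t * a)) by (apply Rinv_le_contravar; lra).
  assert (0 < / (1 + a)) by (apply Rinv_0_lt_compat; lra).
  assert (K3 := Rpower_pos (1 + a) (- p)).
  replace (1 + a - 1) with a by ring. replace (1 + t * a - 1) with (t * a) by ring.
  assert (0 <= (t * a) ^ 3) by (apply pow_le; lra).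
  replace (t ^ 3 * (a ^ 3 * Rpower (1 + a) (- p) * (1 + / (1 + a)) / 3))
    with ((t * a) ^ 3 * (Rpower (1 + a) (- p) * (1 + / (1 + a))) / 3) by (field; lra).
  replace ((t * a) ^ 3 * Rpower (1 + t * a) (- p) * (1 + / (1 + t * a)) / 3)
    with ((t * a) ^ 3 * (Rpower (1 + t * a) (- p) * (1 + / (1 + t * a))) / 3) by (field; lra).
  apply Rmult_le_compat_r; [ lra | ]. apply Rmult_le_compat_l; [ lra | ].
  apply Rmult_le_compat; lra.
Qed.

Lemma Rpower_neg_tangent (p b y : R) : 0 <= p -> 0 < b -> 0 < y ->
  Rpower b (- p) * (1 - p * (y - b) / b) <= Rpower y (- p).
Proof.
  intros Hp Hb Hy.
  assert (E : Rpower y (- p) = Rpower b (- p) * exp (- p * ln (y / b))).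
  { unfold Rpower; rewrite <- exp_plus; f_equal.
    unfold Rdiv; rewrite ln_mult, ln_Rinv; try apply Rinv_0_lt_compat; lra. }
  rewrite E. apply Rmult_le_compat_l; [ left; apply Rpower_pos | ].
  assert (0 < y / b) by (apply Rdiv_lt_0_compat; lra).
  assert (H1 := exp_ineq1_le (- p * ln (y / b))).
  assert (ln (y / b) <= (y - b) / b).
  { replace ((y - b) / b) with (y / b - 1) by (field; lra).
    assert (H2 := exp_ineq1_le (ln (y / b))). rewrite exp_ln in H2; lra. }
  unfold Rdiv in *. nra.
Qed.

(** What remains of the weight inequality when 1 <= y <= 1 + a, with y = 1 + t a. The constant c =
    27/200 must fit both this lemma and [weight_poly_above]: here x = 2 - t^3/2 with t near 2/3
    requires c to be at most about 0.143, and there x = 1, T = 1/3 requires c >= 4/31, about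
    0.129. *)
Lemma weight_poly_below (t x : R) : 0 <= t <= 1 -> 0 <= x <= 2 -> t ^ 3 / 2 <= 2 - x ->
  t - 1 + 27 / 200 * x ^ 2 <= 2 * (27 / 200) * x * t ^ 3.
Proof.
  intros Ht Hx H.
  (* the difference is concave in [x]: it suffices to treat [x = 0] and [x = 2 - t ^ 3 / 2] *)
  set (X := 2 - t ^ 3 / 2). assert (0 <= t ^ 3 <= 1).
  { split; [ apply pow_le; lra | rewrite <- (pow1 3); apply pow_incr; lra ]. }
  assert (HX : t - 1 + 27 / 200 * X ^ 2 <= 2 * (27 / 200) * X * t ^ 3).
  { unfold X.
    enough (0 <= 1 - t - 27 / 200 * (4 - 6 * t ^ 3 + 5 / 4 * (t ^ 3) ^ 2)) by nra.
    (* [(t - r) ^ 2 * (t + 2 * r) >= 0] is the tangent bound t^3 >= 3 r^2 t - 2 r^3. The value r =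
       17/25 is close to the worst point t = 0.69; r = 31/40 serves the remaining range. *)
    destruct (Rle_dec t (4 / 5)).
    - assert (0 <= (t - 17 / 25) ^ 2 * (t + 34 / 25))
        by (apply Rmult_le_pos; [ apply pow2_ge_0 | lra ]).
      nra.
    - assert (0 <= (t - 31 / 40) ^ 2 * (t + 31 / 20))
        by (apply Rmult_le_pos; [ apply pow2_ge_0 | lra ]).
      nra. }
  assert (3 / 2 <= X) by (unfold X; lra).
  assert (x <= X) by (unfold X; lra).
  clearbody X. set (u := t ^ 3) in *. clearbody u.
  assert (0 <= 27 / 200 * (x * (X - x)) * X) by (repeat apply Rmult_le_pos; lra).
  nra.
Qed.

(** The case y >= 1 + a, with T = (y - 1 - a)/a. The two bounds on T are the energy behind and the
    energy ahead, both seen through [Qint_tangent]; they meet at x = 1, T = 1/3. *)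
Lemma weight_poly_above (T x : R) : 0 <= T -> T <= 2 / 3 * (x - / 2) ->
  T <= 2 / 3 * (3 / 2 - x) ->
  T + 27 / 200 * x ^ 2 <= 2 * (27 / 200) * x * (1 + 19 / 8 * T).
Proof.
  intros HT H1 H2.
  enough (0 <= 27 / 200 * x * (2 - x) - T * (1 - 513 / 800 * x)) by nra.
  destruct (Rle_dec x 1).
  - nra.
  - nra.
Qed.

(** Write y = 1 + t a. Convexity of y^(-p) bounds (1 + a)^(-p) - y^(-p) by (t - 1) times the slack,
    so the slack factors out of both sides. For t <= 1 the scaling of [Ffun] turns [jfun] and [Qint]
    into multiples of t^3; for t >= 1 tangents at 1 + a make them affine in t. The energy hypotheses
    then restrict t in terms of x and 2 - x. *)
Lemma weight_ineq_ge1 (p a x y : R) : 0 < p <= 2 -> 0 < a -> 0 <= x <= 2 -> 1 <= y ->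
  Qint p y <= Ffun p (1 + a) * x -> Qint p y <= Ffun p (1 + a) * (2 - x) ->
  (/ 2 + 3 / 4 * p) * Ffun p (1 + a) *
    (Rpower (1 + a) (- p) + 27 / 200 * (p * a * Rpower (1 + a) (- p) / (1 + a)) * x ^ 2
     - Rpower y (- p))
  <= 2 * (27 / 200) * x * (p * a * Rpower (1 + a) (- p) / (1 + a)) * jfun p y.
Proof.
  intros Hp Ha Hx Hy Hl Hr.
  set (b := 1 + a) in *. set (D := p * a * Rpower b (- p) / b).
  assert (Hb : 1 < b) by (unfold b; lra).
  assert (HY := Rpower_pos b (- p)).
  assert (HD : 0 < D) by (unfold D; apply Rdiv_lt_0_compat; [ repeat apply Rmult_lt_0_compat | ]; lra).
  assert (HF : 0 < Ffun p b).
  { unfold Ffun. assert (0 < / b) by (apply Rinv_0_lt_compat; lra).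
    apply Rdiv_lt_0_compat; [ | lra ].
    repeat apply Rmult_lt_0_compat; lra. }
  set (t := (y - 1) / a).
  assert (Ey : y = 1 + t * a) by (unfold t; field; lra).
  assert (Ht : 0 <= t) by (unfold t; apply Rdiv_le_0_compat; lra).
  assert (HT := Rpower_neg_tangent p b y ltac:(lra) ltac:(lra) ltac:(lra)).
  replace (Rpower b (- p) * (1 - p * (y - b) / b)) with (Rpower b (- p) - D * (t - 1)) in HT
    by (unfold D; rewrite Ey; unfold b; field; lra).
  set (H0 := / 2 + 3 / 4 * p). assert (0 < H0) by (unfold H0; lra).
  apply Rle_trans with (H0 * Ffun p b * (D * (t - 1 + 27 / 200 * x ^ 2))).
  { apply Rmult_le_compat_l; [ apply Rmult_le_pos; lra | ]. lra. }
  enough (H0 * Ffun p b * (t - 1 + 27 / 200 * x ^ 2) <= 2 * (27 / 200) * x * jfun p y) by nra.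
  destruct (Rle_dec b y) as [Hby | Hby].
  - assert (Hj := jfun_tangent p b y Hp ltac:(lra)).
    assert (Hq := Qint_tangent p b y Hp ltac:(lra)).
    replace ((y - b) / (b - 1)) with (t - 1) in Hj, Hq
      by (rewrite Ey; unfold b; field; lra).
    fold H0 in Hj.
    assert (0 <= t - 1) by (unfold b in Hby; assert (a * 1 <= a * t) by lra; nra).
    assert (HP := weight_poly_above (t - 1) x ltac:(lra) ltac:(nra) ltac:(nra)).
    apply Rle_trans with (2 * (27 / 200) * x * (H0 * Ffun p b * (1 + 19 / 8 * (t - 1)))).
    + replace (2 * (27 / 200) * x * (H0 * Ffun p b * (1 + 19 / 8 * (t - 1))))
        with (H0 * Ffun p b * (2 * (27 / 200) * x * (1 + 19 / 8 * (t - 1)))) by ring.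
      apply Rmult_le_compat_l; [ apply Rmult_le_pos; lra | lra ].
    + apply Rmult_le_compat_l; [ lra | exact Hj ].
  - assert (Ht1 : t <= 1) by (unfold b in Hby; nra).
    assert (Hs := Ffun_scale p a t ltac:(lra) Ha ltac:(lra)). rewrite <- Ey in Hs. fold b in Hs.
    assert (Hj := jfun_lower p y Hp Hy). fold H0 in Hj.
    assert (Hq := Qint_lower p y Hp Hy).
    assert (HP := weight_poly_below t x ltac:(lra) Hx ltac:(nra)).
    apply Rle_trans with (2 * (27 / 200) * x * (H0 * (t ^ 3 * Ffun p b))).
    + replace (2 * (27 / 200) * x * (H0 * (t ^ 3 * Ffun p b)))
        with (H0 * Ffun p b * (2 * (27 / 200) * x * t ^ 3)) by ring.
      apply Rmult_le_compat_l; [ apply Rmult_le_pos; lra | lra ].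
    + apply Rmult_le_compat_l; [ lra | ]. eapply Rle_trans; [ | exact Hj ].
      apply Rmult_le_compat_l; lra.
Qed.

(** * Estimates below the rest state, y < 1 *)

(** Taylor polynomial of degree 6 at z = 0 of - [Qint 0 (1 - z)]: its second derivative 2z + z^2 +
    z^3 + z^4 truncates the series of z(2 - z)/(1 - z). All further terms are nonnegative, and
    increasing p only increases - [Qint]. *)
Definition ppoly (z : R) : R := z ^ 3 / 3 + z ^ 4 / 12 + z ^ 5 / 20 + z ^ 6 / 30.

Lemma cube_ratio_incr (a d : R) : 0 < a -> a < d ->
  a ^ 2 * (a + 2) / 3 * (a / (1 + a)) <= d ^ 3 * (d + 2) / (3 * (1 + d)).
Proof.
  intros Ha Hd.
  replace (a ^ 2 * (a + 2) / 3 * (a / (1 + a))) with (a ^ 3 * (a + 2) / (3 * (1 + a)))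
    by (field; lra).
  assert (a ^ 3 <= d ^ 3) by (apply pow_incr; lra).
  assert (0 <= a ^ 2 * d * (d - a)) by (repeat apply Rmult_le_pos; try lra; apply pow2_ge_0).
  assert (a ^ 3 * (1 + d) <= d ^ 3 * (1 + a)).
  { nra. }
  assert (H3 : a ^ 3 * (a + 2) * (1 + d) <= d ^ 3 * (d + 2) * (1 + a)).
  { replace (a ^ 3 * (a + 2) * (1 + d)) with (a ^ 3 * ((1 + a) * (1 + d)) + a ^ 3 * (1 + d)) by ring.
    replace (d ^ 3 * (d + 2) * (1 + a)) with (d ^ 3 * ((1 + a) * (1 + d)) + d ^ 3 * (1 + a)) by ring.
    nra. }
  apply Rmult_le_reg_r with (3 * (1 + a) * (1 + d)); [ nra | ].
  replace (a ^ 3 * (a + 2) / (3 * (1 + a)) * (3 * (1 + a) * (1 + d)))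
    with (a ^ 3 * (a + 2) * (1 + d)) by (field; lra).
  replace (d ^ 3 * (d + 2) / (3 * (1 + d)) * (3 * (1 + a) * (1 + d)))
    with (d ^ 3 * (d + 2) * (1 + a)) by (field; lra). exact H3.
Qed.

(** A depth z = 1 - y costs at least the energy [ppoly z], while the available energy is at most m
    times an increasing function of a that bounds [Ffun p (1 + a)]. Hence z cannot be large compared
    with a: by [cube_ratio_incr], a < t z would contradict the numerical hypothesis. In the
    applications m is x or 2 - x. *)
Lemma slope_lower (a z m t : R) : 0 < a -> 0 < z -> 0 <= m -> 0 < t ->
  ppoly z <= a ^ 2 * (a + 2) / 3 * (a / (1 + a)) * m ->
  t ^ 3 * (t * z + 2) * m < 3 * (t * z + 1) * (/ 3 + z / 12 + z ^ 2 / 20 + z ^ 3 / 30) ->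
  t * z <= a.
Proof.
  intros Ha Hz Hm Ht H1 H2.
  destruct (Rle_dec (t * z) a) as [| Hn ]; [ assumption | exfalso ].
  assert (H3 := cube_ratio_incr a (t * z) Ha ltac:(lra)).
  apply (Rmult_le_compat_r m) in H3; [ | lra ].
  assert (H4 : ppoly z <= (t * z) ^ 3 * (t * z + 2) / (3 * (1 + t * z)) * m) by lra.
  assert (Hz3 : 0 < z ^ 3) by (apply pow_lt; lra).
  assert (E : (t * z) ^ 3 * (t * z + 2) / (3 * (1 + t * z)) * m
     = z ^ 3 * (t ^ 3 * (t * z + 2) * m) / (3 * (1 + t * z))) by (field; lra).
  assert (E2 : ppoly z = z ^ 3 * (3 * (t * z + 1) * (/ 3 + z / 12 + z ^ 2 / 20 + z ^ 3 / 30)) / (3 * (1 + t * z)))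
    by (unfold ppoly; field; lra).
  rewrite E, E2 in H4. unfold Rdiv in H4.
  apply Rmult_le_reg_r in H4; [ | apply Rinv_0_lt_compat; lra ].
  apply Rmult_le_reg_l in H4; lra.
Qed.

Lemma gain_of_slope (a d : R) : 0 < d <= a -> d ^ 2 * (d + 2) / 3 <= a ^ 2 * (a + 2) / 3.
Proof.
  intros Hd. assert (d ^ 2 <= a ^ 2) by (apply pow_incr; lra). nra.
Qed.

(** For x <= 1 the energy behind forces a >= 17/20 z. For x >= 1 the energy ahead is the smaller one
    and forces a lower bound on a/z that grows with x; this growth compensates the factor x on the
    left. *)
Lemma gain_large (a z x : R) : 0 < a -> 2 / 5 <= z <= 1 -> 0 <= x < 2 ->
  ppoly z <= a ^ 2 * (a + 2) / 3 * (a / (1 + a)) * x ->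
  ppoly z <= a ^ 2 * (a + 2) / 3 * (a / (1 + a)) * (2 - x) ->
  27 / 100 * x * z ^ 2 * (4 / 5 - 11 / 20 * z)
    <= 495 / 1000 * (a ^ 2 * (a + 2) / 3) * (1 - 4 / 5 * z).
Proof.
  intros Ha Hz Hx Hl Hr.
  destruct (Rle_dec x 1) as [Hx1 | Hx1].
  - assert (Hs : 17 / 20 * z <= a).
    { apply (slope_lower a z x (17 / 20)); try lra. nra. }
    assert (H := gain_of_slope a (17 / 20 * z) ltac:(lra)).
    apply Rle_trans with (27 / 100 * 1 * z ^ 2 * (4 / 5 - 11 / 20 * z)).
    { assert (0 <= z ^ 2 * (4 / 5 - 11 / 20 * z)) by nra. nra. }
    apply Rle_trans with (495 / 1000 * ((17 / 20 * z) ^ 2 * (17 / 20 * z + 2) / 3) * (1 - 4 / 5 * z));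
      [ | nra ].
    replace (27 / 100 * 1 * z ^ 2 * (4 / 5 - 11 / 20 * z))
      with (z ^ 2 * (27 / 100 * (4 / 5 - 11 / 20 * z))) by ring.
    replace (495 / 1000 * ((17 / 20 * z) ^ 2 * (17 / 20 * z + 2) / 3) * (1 - 4 / 5 * z))
      with (z ^ 2 * (165 / 1000 * (289 / 400) * (17 / 20 * z + 2) * (1 - 4 / 5 * z))) by field.
    apply Rmult_le_compat_l; [ apply pow2_ge_0 | nra ].
  (* An affine lower bound for a/z, matching 17/20 at x = 1. *)
  - set (t := 17 / 20 + 2 / 5 * (x - 1)).
    assert (Hxt : 2 - x = 5 / 2 * (5 / 4 - t)) by (unfold t; lra).
    assert (Hs : t * z <= a).
    { apply (slope_lower a z (2 - x) t); try lra.
      assert (Hg : t ^ 3 * (2 - x) <= 161 / 250).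
      { rewrite Hxt.
        (* 15/16 is the maximum point of t^3 (5/4 - t), whence the double root. *)
        assert (0 <= (t - 15 / 16) ^ 2 * (t ^ 2 + 5 / 8 * t + 1 / 4))
          by (apply Rmult_le_pos; [ apply pow2_ge_0 | nra ]). nra. }
      replace (t ^ 3 * (t * z + 2) * (2 - x)) with (t ^ 3 * (2 - x) * (t * z + 2)) by ring.
      apply Rle_lt_trans with (161 / 250 * (t * z + 2)).
      { apply Rmult_le_compat_r; nra. }
      assert (17 / 50 <= t * z) by nra.
      assert (471 / 1250 <= / 3 + z / 12 + z ^ 2 / 20 + z ^ 3 / 30) by nra.
      nra. }
    assert (H := gain_of_slope a (t * z) ltac:(nra)).
    apply Rle_trans with (495 / 1000 * ((t * z) ^ 2 * (t * z + 2) / 3) * (1 - 4 / 5 * z));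
      [ | nra ].
    replace (27 / 100 * x * z ^ 2 * (4 / 5 - 11 / 20 * z))
      with (z ^ 2 * (27 / 100 * x * (4 / 5 - 11 / 20 * z))) by ring.
    replace (495 / 1000 * ((t * z) ^ 2 * (t * z + 2) / 3) * (1 - 4 / 5 * z))
      with (z ^ 2 * (165 / 1000 * (t ^ 2 * (t * z + 2)) * (1 - 4 / 5 * z))) by field.
    apply Rmult_le_compat_l; [ apply pow2_ge_0 | ].
    (* [t ^ 2 (t z + 2)] grows faster than [x] *)
    apply Rle_trans with (x * (165 / 1000 * (289 / 400) * (17 / 20 * z + 2) * (1 - 4 / 5 * z))).
    + replace (27 / 100 * x * (4 / 5 - 11 / 20 * z))
        with (x * (27 / 100 * (4 / 5 - 11 / 20 * z))) by ring.
      apply Rmult_le_compat_l; [ lra | nra ].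
    + assert (289 / 400 * x * (17 / 20 * z + 2) <= t ^ 2 * (t * z + 2)).
      { set (w := x - 1). assert (0 <= w) by (unfold w; lra).
        replace t with (17 / 20 + 2 / 5 * w) by (unfold t, w; lra).
        replace x with (1 + w) by (unfold w; lra).
        assert (0 <= w * (z - 2 / 5)) by (apply Rmult_le_pos; lra).
        nra. }
      nra.
Qed.

(** The counterpart of the slope bounds in [gain_large] for small z, with a weaker constant 79/100.
    The deficit this leaves in the gain is of order z^3 and is paid by the energy terms. *)
Lemma slope_small (a z x : R) : 0 < a -> 0 < z <= 2 / 5 -> 0 <= x < 2 ->
  ppoly z <= a ^ 2 * (a + 2) / 3 * (a / (1 + a)) * x ->
  ppoly z <= a ^ 2 * (a + 2) / 3 * (a / (1 + a)) * (2 - x) ->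
  79 / 100 * z <= a /\ (1 <= x -> (79 / 100 + 3 / 10 * (x - 1)) * z <= a).
Proof.
  intros Ha Hz Hx Hl Hr.
  assert (Hb : 1 <= x -> (79 / 100 + 3 / 10 * (x - 1)) * z <= a).
  { intros Hx1. set (t := 79 / 100 + 3 / 10 * (x - 1)).
    assert (Hxt : 2 - x = 10 / 3 * (109 / 100 - t)) by (unfold t; lra).
    apply (slope_lower a z (2 - x) t); try lra.
    assert (Hg : t ^ 3 * (2 - x) <= 499 / 1000).
    { rewrite Hxt.
      (* 327/400 is the maximum point of t^3 (109/100 - t). *)
      assert (0 <= (t - 327 / 400) ^ 2 * (t ^ 2 + 109 / 200 * t + 22 / 100))
        by (apply Rmult_le_pos; [ apply pow2_ge_0 | nra ]). nra. }
    replace (t ^ 3 * (t * z + 2) * (2 - x)) with (t ^ 3 * (2 - x) * (t * z + 2)) by ring.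
    apply Rle_lt_trans with (499 / 1000 * (t * z + 2)).
    { apply Rmult_le_compat_r; nra. }
    assert (0 <= t * z) by nra.
    assert (0 <= z ^ 3) by (apply pow_le; lra).
    nra. }
  split; [ | exact Hb ].
  destruct (Rle_dec x 1) as [Hx1 | Hx1].
  - apply (slope_lower a z x (79 / 100)); try lra.
    nra.
  - specialize (Hb ltac:(lra)). nra.
Qed.

Lemma derive_nonpos_ge (f df : R -> R) (a b : R) :
  a <= b -> (forall x, a <= x <= b -> is_derive f x (df x)) ->
  (forall x, a <= x <= b -> df x <= 0) -> f b <= f a.
Proof.
  intros ab Hd Hp.
  enough (- f a <= - f b) by lra.
  apply (derive_nonneg_le (fun x => - f x) (fun x => - df x)); auto.
  - intros x Hx; apply (is_derive_opp f x (df x)); auto.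
  - intros x Hx; specialize (Hp x Hx); lra.
Qed.

Lemma Rpower_neg_ge1 (p y : R) : 0 <= p -> 0 < y <= 1 -> 1 <= Rpower y (- p).
Proof.
  intros Hp Hy. assert (H := Rpower_neg_le p y 1 Hp ltac:(lra)).
  unfold Rpower at 1 in H; rewrite ln_1, Rmult_0_r, exp_0 in H; exact H.
Qed.

Lemma Rpower_mult_base (p y : R) : 0 < y -> y * Rpower y (- p) = Rpower y (1 - p).
Proof. intros Hy; unfold Rminus; rewrite Rpower_plus, Rpower_1; auto. Qed.

Lemma Rpower_le1_neg (p y : R) : 0 < y <= 1 -> p <= 0 -> 1 <= Rpower y p.
Proof. intros; rewrite <- (Ropp_involutive p); apply Rpower_neg_ge1; lra. Qed.

Lemma Rpower_le1_pos (p y : R) : 0 < y <= 1 -> 0 <= p -> Rpower y p <= 1.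
Proof.
  intros Hy Hp. assert (H := Rpower_neg_ge1 p y Hp Hy). rewrite Rpower_Ropp in H.
  assert (H1 := Rpower_pos y p).
  apply Rmult_le_reg_l with (/ Rpower y p); [ now apply Rinv_0_lt_compat | ].
  rewrite Rinv_l; lra.
Qed.

Lemma qint_lower_lt1 (p y : R) : 0 < p <= 1 -> 0 < y <= 1 ->
  (1 - y) ^ 2 * Rpower y (- p) <= qint p y.
Proof.
  intros Hp Hy.
  enough (qint p 1 - (1 - 1) ^ 2 * Rpower 1 (- p) <= qint p y - (1 - y) ^ 2 * Rpower y (- p))
    by (rewrite qint_1 in H; lra).
  apply (derive_nonpos_ge (fun z => qint p z - (1 - z) ^ 2 * Rpower z (- p))
    (fun z => qden p z - Rpower z (- p) * (- 2 * (1 - z) - p * (1 - z) ^ 2 / z))); [ lra | | ].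
  - intros z Hz. apply (D_minus (qint p) (fun z => (1 - z) ^ 2 * Rpower z (- p))).
    + apply is_derive_qint; lra.
    + apply (is_derive_weighted p (fun z => (1 - z) ^ 2)); [ lra | ].
      auto_derive; [ trivial | toR; ring ].
  - intros z Hz; rewrite qden_eq by lra. assert (H1 := Rpower_pos z (- p)).
    replace ((z ^ 2 - 1) * Rpower z (- p) / z
      - Rpower z (- p) * (-2 * (1 - z) - p * (1 - z) ^ 2 / z))
      with (- ((1 - p) * (1 - z) ^ 2 * (Rpower z (- p) / z))) by (field; lra).
    assert (0 <= (1 - p) * (1 - z) ^ 2 * (Rpower z (- p) / z)); [ | lra ].
    apply Rmult_le_pos; [ apply Rmult_le_pos; [ lra | apply pow2_ge_0 ] | ].
    apply Rdiv_le_0_compat; lra.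
Qed.

Lemma qint_lower_lt1' (p y : R) : 0 < p <= 2 -> 0 < y <= 1 ->
  / 2 * (1 - y) ^ 2 * Rpower y (- p) <= qint p y.
Proof.
  intros Hp Hy.
  enough (qint p 1 - / 2 * (1 - 1) ^ 2 * Rpower 1 (- p) <= qint p y - / 2 * (1 - y) ^ 2 * Rpower y (- p))
    by (rewrite qint_1 in H; lra).
  apply (derive_nonpos_ge (fun z => qint p z - / 2 * (1 - z) ^ 2 * Rpower z (- p))
    (fun z => qden p z - Rpower z (- p) * (- (1 - z) - p * (/ 2 * (1 - z) ^ 2) / z))); [ lra | | ].
  - intros z Hz. apply (D_minus (qint p) (fun z => / 2 * (1 - z) ^ 2 * Rpower z (- p))).
    + apply is_derive_qint; lra.
    + apply (is_derive_weighted p (fun z => / 2 * (1 - z) ^ 2)); [ lra | ].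
      auto_derive; [ trivial | toR; field ].
  - intros z Hz; rewrite qden_eq by lra. assert (H1 := Rpower_pos z (- p)).
    replace ((z ^ 2 - 1) * Rpower z (- p) / z
      - Rpower z (- p) * (- (1 - z) - p * (/ 2 * (1 - z) ^ 2) / z))
      with (- ((1 - z) * (1 - p / 2 + p / 2 * z) * (Rpower z (- p) / z))) by (field; lra).
    assert (0 <= (1 - z) * (1 - p / 2 + p / 2 * z) * (Rpower z (- p) / z)); [ | lra ].
    apply Rmult_le_pos; [ apply Rmult_le_pos; nra | ].
    apply Rdiv_le_0_compat; lra.
Qed.

(** Equality holds for p = 1, and below y = 1 the function [qint p y] increases with p. *)
Lemma qint_lower_lt1_inv (p y : R) : 1 <= p -> 0 < y <= 1 -> (1 - y) ^ 2 / y <= qint p y.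
Proof.
  intros Hp Hy.
  enough (qint p 1 - (1 - 1) ^ 2 / 1 <= qint p y - (1 - y) ^ 2 / y)
    by (rewrite qint_1 in H; lra).
  apply (derive_nonpos_ge (fun z => qint p z - (1 - z) ^ 2 / z)
    (fun z => qden p z - (- (1 - z ^ 2) / z ^ 2))); [ lra | | ].
  - intros z Hz. apply (D_minus (qint p) (fun z => (1 - z) ^ 2 / z)).
    + apply is_derive_qint; lra.
    + auto_derive; [ lra | toR; field; lra ].
  - intros z Hz; rewrite qden_eq by lra.
    assert (H1 := Rpower_le1_neg (1 - p) z ltac:(lra) ltac:(lra)).
    rewrite <- Rpower_mult_base in H1 by lra.
    replace ((z ^ 2 - 1) * Rpower z (- p) / z - - (1 - z ^ 2) / z ^ 2)
      with (- ((1 - z ^ 2) * (z * Rpower z (- p) - 1) / z ^ 2)) by (field; lra).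
    assert (0 <= (1 - z ^ 2) * (z * Rpower z (- p) - 1) / z ^ 2); [ | lra ].
    apply Rdiv_le_0_compat; [ apply Rmult_le_pos; nra | nra ].
Qed.

Lemma Qint_lower_lt1 (p y : R) : 0 < p -> 0 < y <= 1 -> ppoly (1 - y) <= - Qint p y.
Proof.
  intros Hp Hy.
  set (dp := fun z : R => z ^ 2 + z ^ 3 / 3 + z ^ 4 / 4 + z ^ 5 / 5).
  assert (Hq : forall s, 0 < s <= 1 -> dp (1 - s) <= qint p s).
  { intros s Hs.
    enough (qint p 1 - dp (1 - 1) <= qint p s - dp (1 - s))
      by (rewrite qint_1 in H; unfold dp in *; lra).
    apply (derive_nonpos_ge (fun z => qint p z - dp (1 - z))
      (fun z => qden p z - - (2 * (1 - z) + (1 - z) ^ 2 + (1 - z) ^ 3 + (1 - z) ^ 4))); [ lra | | ].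
    - intros z Hz. apply (D_minus (qint p) (fun z => dp (1 - z))).
      + apply is_derive_qint; lra.
      + unfold dp; auto_derive; [ trivial | toR; field ].
    - intros z Hz; rewrite qden_eq by lra.
      assert (H1 := Rpower_neg_ge1 p z ltac:(lra) ltac:(lra)).
      assert (Ew : exists w, z = 1 - w) by (exists (1 - z); ring). destruct Ew as [w ->].
      replace (1 - (1 - w)) with w by ring.
      set (Y := Rpower (1 - w) (- p)) in *.
      assert (H2 : w * (2 - w) / (1 - w) <= w * (2 - w) / (1 - w) * Y).
      { assert (0 <= w * (2 - w) / (1 - w)) by (apply Rdiv_le_0_compat; nra). nra. }
      replace (((1 - w) ^ 2 - 1) * Y / (1 - w)) with (- (w * (2 - w) / (1 - w) * Y)) by (field; lra).
      assert (H3 : w * (2 - w) / (1 - w) - (2 * w + w ^ 2 + w ^ 3 + w ^ 4) = w ^ 5 / (1 - w))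
        by (field; lra).
      assert (0 <= w ^ 5 / (1 - w)) by (apply Rdiv_le_0_compat; [ apply pow_le; lra | lra ]).
      lra. }
  enough (- Qint p 1 - ppoly (1 - 1) <= - Qint p y - ppoly (1 - y))
    by (rewrite Qint_1 in H; unfold ppoly in *; lra).
  apply (derive_nonpos_ge (fun z => - Qint p z - ppoly (1 - z))
    (fun z => - qint p z - - dp (1 - z))); [ lra | | ].
  - intros z Hz. apply (D_minus (fun z => - Qint p z) (fun z => ppoly (1 - z))).
    + apply (is_derive_opp (Qint p)), is_derive_Qint; lra.
    + unfold ppoly, dp; auto_derive; [ trivial | toR; field ].
  - intros z Hz. assert (H := Hq z ltac:(lra)). lra.
Qed.

(** After division by y^(-p) this reads y^p <= 1 - p (1 - y), the tangent bound at 1 for the concave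
    function y^p. *)
Lemma Rpower_neg_concave (p y : R) : 0 < p <= 1 -> 0 < y <= 1 ->
  p * (1 - y) * Rpower y (- p) <= Rpower y (- p) - 1.
Proof.
  intros Hp Hy.
  enough ((1 - p * (1 - 1)) * Rpower 1 (- p) <= (1 - p * (1 - y)) * Rpower y (- p)).
  { rewrite Rminus_diag, Rmult_0_r, Rminus_0_r, Rmult_1_l in H.
    unfold Rpower at 1 in H; rewrite ln_1, Rmult_0_r, exp_0 in H. lra. }
  apply (derive_nonpos_ge (fun z => (1 - p * (1 - z)) * Rpower z (- p))
    (fun z => Rpower z (- p) * (p - p * (1 - p * (1 - z)) / z))); [ lra | | ].
  - intros z Hz. apply (is_derive_weighted p (fun z => 1 - p * (1 - z))); [ lra | ].
    auto_derive; [ trivial | toR; ring ].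
  - intros z Hz. assert (H1 := Rpower_pos z (- p)).
    replace (p - p * (1 - p * (1 - z)) / z) with (- (p * (1 - p) * (1 - z) / z)) by (field; lra).
    assert (0 <= p * (1 - p) * (1 - z) / z); [ | nra ].
    apply Rdiv_le_0_compat; [ | lra ]. repeat apply Rmult_le_pos; lra.
Qed.

(** As y tends to 0, y^p [qint p y] tends to 1/p. So the constant 1 in [theta_qint] is out of reach
    for p > 1, and 1/2 is the limit value for p = 2. *)
Definition theta (p : R) : R := if Rle_dec p 1 then 1 else / 2.

Lemma theta_qint (p y : R) : 0 < p <= 2 -> 0 < y <= 1 ->
  theta p * (1 - y) ^ 2 * Rpower y (- p) <= qint p y.
Proof.
  intros Hp Hy; unfold theta; destruct (Rle_dec p 1).
  - rewrite Rmult_1_l; apply qint_lower_lt1; lra.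
  - now apply qint_lower_lt1'.
Qed.

(* The total of the terms carrying the factor [Y z] can only be negative for small [z],
   where [Y] is close to 1 and the energy terms [F], [P] take over. *)
Lemma lt1_poly_small_p (a z x Y F P : R) : 0 < a -> 0 < z < 1 -> 0 <= x < 2 ->
  1 <= Y -> Y * (1 - z) <= 1 ->
  ppoly z <= P -> P <= F * x -> P <= F * (2 - x) ->
  F <= a ^ 2 * (a + 2) / 3 * (a / (1 + a)) ->
  27 / 100 * x * (/ 5 * (F * x - P) + Y * z ^ 3 * (4 / 5 - 11 / 20 * z) / (1 - 4 / 5 * z))
  <= / 2 * (99 / 100 * (a ^ 2 * (a + 2) / 3) * (z * Y) + F * (1 - 27 / 200 * x ^ 2)).
Proof.
  intros Ha Hz Hx HY HYz HP HPl HPr HF.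
  set (A := a ^ 2 * (a + 2) / 3) in *.
  assert (Hp3 : z ^ 3 / 3 <= ppoly z).
  { unfold ppoly. assert (0 <= z ^ 4) by (apply pow_le; lra).
    assert (0 <= z ^ 5) by (apply pow_le; lra). assert (0 <= z ^ 6) by (apply pow_le; lra). lra. }
  assert (Hz3 : 0 < z ^ 3) by (apply pow_lt; lra).
  assert (HF0 : 0 <= F) by nra.
  set (w := (4 / 5 - 11 / 20 * z) / (1 - 4 / 5 * z)).
  replace (Y * z ^ 3 * (4 / 5 - 11 / 20 * z) / (1 - 4 / 5 * z)) with (Y * z ^ 3 * w)
    by (unfold w; field; lra).
  assert (Hcoef : 27 / 200 * 9 / 10 * (4 - x ^ 2) <= / 2 - 27 / 400 * x ^ 2 - 27 / 500 * x ^ 2) by nra.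
  enough (0 <= Y * z * (99 / 200 * A - 27 / 100 * x * z ^ 2 * w)
     + F * (/ 2 - 27 / 400 * x ^ 2 - 27 / 500 * x ^ 2) + 27 / 500 * x * P) by nra.
  assert (Hx2 : 0 <= 4 - x ^ 2) by nra.
  assert (HFl : ppoly z <= A * (a / (1 + a)) * x) by nra.
  assert (HFr : ppoly z <= A * (a / (1 + a)) * (2 - x)) by nra.
  destruct (Rle_dec (2 / 5) z) as [Hz4 | Hz4].
  - assert (H := gain_large a z x Ha ltac:(lra) Hx HFl HFr). fold A in H.
    assert (0 <= 99 / 200 * A - 27 / 100 * x * z ^ 2 * w).
    { enough (27 / 100 * x * z ^ 2 * w <= 99 / 200 * A) by lra.
      apply Rmult_le_reg_r with (1 - 4 / 5 * z); [ lra | ].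
      replace (27 / 100 * x * z ^ 2 * w * (1 - 4 / 5 * z))
        with (27 / 100 * x * z ^ 2 * (4 / 5 - 11 / 20 * z)) by (unfold w; field; lra). lra. }
    assert (0 <= Y * z * (99 / 200 * A - 27 / 100 * x * z ^ 2 * w))
      by (repeat apply Rmult_le_pos; lra).
    assert (0 <= F * (/ 2 - 27 / 400 * x ^ 2 - 27 / 500 * x ^ 2)) by (apply Rmult_le_pos; lra).
    assert (0 <= 27 / 500 * x * P) by (apply Rmult_le_pos; lra). lra.
  - destruct (slope_small a z x Ha ltac:(lra) Hx HFl HFr) as [Hs Hs'].
    assert (Hw : w <= 8531 / 10000).
    { unfold w. apply Rmult_le_reg_r with (1 - 4 / 5 * z); [ lra | ].
      unfold Rdiv at 1; rewrite Rmult_assoc, Rinv_l by lra. lra. }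
    assert (HY2 : Y <= 5 / 3) by nra.
    destruct (Rle_dec x 1) as [Hx1 | Hx1].
    + assert (HA := gain_of_slope a (79 / 100 * z) ltac:(lra)). fold A in HA.
      assert (Hb : - (1 / 40) * z ^ 2 <= 99 / 200 * A - 27 / 100 * x * z ^ 2 * w).
      { assert (0 <= z ^ 2) by nra.
        assert (x * z ^ 2 * w <= 8531 / 10000 * z ^ 2).
        { assert (0 <= x * z ^ 2 <= z ^ 2) by (split; [ apply Rmult_le_pos; lra | nra ]). nra. }
        nra. }
      assert (- (1 / 24) * z ^ 3 <= Y * z * (99 / 200 * A - 27 / 100 * x * z ^ 2 * w)).
      { apply Rle_trans with (Y * z * (- (1 / 40) * z ^ 2)).
        - replace (Y * z * (- (1 / 40) * z ^ 2)) with (- (1 / 40) * (Y * z ^ 3)) by ring. nra.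
        - apply Rmult_le_compat_l; [ apply Rmult_le_pos; lra | lra ]. }
      assert (F * (3 / 8) <= F * (/ 2 - 27 / 400 * x ^ 2 - 27 / 500 * x ^ 2))
        by (apply Rmult_le_compat_l; nra).
      assert (0 <= 27 / 500 * x * P) by (apply Rmult_le_pos; lra). lra.
    + set (t := 79 / 100 + 3 / 10 * (x - 1)) in *.
      assert (Ht : 0 < t) by (unfold t; lra).
      assert (HA := gain_of_slope a (t * z) ltac:(split; [ nra | apply Hs'; lra ])). fold A in HA.
      set (k := 27 / 100 * x * (8531 / 10000) - 33 / 100 * t ^ 2).
      assert (Hk : k <= 3 / 5 * (81 / 1000 + 585 / 10000 * x)) by (unfold k, t; nra).
      assert (Hb : - k * z ^ 2 <= 99 / 200 * A - 27 / 100 * x * z ^ 2 * w).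
      { assert (0 <= z ^ 2) by nra.
        assert (27 / 100 * x * z ^ 2 * w <= 27 / 100 * x * (8531 / 10000) * z ^ 2).
        { assert (0 <= 27 / 100 * x * z ^ 2) by (apply Rmult_le_pos; lra). nra. }
        assert (2 / 3 * t ^ 2 * z ^ 2 <= (t * z) ^ 2 * (t * z + 2) / 3).
        { assert (0 <= (t * z) ^ 2 * (t * z)) by (apply Rmult_le_pos; nra). nra. }
        unfold k; nra. }
      assert (Hmain : - (81 / 1000 + 585 / 10000 * x) * z ^ 3
         <= Y * z * (99 / 200 * A - 27 / 100 * x * z ^ 2 * w)).
      { apply Rle_trans with (Y * z * (- k * z ^ 2)).
        - replace (Y * z * (- k * z ^ 2)) with (- (k * Y) * z ^ 3) by ring.
          apply Rmult_le_compat_r; [ lra | ].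
          destruct (Rle_dec k 0); nra.
        - apply Rmult_le_compat_l; [ apply Rmult_le_pos; lra | lra ]. }
      nra.
Qed.

(** The counterpart for p > 1. There Y (1 - z) may exceed 1 and only Y (1 - z)^2 <= 1 is available,
    and [theta] = 1/2 doubles the cost of the velocity. In exchange 1/2 + 3p/4 is at least 5/4. *)
Lemma lt1_poly_large_p (a z x Y F P : R) : 0 < a -> 0 < z < 1 -> 0 <= x < 2 ->
  1 <= Y -> Y * (1 - z) ^ 2 <= 1 ->
  ppoly z <= P -> P <= F * x -> P <= F * (2 - x) ->
  F <= a ^ 2 * (a + 2) / 3 * (a / (1 + a)) ->
  27 / 100 * x * (2 / 5 * (F * x - P)
     + Y * z ^ 3 * (9 / 5 - 47 / 20 * z + 4 / 5 * z ^ 2) / (1 - 4 / 5 * z))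
  <= 99 / 100 * (a ^ 2 * (a + 2) / 3) * (z * Y) + 5 / 4 * F * (1 - 27 / 200 * x ^ 2).
Proof.
  intros Ha Hz Hx HY HYz HP HPl HPr HF.
  set (A := a ^ 2 * (a + 2) / 3) in *.
  assert (Hp3 : z ^ 3 / 3 <= ppoly z).
  { unfold ppoly. assert (0 <= z ^ 4) by (apply pow_le; lra).
    assert (0 <= z ^ 5) by (apply pow_le; lra). assert (0 <= z ^ 6) by (apply pow_le; lra). lra. }
  assert (Hz3 : 0 < z ^ 3) by (apply pow_lt; lra).
  assert (HF0 : 0 <= F) by nra.
  set (w := (9 / 5 - 47 / 20 * z + 4 / 5 * z ^ 2) / (1 - 4 / 5 * z)).
  replace (Y * z ^ 3 * (9 / 5 - 47 / 20 * z + 4 / 5 * z ^ 2) / (1 - 4 / 5 * z)) with (Y * z ^ 3 * w)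
    by (unfold w; field; lra).
  set (co := 5 / 4 - 27 / 160 * x ^ 2 - 27 / 250 * x ^ 2).
  assert (Hcoef : 27675 / 100000 * (4 - x ^ 2) + 143 / 1000 <= co) by (unfold co; nra).
  enough (0 <= Y * z * (99 / 100 * A - 27 / 100 * x * z ^ 2 * w)
     + F * co + 27 / 250 * x * P) by (unfold co in *; nra).
  assert (Hx2 : 0 <= 4 - x ^ 2) by nra.
  assert (HFl : ppoly z <= A * (a / (1 + a)) * x) by nra.
  assert (HFr : ppoly z <= A * (a / (1 + a)) * (2 - x)) by nra.
  destruct (Rle_dec (2 / 5) z) as [Hz4 | Hz4].
  - assert (H := gain_large a z x Ha ltac:(lra) Hx HFl HFr). fold A in H.
    assert (0 <= 99 / 100 * A - 27 / 100 * x * z ^ 2 * w).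
    { enough (27 / 100 * x * z ^ 2 * w <= 99 / 100 * A) by lra.
      apply Rmult_le_reg_r with (1 - 4 / 5 * z); [ lra | ].
      replace (27 / 100 * x * z ^ 2 * w * (1 - 4 / 5 * z))
        with (27 / 100 * x * z ^ 2 * (9 / 5 - 47 / 20 * z + 4 / 5 * z ^ 2)) by (unfold w; field; lra).
      assert (9 / 5 - 47 / 20 * z + 4 / 5 * z ^ 2 <= 2 * (4 / 5 - 11 / 20 * z)) by nra.
      assert (0 <= 27 / 100 * x * z ^ 2) by (apply Rmult_le_pos; nra). nra. }
    assert (0 <= Y * z * (99 / 100 * A - 27 / 100 * x * z ^ 2 * w))
      by (repeat apply Rmult_le_pos; lra).
    assert (0 <= F * co) by (apply Rmult_le_pos; lra).
    assert (0 <= 27 / 250 * x * P) by (apply Rmult_le_pos; lra). lra.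
  - destruct (slope_small a z x Ha ltac:(lra) Hx HFl HFr) as [Hs Hs'].
    assert (Hw : w <= 9 / 5).
    { unfold w. apply Rmult_le_reg_r with (1 - 4 / 5 * z); [ lra | ].
      unfold Rdiv at 1; rewrite Rmult_assoc, Rinv_l by lra. nra. }
    assert (HY2 : Y <= 25 / 9).
    { nra. }
    destruct (Rle_dec x 1) as [Hx1 | Hx1].
    + assert (HA := gain_of_slope a (79 / 100 * z) ltac:(lra)). fold A in HA.
      assert (Hb : - (3 / 40) * z ^ 2 <= 99 / 100 * A - 27 / 100 * x * z ^ 2 * w).
      { assert (0 <= z ^ 2) by nra.
        assert (x * z ^ 2 * w <= 9 / 5 * z ^ 2).
        { assert (0 <= x * z ^ 2 <= z ^ 2) by (split; [ apply Rmult_le_pos; lra | nra ]). nra. }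
        nra. }
      assert (- (5 / 24) * z ^ 3 <= Y * z * (99 / 100 * A - 27 / 100 * x * z ^ 2 * w)).
      { apply Rle_trans with (Y * z * (- (3 / 40) * z ^ 2)).
        - replace (Y * z * (- (3 / 40) * z ^ 2)) with (- (3 / 40) * (Y * z ^ 3)) by ring. nra.
        - apply Rmult_le_compat_l; [ apply Rmult_le_pos; lra | lra ]. }
      assert (F * (9 / 10) <= F * co) by (apply Rmult_le_compat_l; [ lra | unfold co; nra ]).
      assert (0 <= 27 / 250 * x * P) by (apply Rmult_le_pos; lra). lra.
    + set (t := 79 / 100 + 3 / 10 * (x - 1)) in *.
      assert (Ht : 0 < t) by (unfold t; lra).
      assert (HA := gain_of_slope a (t * z) ltac:(split; [ nra | apply Hs'; lra ])). fold A in HA.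
      set (k := 27 / 100 * x * (9 / 5) - 66 / 100 * t ^ 2).
      set (g := 27675 / 100000 * (2 + x) + 143 / 1000 * x + 27 / 250 * x).
      assert (Hk : k <= 3 / 25 * g) by (unfold k, t, g; nra).
      assert (Hg : 0 <= g) by (unfold g; lra).
      assert (Hb : - k * z ^ 2 <= 99 / 100 * A - 27 / 100 * x * z ^ 2 * w).
      { assert (0 <= z ^ 2) by nra.
        assert (27 / 100 * x * z ^ 2 * w <= 27 / 100 * x * (9 / 5) * z ^ 2).
        { assert (0 <= 27 / 100 * x * z ^ 2) by (apply Rmult_le_pos; lra). nra. }
        assert (2 / 3 * t ^ 2 * z ^ 2 <= (t * z) ^ 2 * (t * z + 2) / 3).
        { assert (0 <= (t * z) ^ 2 * (t * z)) by (apply Rmult_le_pos; nra). nra. }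
        unfold k; nra. }
      assert (Hmain : - (g / 3) * z ^ 3
         <= Y * z * (99 / 100 * A - 27 / 100 * x * z ^ 2 * w)).
      { apply Rle_trans with (Y * z * (- k * z ^ 2)).
        - replace (Y * z * (- k * z ^ 2)) with (- (k * Y) * z ^ 3) by ring.
          apply Rmult_le_compat_r; [ lra | ].
          destruct (Rle_dec k 0); nra.
        - apply Rmult_le_compat_l; [ apply Rmult_le_pos; lra | lra ]. }
      assert (P * x <= F).
      { nra. }
      assert (g * P <= F * co + 27 / 250 * x * P) by (unfold g; nra).
      assert (g * (z ^ 3 / 3) <= g * P) by (apply Rmult_le_compat_l; lra). lra.
Qed.

Lemma Ffun_pos (p b : R) : 1 < b -> 0 < Ffun p b.
Proof.
  intros Hb; unfold Ffun. assert (0 < / b) by (apply Rinv_0_lt_compat; lra).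
  assert (HR := Rpower_pos b (- p)).
  apply Rdiv_lt_0_compat; [ | lra ]. repeat apply Rmult_lt_0_compat; lra.
Qed.

Lemma qint_nonneg_lt1 (p y : R) : 0 < p <= 2 -> 0 < y <= 1 -> 0 <= qint p y.
Proof.
  intros Hp Hy. eapply Rle_trans; [ | now apply qint_lower_lt1' ].
  assert (HR := Rpower_pos y (- p)).
  repeat apply Rmult_le_pos; lra.
Qed.

(** Below the rest state the swept energy may be negative, for [nu] of the unfavourable sign. Its
    negative part [S] is split: the part quadratic in [nu] is paid by the velocity bound on the
    energy behind, the rest by y^(-p) - 1, which is large when y is small. One hundredth of y^(-p) -
    1 is set aside for [decline_sqrt]. *)
Lemma weight_ineq_lt1 (p a x y nu : R) : 0 < p <= 2 -> 0 < a -> 0 <= x <= 2 -> 0 < y < 1 ->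
  theta p * nu ^ 2 * (1 - y) - Qint p y <= Ffun p (1 + a) * x ->
  - Qint p y <= Ffun p (1 + a) * (2 - x) ->
  (/ 2 + 3 / 4 * p) * Ffun p (1 + a) *
    (Rpower (1 + a) (- p) + 27 / 200 * (p * a * Rpower (1 + a) (- p) / (1 + a)) * x ^ 2
     - Rpower y (- p) + / 100 * (Rpower y (- p) - 1))
  <= 2 * (27 / 200) * x * (p * a * Rpower (1 + a) (- p) / (1 + a)) *
     (y * nu ^ 2 + y * qint p y - nu * (1 - y ^ 2) * Rpower y (- (p / 2))).
Proof.
  intros Hp Ha Hx Hy Hl Hr.
  assert (HFp := Ffun_pos p (1 + a) ltac:(lra)).
  assert (HY := Rpower_pos (1 + a) (- p)).
  assert (HY1 := Rpower_neg_ge1 p y ltac:(lra) ltac:(lra)).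
  assert (HYb : Rpower (1 + a) (- p) <= 1).
  { assert (HR := Rpower_neg_le p 1 (1 + a) ltac:(lra) ltac:(lra)).
    unfold Rpower at 2 in HR; rewrite ln_1, Rmult_0_r, exp_0 in HR; exact HR. }
  assert (Htan := Rpower_neg_tangent p (1 + a) 1 ltac:(lra) ltac:(lra) ltac:(lra)).
  replace (Rpower 1 (- p)) with 1 in Htan by (unfold Rpower; rewrite ln_1, Rmult_0_r, exp_0; auto).
  assert (HW : Rpower y (- (p / 2)) * Rpower y (- (p / 2)) = Rpower y (- p))
    by (rewrite <- Rpower_plus; f_equal; field).
  assert (HP := Qint_lower_lt1 p y ltac:(lra) ltac:(lra)).
  assert (Hz3 : 0 < ppoly (1 - y)).
  { unfold ppoly. assert (0 < 1 - y) by lra.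
    assert (0 < (1 - y) ^ 3) by (now apply pow_lt). assert (0 < (1 - y) ^ 4) by (now apply pow_lt).
    assert (0 < (1 - y) ^ 5) by (now apply pow_lt). assert (0 < (1 - y) ^ 6) by (now apply pow_lt).
    lra. }
  (* x = 2 would leave no energy ahead, whereas a value y < 1 forces a positive amount on that
     side. *)
  assert (Hx2 : 0 <= x < 2).
  { split; [ lra | ]. destruct (Req_dec x 2) as [-> | ]; [ | lra ].
    rewrite Rminus_diag, Rmult_0_r in Hr. lra. }
  set (P := - Qint p y) in *. set (F := Ffun p (1 + a)) in *.
  set (Yb := Rpower (1 + a) (- p)) in *. set (Y := Rpower y (- p)) in *.
  set (W := Rpower y (- (p / 2))) in *.
  set (A := a ^ 2 * (a + 2) / 3).
  set (D := p * a * Yb / (1 + a)).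
  assert (HD : 0 < D) by (unfold D; apply Rdiv_lt_0_compat; [ repeat apply Rmult_lt_0_compat | ]; lra).
  assert (HFD : F = D * (A / p)) by (unfold F, Ffun, D, A; fold Yb; field; lra).
  assert (HFA : F <= A * (a / (1 + a))).
  { replace F with (A * (a / (1 + a)) * Yb) by (unfold F, Ffun, A; fold Yb; field; lra).
    rewrite <- (Rmult_1_r (A * (a / (1 + a)))) at 2. apply Rmult_le_compat_l; [ | lra ].
    unfold A; apply Rmult_le_pos; [ | apply Rdiv_le_0_compat; lra ].
    apply Rdiv_le_0_compat; [ | lra ]. apply Rmult_le_pos; [ apply pow2_ge_0 | lra ]. }
  replace (Yb * (1 - p * (1 - (1 + a)) / (1 + a))) with (Yb + D) in Htan
    by (unfold D; field; lra).
  set (H0 := / 2 + 3 / 4 * p). assert (HH0 : 0 < H0) by (unfold H0; lra).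
  set (S := nu * (1 - y ^ 2) * W - y * nu ^ 2 - y * qint p y).
  (* The factor D is divided out through F = D (A / p); 99/100 is what remains of y^(-p) - 1 after
     the reserve, and convexity gives (1 + a)^(-p) <= 1 - D. *)
  enough (Hmain : 27 / 100 * x * S
     <= H0 * (99 / 100 * (A / p) * (Y - 1) + F * (1 - 27 / 200 * x ^ 2))).
  { apply (Rmult_le_compat_l D) in Hmain; [ | lra ].
    assert (H0 * F * (D * (1 - 27 / 200 * x ^ 2)) <= H0 * F * (1 - Yb - 27 / 200 * D * x ^ 2)).
    { apply Rmult_le_compat_l; [ apply Rmult_le_pos; lra | lra ]. }
    unfold S in Hmain; nra. }
  set (z := 1 - y) in *. assert (Hz : 0 < z < 1) by (unfold z; lra).
  assert (Hy' : y = 1 - z) by (unfold z; ring).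
  (* AM-GM with weight [y + z / 5] *)
  assert (HS : S <= / 5 * z * nu ^ 2 + (z ^ 2 * (2 - z) ^ 2 / 4 * Y / (1 - 4 / 5 * z) - y * qint p y)).
  { unfold S. enough (nu * (1 - y ^ 2) * W <= (1 - 4 / 5 * z) * nu ^ 2
       + z ^ 2 * (2 - z) ^ 2 / 4 * Y / (1 - 4 / 5 * z)) by (rewrite Hy' in *; nra).
    assert (E : (1 - 4 / 5 * z) * nu ^ 2 + z ^ 2 * (2 - z) ^ 2 / 4 * Y / (1 - 4 / 5 * z)
       - nu * (1 - y ^ 2) * W
       = (1 - 4 / 5 * z) * (nu - z * (2 - z) / 2 * W / (1 - 4 / 5 * z)) ^ 2).
    { rewrite <- HW, Hy'. field; lra. }
    assert (0 <= (1 - 4 / 5 * z) * (nu - z * (2 - z) / 2 * W / (1 - 4 / 5 * z)) ^ 2)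
      by (apply Rmult_le_pos; [ lra | apply pow2_ge_0 ]).
    lra. }
  assert (Hc2 : 0 <= 1 - 27 / 200 * x ^ 2) by nra.
  assert (HA : 0 <= A).
  { unfold A; apply Rdiv_le_0_compat; [ | lra ]. apply Rmult_le_pos; [ apply pow2_ge_0 | lra ]. }
  unfold theta in Hl. destruct (Rle_dec p 1) as [Hp1 | Hp1].
  - assert (Hq := qint_lower_lt1 p y ltac:(lra) ltac:(lra)). fold Y z in Hq.
    assert (HYy : Y * (1 - z) <= 1).
    { rewrite <- Hy', Rmult_comm. unfold Y. rewrite Rpower_mult_base by lra.
      apply Rpower_le1_pos; lra. }
    assert (HP2 : P <= F * x).
    { assert (0 <= nu ^ 2 * z) by (apply Rmult_le_pos; [ apply pow2_ge_0 | lra ]). unfold P; lra. }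
    assert (K := lt1_poly_small_p a z x Y F P Ha Hz Hx2 HY1 HYy HP HP2 Hr HFA). fold A in K.
    assert (Hcv := Rpower_neg_concave p y ltac:(lra) ltac:(lra)). fold Y z in Hcv.
    assert (HT : z ^ 2 * (2 - z) ^ 2 / 4 * Y / (1 - 4 / 5 * z) - y * qint p y
        <= Y * z ^ 3 * (4 / 5 - 11 / 20 * z) / (1 - 4 / 5 * z)).
    { assert (E : z ^ 2 * (2 - z) ^ 2 / 4 * Y / (1 - 4 / 5 * z) - y * (z ^ 2 * Y)
        = Y * z ^ 3 * (4 / 5 - 11 / 20 * z) / (1 - 4 / 5 * z)) by (rewrite Hy'; field; lra).
      rewrite <- E. assert (y * (z ^ 2 * Y) <= y * qint p y) by (apply Rmult_le_compat_l; lra). lra. }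
    eapply Rle_trans; [ | eapply Rle_trans; [ exact K | ] ].
    + apply Rmult_le_compat_l; [ lra | ]. unfold P in *; lra.
    + assert (0 <= F * (1 - 27 / 200 * x ^ 2)) by (apply Rmult_le_pos; lra).
      assert (z * Y <= (Y - 1) / p).
      { apply Rmult_le_reg_l with p; [ lra | ].
        replace (p * ((Y - 1) / p)) with (Y - 1) by (field; lra). lra. }
      assert (E : 99 / 100 * A * (z * Y) <= 99 / 100 * (A / p) * (Y - 1)).
      { replace (99 / 100 * (A / p) * (Y - 1)) with (99 / 100 * A * ((Y - 1) / p)) by (field; lra).
        apply Rmult_le_compat_l; lra. }
      assert (0 <= 99 / 100 * A * (z * Y)) by (repeat apply Rmult_le_pos; lra).
      apply Rmult_le_compat; unfold H0; lra.
  - assert (Hq := qint_lower_lt1_inv p y ltac:(lra) ltac:(lra)). fold z in Hq.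
    assert (HYy : Y * (1 - z) ^ 2 <= 1).
    { rewrite <- Hy'. replace (Y * y ^ 2) with (y * (y * Y)) by ring.
      unfold Y. rewrite Rpower_mult_base by lra.
      replace (1 - p) with (- (p - 1)) by ring. rewrite Rpower_mult_base by lra.
      apply Rpower_le1_pos; lra. }
    assert (HP2 : P <= F * x).
    { assert (0 <= / 2 * nu ^ 2 * z) by (apply Rmult_le_pos; [ | lra ]; assert (K := pow2_ge_0 nu); lra).
      unfold P; lra. }
    assert (K := lt1_poly_large_p a z x Y F P Ha Hz Hx2 HY1 HYy HP HP2 Hr HFA). fold A in K.
    assert (HT : z ^ 2 * (2 - z) ^ 2 / 4 * Y / (1 - 4 / 5 * z) - y * qint p y
        <= Y * z ^ 3 * (9 / 5 - 47 / 20 * z + 4 / 5 * z ^ 2) / (1 - 4 / 5 * z)).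
    { assert (E : z ^ 2 * (2 - z) ^ 2 / 4 * Y / (1 - 4 / 5 * z) - z ^ 2 * (Y * (1 - z) ^ 2)
        = Y * z ^ 3 * (9 / 5 - 47 / 20 * z + 4 / 5 * z ^ 2) / (1 - 4 / 5 * z)) by (field; lra).
      rewrite <- E.
      assert (z ^ 2 * (Y * (1 - z) ^ 2) <= z ^ 2 * 1) by (apply Rmult_le_compat_l; [ apply pow2_ge_0 | lra ]).
      assert (y * (z ^ 2 / y) <= y * qint p y) by (apply Rmult_le_compat_l; lra).
      replace (y * (z ^ 2 / y)) with (z ^ 2) in * by (field; lra). lra. }
    eapply Rle_trans; [ | eapply Rle_trans; [ exact K | ] ].
    + apply Rmult_le_compat_l; [ lra | ]. unfold P in *; lra.
    + assert (0 <= F * (1 - 27 / 200 * x ^ 2)) by (apply Rmult_le_pos; lra).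
      assert (HYY : z * Y <= Y - 1).
      { assert (1 <= y * Y).
        { unfold Y. rewrite Rpower_mult_base by lra. apply Rpower_le1_neg; lra. }
        rewrite Hy' in *. lra. }
      assert (HHp : 1 <= H0 / p).
      { apply Rmult_le_reg_r with p; [ lra | ].
        replace (H0 / p * p) with H0 by (field; lra). unfold H0; lra. }
      replace (H0 * (99 / 100 * (A / p) * (Y - 1) + F * (1 - 27 / 200 * x ^ 2)))
        with (99 / 100 * A * (H0 / p * (Y - 1)) + H0 * (F * (1 - 27 / 200 * x ^ 2))) by (field; lra).
      assert (z * Y <= H0 / p * (Y - 1)) by nra.
      assert (99 / 100 * A * (z * Y) <= 99 / 100 * A * (H0 / p * (Y - 1)))
        by (apply Rmult_le_compat_l; lra).
      assert (5 / 4 * (F * (1 - 27 / 200 * x ^ 2)) <= H0 * (F * (1 - 27 / 200 * x ^ 2)))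
        by (apply Rmult_le_compat_r; unfold H0; lra). lra.
Qed.

(** * Continuous functions on rectangles *)

Lemma continuity_2d_pt_slice1 (f : R -> R -> R) (t x : R) :
  continuity_2d_pt f t x -> continuity_pt (fun s => f s x) t.
Proof.
  intros H; apply continuity_pt_locally; intros eps.
  destruct (H eps) as [d Hd]; exists d; intros s Hs; apply Hd; auto.
  rewrite Rminus_diag, Rabs_R0; apply cond_pos.
Qed.

Lemma continuity_2d_pt_slice2 (f : R -> R -> R) (t x : R) :
  continuity_2d_pt f t x -> continuity_pt (fun y => f t y) x.
Proof.
  intros H; apply continuity_pt_locally; intros eps.
  destruct (H eps) as [d Hd]; exists d; intros s Hs; apply Hd; auto.
  rewrite Rminus_diag, Rabs_R0; apply cond_pos.
Qed.

Definition clamp (a b x : R) : R := Rmax a (Rmin b x).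

Lemma clamp_in (a b x : R) : a <= b -> a <= clamp a b x <= b.
Proof.
  intros H; unfold clamp, Rmax, Rmin; destruct (Rle_dec b x), (Rle_dec a _); lra.
Qed.

Lemma clamp_id (a b x : R) : a <= x <= b -> clamp a b x = x.
Proof.
  intros H; unfold clamp. rewrite Rmin_right by lra. now rewrite Rmax_right by lra.
Qed.

Lemma clamp_lip (a b x y : R) : a <= b -> Rabs (clamp a b x - clamp a b y) <= Rabs (x - y).
Proof.
  intros H; unfold clamp, Rmax, Rmin.
  destruct (Rle_dec b x), (Rle_dec b y);
    repeat match goal with |- context [Rle_dec ?u ?v] => destruct (Rle_dec u v) end;
    unfold Rabs; repeat destruct Rcase_abs; lra.
Qed.

Section Rectangle.
Variables (f : R -> R -> R) (a b c d : R).
Hypothesis hab : a <= b.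
Hypothesis hcd : c <= d.
Hypothesis Hc : forall t x, a <= t <= b -> c <= x <= d -> continuity_2d_pt f t x.

(** Clamping the arguments gives a function on the whole plane with a uniform modulus of continuity.
    Its minimum over x, at a chosen point [X t], is then continuous in t, and the one-variable
    theorem applies twice. *)
Lemma rectangle_min : exists t0 x0, a <= t0 <= b /\ c <= x0 <= d /\
  forall t x, a <= t <= b -> c <= x <= d -> f t0 x0 <= f t x.
Proof.
  set (F := fun t x => f (clamp a b t) (clamp c d x)).
  assert (HF : forall eps : posreal, exists del : posreal, forall t x s y,
    Rabs (s - t) < del -> Rabs (y - x) < del -> Rabs (F s y - F t x) < eps).
  { intros eps. destruct (uniform_continuity_2d f a b c d Hc eps) as [del Hd].
    exists del; intros t x s y H1 H2; unfold F; apply Hd; try (now apply clamp_in).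
    - eapply Rle_lt_trans; [ now apply clamp_lip | assumption ].
    - eapply Rle_lt_trans; [ now apply clamp_lip | assumption ]. }
  assert (Hx : forall t, exists x, (forall y, c <= y <= d -> F t x <= F t y) /\ c <= x <= d).
  { intros t. apply (continuity_ab_min (F t) c d hcd). intros x _.
    apply continuity_pt_locally; intros eps. destruct (HF eps) as [del Hd].
    exists del; intros y Hy; apply Hd; auto. rewrite Rminus_diag, Rabs_R0; apply cond_pos. }
  set (X := fun t => proj1_sig (constructive_indefinite_description _ (Hx t))).
  assert (HX : forall t, (forall y, c <= y <= d -> F t (X t) <= F t y) /\ c <= X t <= d)
    by (intros t; unfold X; destruct (constructive_indefinite_description _ (Hx t)); auto).
  destruct (continuity_ab_min (fun t => F t (X t)) a b hab) as [t0 [H1 H2]].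
  { intros t _. apply continuity_pt_locally; intros eps. destruct (HF eps) as [del Hd].
    exists del; intros s Hs.
    destruct (HX t) as [Ht1 Ht2], (HX s) as [Hs1 Hs2].
    assert (K1 := Ht1 (X s) Hs2). assert (K2 := Hs1 (X t) Ht2).
    assert (Z : forall z, Rabs (z - z) < del) by (intros; rewrite Rminus_diag, Rabs_R0; apply cond_pos).
    assert (K3 := Hd t (X s) s (X s) Hs (Z _)). assert (K4 := Hd t (X t) s (X t) Hs (Z _)).
    apply Rabs_def2 in K3; apply Rabs_def2 in K4. apply Rabs_def1; lra. }
  destruct (HX t0) as [Ht1 Ht2].
  exists t0, (X t0); split; [ exact H2 | split; [ exact Ht2 | ] ].
  intros t x Ht Hx'. specialize (H1 t Ht). destruct (HX t) as [K1 K2]. specialize (K1 x Hx').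
  unfold F in H1, K1. rewrite !clamp_id in H1 by assumption. rewrite !clamp_id in K1 by assumption.
  lra.
Qed.

End Rectangle.

Lemma rectangle_bounded (f : R -> R -> R) (a b c d : R) :
  (forall t x, a <= t <= b -> c <= x <= d -> continuity_2d_pt f t x) ->
  exists M, 0 < M /\ forall t x, a <= t <= b -> c <= x <= d -> Rabs (f t x) <= M.
Proof.
  intros Hc.
  destruct (Rle_dec a b) as [hab | hab]; [ | exists 1; split; [ lra | intros; lra ] ].
  destruct (Rle_dec c d) as [hcd | hcd]; [ | exists 1; split; [ lra | intros; lra ] ].
  destruct (rectangle_min f a b c d hab hcd Hc) as [t0 [x0 [_ [_ H0]]]].
  destruct (rectangle_min (fun t x => - f t x) a b c d hab hcd) as [t1 [x1 [_ [_ H1]]]].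
  { intros; apply continuity_2d_pt_opp; auto. }
  exists (1 + Rabs (f t0 x0) + Rabs (f t1 x1)).
  assert (K0 := Rabs_pos (f t0 x0)). assert (K1 := Rabs_pos (f t1 x1)). split; [ lra | ].
  intros t x Ht Hx. specialize (H0 t x Ht Hx). specialize (H1 t x Ht Hx).
  apply Rabs_le. unfold Rabs in *; repeat destruct Rcase_abs; lra.
Qed.

(* A classical solution, extended to negative times by its initial data, so that
   two-sided continuity makes sense up to [t = 0]. *)
Record smooth_flow (g T : R) (h u v hx ux vx : R -> R -> R) : Prop := {
  flow_pos : forall t x, t < T -> 0 < h t x;
  flow_h_c : forall t x, t < T -> continuity_2d_pt h t x;
  flow_u_c : forall t x, t < T -> continuity_2d_pt u t x;
  flow_v_c : forall t x, t < T -> continuity_2d_pt v t x;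
  flow_hx_c : forall t x, t < T -> continuity_2d_pt hx t x;
  flow_ux_c : forall t x, t < T -> continuity_2d_pt ux t x;
  flow_vx_c : forall t x, t < T -> continuity_2d_pt vx t x;
  flow_h_x : forall t x, t < T -> is_derive (fun y => h t y) x (hx t x);
  flow_u_x : forall t x, t < T -> is_derive (fun y => u t y) x (ux t x);
  flow_v_x : forall t x, t < T -> is_derive (fun y => v t y) x (vx t x);
  flow_h_t : forall t x, 0 < t < T ->
    is_derive (fun s => h s x) t (- (h t x) ^ 2 * ux t x);
  flow_u_t : forall t x, 0 < t < T ->
    is_derive (fun s => u s x) t (v t x - Rpower (h t x) (g - 1) * hx t x);
  flow_v_t : forall t x, 0 < t < T -> is_derive (fun s => v s x) t (- u t x)
}.

Arguments flow_pos {g T h u v hx ux vx}.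
Arguments flow_h_c {g T h u v hx ux vx}.
Arguments flow_u_c {g T h u v hx ux vx}.
Arguments flow_v_c {g T h u v hx ux vx}.
Arguments flow_hx_c {g T h u v hx ux vx}.
Arguments flow_ux_c {g T h u v hx ux vx}.
Arguments flow_vx_c {g T h u v hx ux vx}.
Arguments flow_h_x {g T h u v hx ux vx}.
Arguments flow_u_x {g T h u v hx ux vx}.
Arguments flow_v_x {g T h u v hx ux vx}.
Arguments flow_h_t {g T h u v hx ux vx}.
Arguments flow_u_t {g T h u v hx ux vx}.
Arguments flow_v_t {g T h u v hx ux vx}.

Definition from0 (f : R -> R -> R) (t x : R) : R := f (Rmax 0 t) x.

Lemma from0_continuity (T : R) (f : R -> R -> R) (t x : R) : 0 < T ->
  (forall t x, 0 <= t < T -> cont_within (slab T) f t x) -> t < T ->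
  continuity_2d_pt (from0 f) t x.
Proof.
  intros HT Hf Ht eps.
  assert (Hr : 0 <= Rmax 0 t < T) by (unfold Rmax; destruct (Rle_dec 0 t); lra).
  assert (K := Hf (Rmax 0 t) x Hr).
  assert (Hball : locally (f (Rmax 0 t) x) (fun z => Rabs (z - f (Rmax 0 t) x) < eps))
    by (exists eps; intros z Hz; exact Hz).
  destruct (K _ Hball) as [d Hd].
  assert (Hd2 : 0 < Rmin d (T - t)) by (apply Rmin_glb_lt; [ apply cond_pos | lra ]).
  exists (mkposreal _ Hd2); simpl; intros s y Hs Hy. unfold from0.
  assert (Hs1 : Rabs (s - t) < d) by (eapply Rlt_le_trans; [ exact Hs | apply Rmin_l ]).
  assert (Hs2 : Rabs (s - t) < T - t) by (eapply Rlt_le_trans; [ exact Hs | apply Rmin_r ]).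
  assert (Hy1 : Rabs (y - x) < d) by (eapply Rlt_le_trans; [ exact Hy | apply Rmin_l ]).
  apply (Hd (Rmax 0 s, y)).
  - split; [ | exact Hy1 ]. change (Rabs (Rmax 0 s - Rmax 0 t) < d).
    eapply Rle_lt_trans; [ | exact Hs1 ].
    unfold Rmax; destruct (Rle_dec 0 s), (Rle_dec 0 t);
      unfold Rabs; repeat destruct Rcase_abs; lra.
  - unfold slab; simpl. apply Rabs_def2 in Hs2.
    unfold Rmax; destruct (Rle_dec 0 s); lra.
Qed.

Lemma from0_derive_t (f : R -> R -> R) (t x l : R) : 0 < t ->
  is_derive (fun s => f s x) t l -> is_derive (fun s => from0 f s x) t l.
Proof.
  intros Ht Hd. apply (is_derive_ext_loc (fun s => f s x)); [ | exact Hd ].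
  exists (mkposreal _ Ht); intros s Hs. change (Rabs (s - t) < t) in Hs.
  apply Rabs_def2 in Hs. unfold from0. rewrite Rmax_right by lra. reflexivity.
Qed.

Lemma from0_pos (f : R -> R -> R) (t x : R) : 0 <= t -> from0 f t x = f t x.
Proof. intros; unfold from0; rewrite Rmax_right; auto. Qed.

Lemma classical_flow (g T : R) (h u v : R -> R -> R) (h0 u0 v0 : R -> R) :
  1 <= g -> 0 < T -> classical_solution g T h u v h0 u0 v0 ->
  smooth_flow g T (from0 h) (from0 u) (from0 v)
    (from0 (d_x h)) (from0 (d_x u)) (from0 (d_x v)).
Proof.
  intros Hg HT [[Hhx [Hht [Hhc _]]] [[Hux [Hut [Huc _]]] [[Hvx [Hvt [Hvc _]]]
    [Hpos [_ Heq]]]]].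
  assert (Hr : forall t, t < T -> 0 <= Rmax 0 t < T)
    by (intros t Ht; unfold Rmax; destruct (Rle_dec 0 t); lra).
  constructor.
  - intros t x Ht; apply Hpos; auto.
  - intros t x Ht; apply (from0_continuity T); auto. intros; now apply Hhc.
  - intros t x Ht; apply (from0_continuity T); auto. intros; now apply Huc.
  - intros t x Ht; apply (from0_continuity T); auto. intros; now apply Hvc.
  - intros t x Ht; apply (from0_continuity T); auto. intros; now apply Hhc.
  - intros t x Ht; apply (from0_continuity T); auto. intros; now apply Huc.
  - intros t x Ht; apply (from0_continuity T); auto. intros; now apply Hvc.
  - intros t x Ht; apply Derive_correct, Hhx; auto.
  - intros t x Ht; apply Derive_correct, Hux; auto.
  - intros t x Ht; apply Derive_correct, Hvx; auto.
  - intros t x Ht; apply from0_derive_t; [ lra | ]. rewrite !from0_pos by lra.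
    replace (- (h t x) ^ 2 * d_x u t x) with (d_t h t x)
      by (destruct (Heq t x Ht) as [E _]; lra).
    apply Derive_correct, Hht; auto.
  - intros t x Ht; apply from0_derive_t; [ lra | ]. rewrite !from0_pos by lra.
    assert (Hh := Hpos t x ltac:(lra)).
    assert (E1 : d_x (fun s y => Rpower (h s y) g / g) t x = Rpower (h t x) (g - 1) * d_x h t x).
    { apply is_derive_unique.
      assert (K := D_comp (fun z => / g * Rpower z g) (fun y => h t y) x _ (d_x h t x)
        (D_scal _ (/ g) _ _ (is_derive_Rpower g (h t x) Hh)) (Derive_correct _ _ (Hhx t x ltac:(lra)))).
      replace (Rpower (h t x) (g - 1) * d_x h t x) with (d_x h t x * (/ g * (g * Rpower (h t x) g / h t x))).
      - eapply is_derive_ext; [ | exact K ]. intros y; unfold Rdiv; toR; ring.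
      - unfold Rminus; rewrite Rpower_plus, Rpower_Ropp, Rpower_1 by lra. field; lra. }
    replace (v t x - Rpower (h t x) (g - 1) * d_x h t x) with (d_t u t x)
      by (destruct (Heq t x Ht) as [_ [E _]]; lra).
    apply Derive_correct, Hut; auto.
  - intros t x Ht; apply from0_derive_t; [ lra | ]. rewrite !from0_pos by lra.
    replace (- u t x) with (d_t v t x) by (destruct (Heq t x Ht) as [_ [_ E]]; lra).
    apply Derive_correct, Hvt; auto.
Qed.

(** * Riemann invariants *)

(** [Kf] is the primitive of [kf] vanishing at the rest value h = 1, so that u + e [Kf] is a Riemann
    invariant that vanishes at rest. [cf] is the corresponding wave speed h^((g+1)/2) in mass
    coordinates. *)
Definition kf (g h : R) : R := Rpower h ((g - 3) / 2).
Definition Kf (g h : R) : R := RInt (kf g) 1 h.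
Definition cf (g h : R) : R := h ^ 2 * kf g h.
Definition riem (g e : R) (h u : R -> R -> R) (t x : R) : R := u t x + e * Kf g (h t x).

Lemma kf_pos (g h : R) : 0 < kf g h.
Proof. apply Rpower_pos. Qed.

Lemma cf_pos (g h : R) : 0 < h -> 0 < cf g h.
Proof. intros; unfold cf; apply Rmult_lt_0_compat; [ nra | apply kf_pos ]. Qed.

Lemma Rpower_one (a : R) : Rpower 1 a = 1.
Proof. unfold Rpower; rewrite ln_1, Rmult_0_r, exp_0; reflexivity. Qed.

Lemma cf_1 (g : R) : cf g 1 = 1.
Proof. unfold cf, kf; rewrite Rpower_one; ring. Qed.

Lemma kf_sq (g h : R) : 0 < h -> Rpower h (g - 1) = h ^ 2 * (kf g h) ^ 2.
Proof.
  intros Hh. unfold kf. replace (g - 1) with (1 + 1 + ((g - 3) / 2 + (g - 3) / 2)) by field.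
  rewrite !Rpower_plus, Rpower_1 by lra. ring.
Qed.

Lemma is_derive_Kf (g h : R) : 0 < h -> is_derive (Kf g) h (kf g h).
Proof.
  intros Hh; apply is_derive_RInt_from1; auto.
  intros z Hz; apply continuous_Rpower; auto.
Qed.

Lemma Kf_1 (g : R) : Kf g 1 = 0.
Proof. apply (RInt_point (V := R_CompleteNormedModule)). Qed.

Lemma Kf_incr (g x y : R) : 0 < x -> x < y -> Kf g x < Kf g y.
Proof.
  intros Hx Hxy.
  destruct (MVT_gen (Kf g) x y (kf g)) as [c [Hc He]];
    rewrite ?Rmin_left, ?Rmax_right in * by lra.
  - intros z Hz; apply is_derive_Kf; lra.
  - intros z Hz; eapply is_derive_continuity_pt, is_derive_Kf; lra.
  - assert (H := kf_pos g c). nra.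
Qed.

Lemma Kf_eq0 (g h : R) : 0 < h -> Kf g h = 0 -> h = 1.
Proof.
  intros Hh HK. rewrite <- (Kf_1 g) in HK.
  destruct (Rtotal_order h 1) as [Hl | [He | Hl]]; auto.
  - assert (H := Kf_incr g h 1 Hh Hl); lra.
  - assert (H := Kf_incr g 1 h ltac:(lra) Hl); lra.
Qed.

Lemma continuity_2d_comp (F : R -> R) (f : R -> R -> R) (t x : R) :
  continuity_pt F (f t x) -> continuity_2d_pt f t x ->
  continuity_2d_pt (fun s y => F (f s y)) t x.
Proof.
  intros HF Hf eps.
  destruct (proj1 (continuity_pt_locally F (f t x)) HF eps) as [d Hd].
  destruct (Hf d) as [d' Hd']. exists d'; intros s y Hs Hy. apply Hd. now apply Hd'.
Qed.

Lemma Kf_continuity (g h : R) : 0 < h -> continuity_pt (Kf g) h.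
Proof. intros; eapply is_derive_continuity_pt, is_derive_Kf; auto. Qed.

Lemma kf_continuity (g h : R) : 0 < h -> continuity_pt (kf g) h.
Proof. intros; eapply is_derive_continuity_pt, is_derive_Rpower; auto. Qed.

Section Riemann.
Variables (g T : R) (h u v hx ux vx : R -> R -> R).
Hypothesis S : smooth_flow g T h u v hx ux vx.

Lemma riem_x (e t x : R) : t < T ->
  is_derive (fun y => riem g e h u t y) x (ux t x + e * (kf g (h t x) * hx t x)).
Proof.
  intros Ht. unfold riem. apply D_plus; [ apply (flow_u_x S); auto | ].
  apply D_scal. rewrite Rmult_comm. apply (D_comp (Kf g) (fun y => h t y)).
  - apply is_derive_Kf, (flow_pos S); auto.
  - apply (flow_h_x S); auto.
Qed.

Lemma riem_t (e t x : R) : e * e = 1 -> 0 < t < T ->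
  is_derive (fun s => riem g e h u s x) t
    (v t x - e * cf g (h t x) * (ux t x + e * (kf g (h t x) * hx t x))).
Proof.
  intros He Ht. unfold riem.
  assert (Hh := flow_pos S t x ltac:(lra)).
  replace (v t x - e * cf g (h t x) * (ux t x + e * (kf g (h t x) * hx t x)))
    with ((v t x - Rpower (h t x) (g - 1) * hx t x)
          + e * ((- (h t x) ^ 2 * ux t x) * kf g (h t x))).
  - apply D_plus; [ apply (flow_u_t S); auto | ].
    apply D_scal. apply (D_comp (Kf g) (fun s => h s x)).
    + now apply is_derive_Kf.
    + apply (flow_h_t S); auto.
  - rewrite kf_sq by auto. unfold cf.
    replace (e * (h t x ^ 2 * kf g (h t x)) * (ux t x + e * (kf g (h t x) * hx t x)))
      with (e * (h t x ^ 2 * kf g (h t x)) * ux t x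
            + (e * e) * (h t x ^ 2 * kf g (h t x) * (kf g (h t x) * hx t x))) by ring.
    rewrite He; ring.
Qed.

Lemma riem_continuity (e t x : R) : t < T -> continuity_2d_pt (riem g e h u) t x.
Proof.
  intros Ht. apply continuity_2d_pt_plus; [ apply (flow_u_c S); auto | ].
  apply continuity_2d_pt_mult; [ apply continuity_2d_pt_const | ].
  apply continuity_2d_comp; [ apply Kf_continuity, (flow_pos S) |
    apply (flow_h_c S) ]; auto.
Qed.

Lemma cf_h_continuity (t x : R) : t < T -> continuity_2d_pt (fun t x => cf g (h t x)) t x.
Proof.
  intros Ht. assert (Hh := flow_h_c S t x Ht).
  unfold cf. apply continuity_2d_pt_mult.
  - apply (continuity_2d_comp (fun z => z ^ 2)); auto.
    apply derivable_continuous_pt, derivable_pt_pow.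
  - apply continuity_2d_comp; auto. apply kf_continuity, (flow_pos S); auto.
Qed.
End Riemann.

Lemma left_max_derive (f : R -> R) (t l d : R) : 0 < d -> is_derive f t l ->
  (forall s, t - d <= s <= t -> f s <= f t) -> 0 <= l.
Proof.
  intros Hd Hl Hm. apply is_derive_Reals in Hl.
  destruct (Rle_dec 0 l) as [ | Hn ]; [ assumption | exfalso ].
  destruct (Hl (- l / 2) ltac:(lra)) as [del Hdel].
  set (k := - Rmin d (del / 2)).
  assert (Hk : - d <= k < 0 /\ Rabs k < del).
  { assert (K := cond_pos del). unfold k, Rmin; destruct (Rle_dec d (del / 2));
      rewrite Rabs_left; lra. }
  specialize (Hdel k ltac:(lra) ltac:(lra)). specialize (Hm (t + k) ltac:(lra)).
  apply Rabs_def2 in Hdel.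
  assert (0 <= (f (t + k) - f t) / k).
  { replace ((f (t + k) - f t) / k) with ((f t - f (t + k)) / (- k)) by (field; lra).
    apply Rdiv_le_0_compat; lra. }
  lra.
Qed.

Lemma interior_max_derive (f : R -> R) (a b x l : R) : a < x < b -> is_derive f x l ->
  (forall y, a < y < b -> f y <= f x) -> l = 0.
Proof.
  intros Hx Hl Hm. apply is_derive_Reals in Hl.
  assert (E := deriv_maximum f a b x (exist _ l Hl) ltac:(lra) ltac:(lra)
    (fun y H1 H2 => Hm y (conj H1 H2))). exact E.
Qed.

(** * Finite speed of propagation *)

(** The square makes the positive part C^1, so products of such functions are admissible cutoffs. *)
Definition sqpos (s : R) : R := (Rmax 0 s) ^ 2.
Definition sqpos' (s : R) : R := 2 * Rmax 0 s.

Lemma is_derive_sqpos (s : R) : is_derive sqpos s (sqpos' s).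
Proof.
  apply is_derive_Reals. intros eps Heps. exists (mkposreal _ Heps); simpl; intros k Hk Hk2.
  assert (H : Rabs (sqpos (s + k) - sqpos s - sqpos' s * k) <= k ^ 2).
  { unfold sqpos, sqpos', Rmax. destruct (Rle_dec 0 (s + k)), (Rle_dec 0 s);
      unfold Rabs; destruct Rcase_abs; nra. }
  replace ((sqpos (s + k) - sqpos s) / k - sqpos' s)
    with ((sqpos (s + k) - sqpos s - sqpos' s * k) / k) by (field; auto).
  unfold Rdiv; rewrite Rabs_mult, Rabs_inv.
  assert (0 < Rabs k) by (apply Rabs_pos_lt; auto).
  apply Rle_lt_trans with (k ^ 2 * / Rabs k).
  - apply Rmult_le_compat_r; [ left; apply Rinv_0_lt_compat | ]; auto.
  - rewrite <- (pow2_abs k). replace (Rabs k ^ 2 * / Rabs k) with (Rabs k) by (field; lra). auto.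
Qed.

Lemma sqpos_ge0 (s : R) : 0 <= sqpos s.
Proof. apply pow2_ge_0. Qed.

Lemma sqpos'_ge0 (s : R) : 0 <= sqpos' s.
Proof. unfold sqpos'; assert (H := Rmax_l 0 s); lra. Qed.

Lemma sqpos_pos (s : R) : 0 < s -> 0 < sqpos s.
Proof. intros; unfold sqpos; rewrite Rmax_right by lra; nra. Qed.

Lemma sqpos_pos_inv (s : R) : 0 < sqpos s -> 0 < s.
Proof. unfold sqpos, Rmax; destruct (Rle_dec 0 s); intros; nra. Qed.

Section Cone.
Variables (t0 a b : R).

(* supported in the cone [a + 2 (t - t0) < x < b - 2 (t - t0)], and nonincreasing along
   every direction of speed at most 2 *)
Definition cutoff (t x : R) : R := sqpos (x - a - 2 * (t - t0)) * sqpos (b - 2 * (t - t0) - x).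
Definition damped (r : R -> R -> R) (t x : R) : R :=
  exp (- 4 * (t - t0)) * (cutoff t x * (r t x) ^ 2).

Lemma damped_max (r : R -> R -> R) (t1 t x rt rx kappa q : R) :
  t0 < t1 -> is_derive (fun s => r s x) t rt -> is_derive (fun y => r t y) x rx ->
  rt + kappa * rx = q -> Rabs kappa <= 2 -> r t x * q <= (r t x) ^ 2 ->
  t0 < t <= t1 -> a <= x <= b -> 0 < damped r t x ->
  (forall s y, t0 <= s <= t1 -> a <= y <= b -> damped r s y <= damped r t x) -> False.
Proof.
  intros Ht01 Hrt Hrx Hq Hk Hrq Ht Hx Hpos Hmax.
  set (X1 := x - a - 2 * (t - t0)). set (X2 := b - 2 * (t - t0) - x).
  assert (Hw : 0 < cutoff t x /\ (r t x) ^ 2 <> 0).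
  { unfold damped in Hpos.
    assert (0 <= cutoff t x) by (apply Rmult_le_pos; apply sqpos_ge0).
    split; [ | intros Z; rewrite Z in Hpos; lra ].
    destruct (Req_dec (cutoff t x) 0) as [Z | Z]; [ rewrite Z in Hpos; lra | lra ]. }
  destruct Hw as [Hw Hr0].
  assert (HX : 0 < sqpos X1 /\ 0 < sqpos X2).
  { unfold cutoff in Hw; fold X1 X2 in Hw.
    assert (0 <= sqpos X1) by apply sqpos_ge0. assert (0 <= sqpos X2) by apply sqpos_ge0.
    split; [ destruct (Req_dec (sqpos X1) 0) as [Z | Z] | destruct (Req_dec (sqpos X2) 0) as [Z | Z] ];
      try lra; rewrite Z in Hw; lra. }
  destruct HX as [HX1 HX2].
  assert (HX1' := sqpos_pos_inv _ HX1). assert (HX2' := sqpos_pos_inv _ HX2).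
  assert (Hint : a < x < b) by (unfold X1, X2 in *; lra).
  set (E := exp (- 4 * (t - t0))). assert (HE : 0 < E) by apply exp_pos.
  set (wt := - 2 * sqpos' X1 * sqpos X2 + sqpos X1 * (- 2 * sqpos' X2)).
  set (wx := sqpos' X1 * sqpos X2 - sqpos X1 * sqpos' X2).
  assert (Hdt : is_derive (fun s => damped r s x) t
     (- 4 * E * (cutoff t x * (r t x) ^ 2)
       + E * (wt * (r t x) ^ 2 + cutoff t x * (2 * r t x * rt)))).
  { unfold damped. apply (D_mult (fun s => exp (- 4 * (s - t0)))
      (fun s => cutoff s x * (r s x) ^ 2)); [ unfold E; auto_derive; [ trivial | toR; unfold Rminus; ring ] | ].
    apply (D_mult (fun s => cutoff s x) (fun s => (r s x) ^ 2)).
    - unfold cutoff, wt. apply (D_mult (fun s => sqpos (x - a - 2 * (s - t0)))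
        (fun s => sqpos (b - 2 * (s - t0) - x))).
      + apply (D_comp sqpos (fun s => x - a - 2 * (s - t0))); [ apply is_derive_sqpos | ].
        auto_derive; [ trivial | toR; ring ].
      + apply (D_comp sqpos (fun s => b - 2 * (s - t0) - x)); [ apply is_derive_sqpos | ].
        auto_derive; [ trivial | toR; ring ].
    - replace (2 * r t x * rt) with (rt * (2 * r t x)) by ring.
      apply (D_comp (fun z => z ^ 2) (fun s => r s x)); auto.
      auto_derive; [ trivial | toR; ring ]. }
  assert (Hdx : is_derive (fun y => damped r t y) x
     (E * (wx * (r t x) ^ 2 + cutoff t x * (2 * r t x * rx)))).
  { unfold damped. apply (D_scal (fun y => cutoff t y * r t y ^ 2)).
    apply (D_mult (fun y => cutoff t y) (fun y => (r t y) ^ 2)).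
    - unfold cutoff, wx. replace (sqpos' X1 * sqpos X2 - sqpos X1 * sqpos' X2)
        with (1 * sqpos' X1 * sqpos X2 + sqpos X1 * (- 1 * sqpos' X2)) by ring.
      apply (D_mult (fun y => sqpos (y - a - 2 * (t - t0)))
        (fun y => sqpos (b - 2 * (t - t0) - y))).
      + apply (D_comp sqpos (fun y => y - a - 2 * (t - t0))); [ apply is_derive_sqpos | ].
        auto_derive; [ trivial | toR; ring ].
      + apply (D_comp sqpos (fun y => b - 2 * (t - t0) - y)); [ apply is_derive_sqpos | ].
        auto_derive; [ trivial | toR; ring ].
    - replace (2 * r t x * rx) with (rx * (2 * r t x)) by ring.
      apply (D_comp (fun z => z ^ 2) (fun y => r t y)); auto.
      auto_derive; [ trivial | toR; ring ]. }
  assert (K1 := left_max_derive _ t _ (t - t0) ltac:(lra) Hdt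
    ltac:(intros s Hs; apply Hmax; lra)).
  assert (K2 : E * (wx * (r t x) ^ 2 + cutoff t x * (2 * r t x * rx)) = 0).
  { apply (interior_max_derive (fun y => damped r t y) a b x); auto. intros y Hy; apply Hmax; lra. }
  assert (Hs1 := sqpos'_ge0 X1). assert (Hs2 := sqpos'_ge0 X2).
  assert (Hk' : - 2 <= kappa <= 2) by (apply Rabs_le_between; exact Hk).
  assert (Hwt : wt + kappa * wx <= 0).
  { unfold wt, wx.
    assert (0 <= (2 - kappa) * (sqpos' X1 * sqpos X2)) by (apply Rmult_le_pos; [ lra | apply Rmult_le_pos; lra ]).
    assert (0 <= (2 + kappa) * (sqpos X1 * sqpos' X2)) by (apply Rmult_le_pos; [ lra | apply Rmult_le_pos; lra ]).
    lra. }
  assert (Hr2 : 0 < (r t x) ^ 2) by (assert (K := pow2_ge_0 (r t x)); lra).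
  assert (K3 : 0 <= E * ((wt + kappa * wx) * (r t x) ^ 2 + cutoff t x * (2 * (r t x * q))
     - 4 * (cutoff t x * (r t x) ^ 2))).
  { rewrite <- Hq.
    replace (E * ((wt + kappa * wx) * (r t x) ^ 2 + cutoff t x * (2 * (r t x * (rt + kappa * rx)))
     - 4 * (cutoff t x * (r t x) ^ 2)))
      with ((- 4 * E * (cutoff t x * (r t x) ^ 2)
       + E * (wt * (r t x) ^ 2 + cutoff t x * (2 * r t x * rt)))
       + kappa * (E * (wx * (r t x) ^ 2 + cutoff t x * (2 * r t x * rx)))) by ring.
    rewrite K2. lra. }
  assert ((wt + kappa * wx) * (r t x) ^ 2 <= 0) by nra.
  assert (cutoff t x * (2 * (r t x * q)) <= cutoff t x * (2 * (r t x) ^ 2))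
    by (apply Rmult_le_compat_l; lra).
  assert (0 < cutoff t x * (r t x) ^ 2) by (apply Rmult_lt_0_compat; lra).
  nra.
Qed.

Lemma damped_continuity (r : R -> R -> R) (t x : R) :
  continuity_2d_pt r t x -> continuity_2d_pt (damped r) t x.
Proof.
  intros Hr. unfold damped, cutoff.
  assert (Hsq : forall s, continuity_pt sqpos s)
    by (intros s; eapply is_derive_continuity_pt, is_derive_sqpos).
  apply continuity_2d_pt_mult; [ | apply continuity_2d_pt_mult; [ apply continuity_2d_pt_mult | ] ].
  - apply (continuity_2d_comp (fun z => exp (- 4 * (z - t0))) (fun s _ => s)).
    + apply (is_derive_continuity_pt _ _ (- 4 * exp (- 4 * (t - t0)))).
      auto_derive; [ trivial | toR; unfold Rminus; ring ].
    + apply continuity_2d_pt_id1.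
  - apply (continuity_2d_comp sqpos (fun s y => y - a - 2 * (s - t0))); [ apply Hsq | ].
    repeat first [ apply continuity_2d_pt_minus | apply continuity_2d_pt_mult
      | apply continuity_2d_pt_id1 | apply continuity_2d_pt_id2 | apply continuity_2d_pt_const ].
  - apply (continuity_2d_comp sqpos (fun s y => b - 2 * (s - t0) - y)); [ apply Hsq | ].
    repeat first [ apply continuity_2d_pt_minus | apply continuity_2d_pt_mult
      | apply continuity_2d_pt_id1 | apply continuity_2d_pt_id2 | apply continuity_2d_pt_const ].
  - apply (continuity_2d_comp (fun z => z ^ 2)); auto.
    apply derivable_continuous_pt, derivable_pt_pow.
Qed.

Lemma damped_sq_le (r1 r2 : R -> R -> R) (t x : R) : 0 < damped r2 t x ->
  damped r1 t x <= damped r2 t x -> (r1 t x) ^ 2 <= (r2 t x) ^ 2.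
Proof.
  unfold damped; intros H1 H2. assert (HE := exp_pos (- 4 * (t - t0))).
  assert (0 <= cutoff t x) by (apply Rmult_le_pos; apply sqpos_ge0).
  destruct (Req_dec (cutoff t x) 0) as [Z | Z].
  { rewrite Z, Rmult_0_l, Rmult_0_r in H1; lra. }
  apply Rmult_le_reg_l with (cutoff t x); [ lra | ].
  apply Rmult_le_reg_l with (exp (- 4 * (t - t0))); lra.
Qed.
End Cone.

Section Propagation.
Variables (g T : R) (h u v hx ux vx : R -> R -> R).
Hypothesis S : smooth_flow g T h u v hx ux vx.

Definition at_rest (t x : R) : Prop := h t x = 1 /\ u t x = 0 /\ v t x = 0.

Lemma at_rest_riem (t x : R) : t < T -> riem g 1 h u t x = 0 -> riem g (- 1) h u t x = 0 ->
  v t x = 0 -> at_rest t x.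
Proof.
  unfold riem; intros Ht H1 H2 Hv. assert (HK : Kf g (h t x) = 0) by lra.
  split; [ | lra ]. eapply Kf_eq0; [ | exact HK ]. apply (flow_pos S); auto.
Qed.

Lemma damped_zero (t0 a b : R) (r : R -> R -> R) (x : R) :
  (a < x < b -> r t0 x = 0) -> damped t0 a b r t0 x = 0.
Proof.
  intros H. unfold damped, cutoff. rewrite Rminus_diag, !Rmult_0_r.
  destruct (Rlt_dec a x) as [Ha | Ha].
  - destruct (Rlt_dec x b) as [Hb | Hb].
    + rewrite H by lra. ring.
    + replace (sqpos (b - 0 - x)) with 0; [ ring | ].
      unfold sqpos. rewrite Rmax_left by lra. ring.
  - replace (sqpos (x - a - 0)) with 0; [ ring | ].
    unfold sqpos. rewrite Rmax_left by lra. ring.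
Qed.

Lemma damped_inside (t0 a b : R) (r : R -> R -> R) (t x : R) : t0 <= t ->
  0 < damped t0 a b r t x -> a < x < b.
Proof.
  intros Ht Hp. unfold damped, cutoff in Hp.
  destruct (Rlt_dec (2 * (t - t0)) (x - a)) as [Ha | Ha].
  - destruct (Rlt_dec x (b - 2 * (t - t0))) as [Hb | Hb]; [ lra | exfalso ].
    replace (sqpos (b - 2 * (t - t0) - x)) with 0 in Hp; [ lra | ].
    unfold sqpos. rewrite Rmax_left by lra. ring.
  - exfalso. replace (sqpos (x - a - 2 * (t - t0))) with 0 in Hp; [ lra | ].
    unfold sqpos. rewrite Rmax_left by lra. ring.
Qed.

(** The two Riemann invariants are forced by v, and v by u, which is half of their sum. At the
    maximum of the largest of the three damped squares the forcing q therefore satisfies r q <= r^2,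
    as [damped_max] requires. *)
Lemma propagation_step (t0 t1 a b : R) : 0 <= t0 < t1 -> t1 < T -> a <= b ->
  (forall t x, t0 <= t <= t1 -> a < x < b -> cf g (h t x) <= 2) ->
  (forall x, a < x < b -> at_rest t0 x) ->
  forall t x, t0 <= t <= t1 -> a + 2 * (t - t0) < x < b - 2 * (t - t0) -> at_rest t x.
Proof.
  intros Ht01 Ht1 Hab Hc Hini.
  set (r1 := riem g 1 h u). set (r2 := riem g (- 1) h u).
  set (d1 := damped t0 a b r1). set (d2 := damped t0 a b r2). set (d3 := damped t0 a b v).
  assert (Hmax : forall r, (forall t x, t0 <= t <= t1 -> a <= x <= b -> continuity_2d_pt r t x) ->
     exists tm xm, t0 <= tm <= t1 /\ a <= xm <= b /\ forall t x, t0 <= t <= t1 -> a <= x <= b ->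
       damped t0 a b r t x <= damped t0 a b r tm xm).
  { intros r Hr. destruct (rectangle_min (fun t x => - damped t0 a b r t x) t0 t1 a b)
      as [tm [xm [K1 [K2 K3]]]]; try lra.
    - intros t x Ht Hx; apply continuity_2d_pt_opp, damped_continuity; auto.
    - exists tm, xm; split; [ | split ]; auto. intros t x Ht Hx; specialize (K3 t x Ht Hx); lra. }
  destruct (Hmax r1) as [m1 [y1 [Hm1 [Hy1 M1]]]].
  { intros; apply (riem_continuity g T h u v hx ux vx S); lra. }
  destruct (Hmax r2) as [m2 [y2 [Hm2 [Hy2 M2]]]].
  { intros; apply (riem_continuity g T h u v hx ux vx S); lra. }
  destruct (Hmax v) as [m3 [y3 [Hm3 [Hy3 M3]]]].
  { intros; apply (flow_v_c S); lra. }
  fold d1 in M1; fold d2 in M2; fold d3 in M3. clear Hmax.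
  assert (Hz : forall x, d1 t0 x = 0 /\ d2 t0 x = 0 /\ d3 t0 x = 0).
  { intros x. unfold d1, d2, d3, r1, r2.
    split; [ | split ]; apply damped_zero; intros Hx; destruct (Hini x Hx) as [E1 [E2 E3]];
      unfold riem; rewrite ?E1, ?E2, ?E3, ?Kf_1; ring. }
  assert (Hcb : forall e t x, e * e = 1 -> t0 <= t <= t1 -> a < x < b -> Rabs (e * cf g (h t x)) <= 2).
  { intros e t x He Ht Hx. specialize (Hc t x Ht Hx).
    assert (Hp := cf_pos g (h t x) (flow_pos S t x ltac:(lra))).
    assert (Rabs e = 1).
    { assert (Rabs e * Rabs e = 1) by (rewrite <- Rabs_mult, He; apply Rabs_R1).
      assert (K := Rabs_pos e). nra. }
    rewrite Rabs_mult, H, Rmult_1_l, Rabs_right; lra. }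
  (* the largest of the three damped quantities cannot be positive *)
  assert (Hriem : forall e m y, e * e = 1 -> t0 <= m <= t1 -> a <= y <= b ->
    damped t0 a b (riem g e h u) t0 y = 0 ->
    (forall t x, t0 <= t <= t1 -> a <= x <= b ->
       damped t0 a b (riem g e h u) t x <= damped t0 a b (riem g e h u) m y) ->
    d3 m y <= damped t0 a b (riem g e h u) m y -> damped t0 a b (riem g e h u) m y <= 0).
  { intros e m y He Hm Hy Hzero HM H3. apply Rnot_lt_le; intros Hpos.
    assert (Hmt : t0 < m).
    { destruct (Req_dec m t0) as [-> | ]; [ lra | lra ]. }
    assert (Hin := damped_inside t0 a b _ m y ltac:(lra) Hpos).
    apply (damped_max t0 a b (riem g e h u) t1 m y
      (v m y - e * cf g (h m y) * (ux m y + e * (kf g (h m y) * hx m y)))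
      (ux m y + e * (kf g (h m y) * hx m y)) (e * cf g (h m y)) (v m y)); auto; try lra.
    - apply (riem_t g T h u v hx ux vx S); auto; lra.
    - apply (riem_x g T h u v hx ux vx S); lra.
    - assert (K := damped_sq_le t0 a b v (riem g e h u) m y Hpos H3).
      nra. }
  assert (Hv : d1 m3 y3 <= d3 m3 y3 -> d2 m3 y3 <= d3 m3 y3 -> d3 m3 y3 <= 0).
  { intros H1 H2. apply Rnot_lt_le; intros Hpos.
    assert (Hmt : t0 < m3).
    { destruct (Req_dec m3 t0) as [E | ]; [ | lra ]. rewrite E in Hpos.
      destruct (Hz y3) as [_ [_ E3]]; lra. }
    apply (damped_max t0 a b v t1 m3 y3 (- u m3 y3) (vx m3 y3) 0 (- u m3 y3)); auto; try lra.
    - apply (flow_v_t S); lra.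
    - apply (flow_v_x S); lra.
    - rewrite Rabs_R0; lra.
    - assert (K1 := damped_sq_le t0 a b r1 v m3 y3 Hpos H1).
      assert (K2 := damped_sq_le t0 a b r2 v m3 y3 Hpos H2).
      unfold r1, r2, riem in K1, K2.
      set (U := u m3 y3) in *. set (K := Kf g (h m3 y3)) in *. set (V := v m3 y3) in *.
      nra. }
  assert (Hall : forall t x, t0 <= t <= t1 -> a <= x <= b -> d1 t x <= 0 /\ d2 t x <= 0 /\ d3 t x <= 0).
  { assert (L1 := M3 m1 y1 Hm1 Hy1). assert (L2 := M3 m2 y2 Hm2 Hy2).
    assert (L3 := M1 m3 y3 Hm3 Hy3). assert (L4 := M2 m3 y3 Hm3 Hy3).
    assert (R1 := Hriem 1 m1 y1 ltac:(ring) Hm1 Hy1 (proj1 (Hz y1)) M1).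
    assert (R2 := Hriem (- 1) m2 y2 ltac:(ring) Hm2 Hy2 (proj1 (proj2 (Hz y2))) M2).
    fold r1 in R1; fold r2 in R2. fold d1 in R1; fold d2 in R2.
    assert (Hb : d1 m1 y1 <= 0 /\ d2 m2 y2 <= 0 /\ d3 m3 y3 <= 0).
    { destruct (Rle_dec (d3 m3 y3) (d1 m1 y1)), (Rle_dec (d3 m3 y3) (d2 m2 y2)).
      - repeat split; lra.
      - repeat split; lra.
      - repeat split; lra.
      - lra. }
    intros t x Ht Hx. specialize (M1 t x Ht Hx). specialize (M2 t x Ht Hx).
    specialize (M3 t x Ht Hx). lra. }
  intros t x Ht Hx. destruct (Hall t x Ht ltac:(lra)) as [Q1 [Q2 Q3]].
  assert (Hzero : forall r, damped t0 a b r t x <= 0 -> r t x = 0).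
  { intros r Hr. unfold damped, cutoff in Hr.
    assert (HE := exp_pos (- 4 * (t - t0))).
    assert (P1 := sqpos_pos (x - a - 2 * (t - t0)) ltac:(lra)).
    assert (P2 := sqpos_pos (b - 2 * (t - t0) - x) ltac:(lra)).
    destruct (Req_dec (r t x) 0) as [ | Hn ]; [ assumption | exfalso ].
    assert (0 < (r t x) ^ 2) by (assert (K := pow2_ge_0 (r t x)); assert (r t x ^ 2 <> 0) by (apply pow_nonzero; auto); lra).
    assert (0 < exp (-4 * (t - t0)) * (sqpos (x - a - 2 * (t - t0)) * sqpos (b - 2 * (t - t0) - x) * r t x ^ 2)).
    { apply Rmult_lt_0_compat; auto. apply Rmult_lt_0_compat; auto. apply Rmult_lt_0_compat; auto. }
    lra. }
  apply at_rest_riem; try lra; now apply Hzero.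
Qed.

(** The speed bound 2 is not known in advance. At rest the speed is 1, and uniform continuity keeps
    it below 2 for a fixed time step [eps], over which [propagation_step] restores rest in the
    smaller interval; the step size is uniform, so finitely many steps suffice. *)
Lemma propagation (T1 a b : R) : 0 < T1 < T -> a <= b ->
  (forall x, a < x < b -> at_rest 0 x) ->
  forall t x, 0 <= t <= T1 -> a + 2 * t < x < b - 2 * t -> at_rest t x.
Proof.
  intros HT1 Hab Hini.
  destruct (uniform_continuity_2d (fun t x => cf g (h t x)) 0 T1 a b) with (eps := mkposreal 1 Rlt_0_1)
    as [del Hdel].
  { intros t x Ht Hx; apply (cf_h_continuity g T h u v hx ux vx S); lra. }
  set (eps := del / 2). assert (Heps : 0 < eps < del) by (assert (K := cond_pos del); unfold eps; lra).
  assert (Hn : forall n t x, 0 <= t <= T1 -> t <= INR n * eps -> a + 2 * t < x < b - 2 * t -> at_rest t x).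
  { induction n as [ | n IH ]; intros t x Ht Hn Hx.
    - simpl in Hn. replace t with 0 in * by lra. apply Hini; lra.
    - destruct (Rle_dec t (INR n * eps)) as [Hl | Hl]; [ now apply IH | ].
      rewrite S_INR in Hn.
      assert (Hn0 : 0 <= INR n * eps) by (apply Rmult_le_pos; [ apply pos_INR | lra ]).
      apply (propagation_step (INR n * eps) t (a + 2 * (INR n * eps)) (b - 2 * (INR n * eps)));
        try lra; [ | intros y Hy; apply IH; lra ].
      intros s y Hs Hy.
      destruct (IH (INR n * eps) y ltac:(lra) ltac:(lra) ltac:(lra)) as [E _].
      assert (K := Hdel (INR n * eps) y s y ltac:(lra) ltac:(lra) ltac:(lra) ltac:(lra)
        ltac:(rewrite Rabs_right; lra) ltac:(rewrite Rminus_diag, Rabs_R0; apply cond_pos)).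
      simpl in K. rewrite E, cf_1 in K. apply Rabs_def2 in K. lra. }
  intros t x Ht Hx. destruct (nfloor_ex (T1 / eps)) as [N HN].
  { apply Rdiv_le_0_compat; lra. }
  apply (Hn (Datatypes.S N)); auto. rewrite S_INR.
  assert (T1 / eps * eps <= (INR N + 1) * eps) by (apply Rmult_le_compat_r; lra).
  replace (T1 / eps * eps) with T1 in H by (field; lra). lra.
Qed.
End Propagation.

(** * Conservation of vorticity and rest outside a bounded set *)

Lemma mvt_bound (f df : R -> R) (a b M : R) : a <= b ->
  (forall x, a < x < b -> is_derive f x (df x)) ->
  (forall x, a <= x <= b -> continuity_pt f x) ->
  (forall x, a <= x <= b -> Rabs (df x) <= M) -> Rabs (f b - f a) <= M * (b - a).
Proof.
  intros Hab Hd Hc HM.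
  destruct (MVT_gen f a b df) as [c [Hc1 Hc2]]; rewrite ?Rmin_left, ?Rmax_right in * by lra; auto.
  rewrite Hc2, Rabs_mult, (Rabs_right (b - a)) by lra.
  apply Rmult_le_compat_r; [ lra | apply HM; lra ].
Qed.

Definition dq (d : R) (f : R -> R -> R) (t x : R) : R := (f t (x + d) - f t x) / d.

Lemma dq_uniform (f fx : R -> R -> R) (a b c d eta : R) :
  (forall t x, a <= t <= b -> is_derive (fun y => f t y) x (fx t x)) ->
  (forall t x, a <= t <= b -> continuity_2d_pt fx t x) -> 0 < eta ->
  exists d0, 0 < d0 <= 1 /\ forall del t x, 0 < del < d0 -> a <= t <= b -> c <= x <= d ->
    Rabs (dq del f t x - fx t x) <= eta /\ Rabs (fx t (x + del) - fx t x) <= eta.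
Proof.
  intros Hd Hc Heta.
  destruct (uniform_continuity_2d fx a b c (d + 1)) with (eps := mkposreal _ Heta) as [d1 Hd1].
  { intros; apply Hc; lra. }
  exists (Rmin d1 1). assert (K := cond_pos d1).
  assert (K1 := Rmin_l d1 1). assert (K2 := Rmin_r d1 1).
  split; [ split; [ apply Rmin_glb_lt; lra | lra ] | ].
  intros del t x Hdel Ht Hx.
  assert (Hu : forall y, x <= y <= x + del -> Rabs (fx t y - fx t x) <= eta).
  { intros y Hy. left. apply (Hd1 t x t y); try lra.
    - rewrite Rminus_diag, Rabs_R0; lra.
    - rewrite Rabs_right; lra. }
  split; [ | apply Hu; lra ].
  destruct (MVT_gen (fun y => f t y) x (x + del) (fun y => fx t y)) as [z [Hz1 Hz2]];
    rewrite ?Rmin_left, ?Rmax_right in * by lra.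
  - intros y Hy; apply Hd; auto.
  - intros y Hy; eapply is_derive_continuity_pt, Hd; auto.
  - unfold dq. replace ((f t (x + del) - f t x) / del) with (fx t z)
      by (rewrite Hz2; field; lra).
    apply Hu; lra.
Qed.

Section Vorticity.
Variables (g T : R) (h u v hx ux vx : R -> R -> R).
Hypothesis S : smooth_flow g T h u v hx ux vx.

(** Formally v_x has time derivative - u_x, which cancels that of 1/h. Since v_x need not be
    differentiable in time, the mean value theorem is applied to a difference quotient of v plus
    1/h, whose time derivative is uniformly small. *)
Lemma vorticity_conserved (t x : R) : 0 <= t < T -> vx t x + / h t x = vx 0 x + / h 0 x.
Proof.
  intros Ht.
  assert (Hsmall : forall eta, 0 < eta ->
    Rabs ((vx t x + / h t x) - (vx 0 x + / h 0 x)) <= eta * (t + 2)).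
  { intros eta Heta.
    destruct (dq_uniform u ux 0 t x x eta) as [d1 [Hd1 D1]]; auto.
    { intros; apply (flow_u_x S); lra. }
    { intros; apply (flow_ux_c S); lra. }
    destruct (dq_uniform v vx 0 t x x eta) as [d2 [Hd2 D2]]; auto.
    { intros; apply (flow_v_x S); lra. }
    { intros; apply (flow_vx_c S); lra. }
    set (del := Rmin d1 d2 / 2).
    assert (Hdel : 0 < del < d1 /\ del < d2).
    { assert (K1 := Rmin_l d1 d2). assert (K2 := Rmin_r d1 d2).
      assert (0 < Rmin d1 d2) by (apply Rmin_glb_lt; lra). unfold del; lra. }
    assert (Hpos : forall s, s < T -> 0 < h s x) by (intros; now apply (flow_pos S)).
    set (phi := fun s => dq del v s x + / h s x).
    assert (Hphi : Rabs (phi t - phi 0) <= eta * (t - 0)).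
    { apply (mvt_bound phi (fun s => - dq del u s x + ux s x)); [ lra | | | ].
      - intros s Hs. unfold phi. apply (D_plus (fun s => dq del v s x) (fun s => / h s x)).
        + unfold dq. replace (- ((u s (x + del) - u s x) / del))
            with (/ del * (- u s (x + del) - - u s x)) by (field; lra).
          apply (is_derive_ext (fun s => / del * (v s (x + del) - v s x))).
          { intros y; toR; field; lra. }
          apply D_scal, D_minus; apply (flow_v_t S); lra.
        + specialize (Hpos s ltac:(lra)).
          replace (ux s x) with (- (- (h s x) ^ 2 * ux s x) / (h s x) ^ 2) by (field; lra).
          apply (is_derive_inv (fun s => h s x)); [ apply (flow_h_t S); lra | lra ].
      - intros s Hs. unfold phi, dq.
        assert (Hvc : forall y, continuity_pt (fun s => v s y) s)
          by (intros; apply continuity_2d_pt_slice1, (flow_v_c S); lra).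
        apply continuity_pt_plus.
        + apply continuity_pt_mult; [ | apply continuity_pt_const; intros ? ?; reflexivity ].
          apply continuity_pt_minus; apply Hvc.
        + apply continuity_pt_inv; [ | specialize (Hpos s ltac:(lra)); lra ].
          apply continuity_2d_pt_slice1, (flow_h_c S); lra.
      - intros s Hs. destruct (D1 del s x ltac:(lra) ltac:(lra) ltac:(lra)) as [K _].
        replace (- dq del u s x + ux s x) with (- (dq del u s x - ux s x)) by ring.
        now rewrite Rabs_Ropp. }
    destruct (D2 del t x ltac:(lra) ltac:(lra) ltac:(lra)) as [K1 _].
    destruct (D2 del 0 x ltac:(lra) ltac:(lra) ltac:(lra)) as [K2 _].
    unfold phi in Hphi. apply Rabs_le_between in Hphi.
    apply Rabs_le_between in K1. apply Rabs_le_between in K2. apply Rabs_le. lra. }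
  apply Rminus_diag_uniq. apply Rabs_eq_0.
  apply Rle_antisym; [ | apply Rabs_pos ].
  apply Rnot_lt_le; intros Hlt.
  set (A := Rabs (vx t x + / h t x - (vx 0 x + / h 0 x))) in *.
  assert (K := Hsmall (A / (2 * (t + 2))) ltac:(apply Rdiv_lt_0_compat; lra)).
  fold A in K. replace (A / (2 * (t + 2)) * (t + 2)) with (A / 2) in K by (field; lra). lra.
Qed.

(** A point far out is reached from a bounded interval lying entirely in the region of initial rest.
    The margin in the choice of L makes the state constant in a neighbourhood of every point with
    |x| >= L - 1, so the space derivatives vanish there too. *)
Lemma rest_outside (L0 T1 : R) : 0 < T1 < T ->
  (forall x, L0 < Rabs x -> at_rest h u v 0 x) ->
  exists L, 1 < L /\ forall t x, 0 <= t <= T1 -> L - 1 <= Rabs x ->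
    at_rest h u v t x /\ hx t x = 0 /\ ux t x = 0 /\ vx t x = 0.
Proof.
  intros HT1 Hini.
  set (M := Rabs L0 + 2 * T1 + 1).
  assert (HL0 := Rle_abs L0). assert (HL0' := Rabs_pos L0).
  assert (Hr : forall t x, 0 <= t <= T1 -> M < Rabs x -> at_rest h u v t x).
  { intros t x Ht Hx. unfold M in Hx. destruct (Rle_dec 0 x) as [Hp | Hp].
    - rewrite (Rabs_right x) in Hx by lra.
      apply (propagation g T h u v hx ux vx S T1 (Rabs L0) (x + 2 * T1 + 1)); try lra.
      intros y Hy; apply Hini. rewrite Rabs_right; lra.
    - rewrite (Rabs_left x) in Hx by lra.
      apply (propagation g T h u v hx ux vx S T1 (x - 2 * T1 - 1) (- Rabs L0)); try lra.
      intros y Hy; apply Hini. rewrite Rabs_left; lra. }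
  exists (M + 2). split; [ unfold M; lra | ].
  intros t x Ht Hx.
  split; [ apply Hr; auto; lra | ].
  assert (Hloc : locally x (fun y => at_rest h u v t y)).
  { exists (mkposreal 1 Rlt_0_1); intros y Hy. change (Rabs (y - x) < 1) in Hy.
    apply Hr; auto. revert Hy; generalize (y : R); clear y; intros y Hy.
    assert (K := Rabs_triang_inv x (x - y)).
    replace (x - (x - y)) with y in K by ring. rewrite (Rabs_minus_sym x y) in K. lra. }
  assert (Hu : forall (f : R -> R) l, is_derive f x l -> forall k, locally x (fun y => f y = k) -> l = 0).
  { intros f l Hf k Hk. rewrite <- (is_derive_unique f x l Hf).
    rewrite (Derive_ext_loc f (fun _ => k) x Hk). apply Derive_const. }
  split; [ | split ].
  - apply (Hu (fun y => h t y) _ (flow_h_x S t x ltac:(lra)) 1).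
    apply (filter_imp _ _ (fun y (H : at_rest h u v t y) => proj1 H) Hloc).
  - apply (Hu (fun y => u t y) _ (flow_u_x S t x ltac:(lra)) 0).
    apply (filter_imp _ _ (fun y (H : at_rest h u v t y) => proj1 (proj2 H)) Hloc).
  - apply (Hu (fun y => v t y) _ (flow_v_x S t x ltac:(lra)) 0).
    apply (filter_imp _ _ (fun y (H : at_rest h u v t y) => proj2 (proj2 H)) Hloc).
Qed.
End Vorticity.

(** * Energy *)

Definition yvar (g h : R) : R := Rpower h (g / 2).
(** This is h^2 times the derivative of [Qpot g], so that u times it is the energy flux. It vanishes
    at h = 1. *)
Definition press (g h : R) : R := (Rpower h g - 1) / g.
Definition dens (g : R) (h u v : R -> R -> R) (t x : R) : R :=
  / 2 * (u t x ^ 2 + v t x ^ 2) + Qpot g (h t x).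

Lemma is_derive_Qpot (g h : R) : 0 < h ->
  is_derive (Qpot g) h (/ g * (Rpower h (g - 2) - Rpower h (- 2))).
Proof.
  intros Hh. unfold Qpot. apply D_scal.
  apply (is_derive_RInt_from1 (fun s => Rpower s (g - 2) - Rpower s (-2))); auto.
  intros z Hz; apply (continuous_minus (V := R_NormedModule)
    (fun s => Rpower s (g - 2)) (fun s => Rpower s (-2))); now apply continuous_Rpower.
Qed.

Lemma Rpower_minus2 (g h : R) : 0 < h -> Rpower h (g - 2) = Rpower h g / h ^ 2.
Proof.
  intros Hh. unfold Rminus. rewrite Rpower_plus.
  replace (- (2)) with (- (1 + 1)) by ring.
  rewrite Rpower_Ropp, Rpower_plus, Rpower_1 by lra. field; lra.
Qed.

Lemma Rpower_m2 (h : R) : 0 < h -> Rpower h (- 2) = / h ^ 2.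
Proof.
  intros Hh. replace (- 2) with (0 - 2) by ring. rewrite Rpower_minus2 by auto.
  unfold Rpower at 1. rewrite Rmult_0_l, exp_0. field; lra.
Qed.

Lemma yvar_pos (g h : R) : 0 < yvar g h.
Proof. apply Rpower_pos. Qed.

Lemma yvar_sq (g h : R) : (yvar g h) ^ 2 = Rpower h g.
Proof. unfold yvar; simpl. rewrite Rmult_1_r, <- Rpower_plus. f_equal; field. Qed.

Lemma yvar_neg_power (g h : R) : 0 < g -> 0 < h -> Rpower (yvar g h) (- (2 / g)) = / h.
Proof.
  intros Hg Hh. unfold yvar. rewrite Rpower_mult.
  replace (g / 2 * - (2 / g)) with (- (1)) by (field; lra).
  now rewrite Rpower_Ropp, Rpower_1.
Qed.

Lemma yvar_neg_half_power (g h : R) : 0 < g -> 0 < h ->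
  Rpower (yvar g h) (- (2 / g / 2)) = / sqrt h.
Proof.
  intros Hg Hh. unfold yvar. rewrite Rpower_mult.
  replace (g / 2 * - (2 / g / 2)) with (- / 2) by (field; lra).
  now rewrite Rpower_Ropp, Rpower_sqrt.
Qed.

Lemma yvar_1 (g : R) : yvar g 1 = 1.
Proof. apply Rpower_one. Qed.

Lemma sqrt_kf (g h : R) : 0 < h -> sqrt h * kf g h = yvar g h / h.
Proof.
  intros Hh. unfold kf, yvar. rewrite <- Rpower_sqrt by auto.
  rewrite <- Rpower_plus. replace (/ 2 + (g - 3) / 2) with (g / 2 + - (1)) by field.
  rewrite Rpower_plus, Rpower_Ropp, Rpower_1 by auto. reflexivity.
Qed.

Lemma cf_sqrt (g h : R) : 0 < h -> cf g h = sqrt h * yvar g h.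
Proof.
  intros Hh. assert (K := sqrt_kf g h Hh). unfold cf.
  assert (Hss := sqrt_sqrt h ltac:(lra)).
  replace (yvar g h) with (h * (sqrt h * kf g h)) by (rewrite K; field; lra).
  rewrite <- Hss at 1. replace (sqrt h * (h * (sqrt h * kf g h))) with ((sqrt h * sqrt h) * h * kf g h) by ring.
  rewrite Hss. ring.
Qed.

Lemma is_derive_yvar (g h : R) : 0 < h -> is_derive (yvar g) h (g / 2 * yvar g h / h).
Proof. intros; now apply is_derive_Rpower. Qed.

Lemma Qpot_qint (g h : R) : 0 < g -> 0 < h ->
  Qpot g h = 2 / g ^ 2 * qint (2 / g) (yvar g h).
Proof.
  intros Hg Hh.
  set (f := fun z => Qpot g z - 2 / g ^ 2 * qint (2 / g) (yvar g z)).
  assert (Hf1 : f 1 = 0).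
  { unfold f. rewrite yvar_1, qint_1. unfold Qpot.
    rewrite (RInt_point (V := R_CompleteNormedModule)). unfold zero; simpl. ring. }
  assert (Hd : forall z, 0 < z -> is_derive f z 0).
  { intros z Hz. unfold f.
    assert (Hy := yvar_pos g z).
    replace 0 with (/ g * (Rpower z (g - 2) - Rpower z (- 2))
      - 2 / g ^ 2 * (g / 2 * yvar g z / z * qden (2 / g) (yvar g z))).
    - apply D_minus; [ now apply is_derive_Qpot | ]. apply D_scal.
      apply (D_comp (qint (2 / g)) (yvar g)); [ now apply is_derive_qint | now apply is_derive_yvar ].
    - rewrite qden_eq by auto. rewrite yvar_neg_power, Rpower_minus2, Rpower_m2, <- yvar_sq by auto.
      field; lra. }
  assert (Hf : f h = f 1).
  { destruct (MVT_gen f 1 h (fun _ => 0)) as [c [_ Hc]].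
    - intros z Hz; apply Hd. revert Hz; unfold Rmin; destruct (Rle_dec 1 h); lra.
    - intros z Hz; eapply is_derive_continuity_pt, Hd.
      revert Hz; unfold Rmin; destruct (Rle_dec 1 h); lra.
    - lra. }
  unfold f in Hf at 1. rewrite Hf1 in Hf. lra.
Qed.

Lemma is_derive_press (g h : R) : 0 < g -> 0 < h -> is_derive (press g) h (Rpower h (g - 1)).
Proof.
  intros Hg Hh. unfold press.
  apply (is_derive_ext (fun z => / g * (Rpower z g - 1))); [ intros z; toR; field; lra | ].
  replace (Rpower h (g - 1)) with (/ g * (g * Rpower h g / h - 0)).
  - apply D_scal, D_minus; [ now apply is_derive_Rpower | apply D_const ].
  - unfold Rminus; rewrite Rpower_plus, Rpower_Ropp, Rpower_1 by lra. field; lra.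
Qed.

Lemma Qpot_1 (g : R) : Qpot g 1 = 0.
Proof.
  unfold Qpot. rewrite (RInt_point (V := R_CompleteNormedModule)). apply Rmult_0_r.
Qed.

Lemma continuity_2d_pow2 (f : R -> R -> R) (t x : R) : continuity_2d_pt f t x ->
  continuity_2d_pt (fun t x => f t x ^ 2) t x.
Proof.
  intros. apply (continuity_2d_comp (fun z => z ^ 2)); auto.
  apply derivable_continuous_pt, derivable_pt_pow.
Qed.

Lemma D_sq (f : R -> R) (x l : R) : is_derive f x l -> is_derive (fun z => f z ^ 2) x (2 * f x * l).
Proof.
  intros H. replace (2 * f x * l) with (l * (2 * f x)) by ring.
  apply (D_comp (fun z => z ^ 2) f); auto. auto_derive; [ trivial | toR; ring ].
Qed.

Section Energy.
Variables (g T : R) (h u v hx ux vx : R -> R -> R).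
Hypothesis Hg : 1 <= g.
Hypothesis S : smooth_flow g T h u v hx ux vx.

Let eta := dens g h u v.
Let flux t x := u t x * press g (h t x).
Let fluxx t x := ux t x * press g (h t x) + u t x * (Rpower (h t x) (g - 1) * hx t x).

Lemma dens_t (t x : R) : 0 < t < T -> is_derive (fun s => eta s x) t (- fluxx t x).
Proof.
  intros Ht. assert (Hh := flow_pos S t x ltac:(lra)).
  unfold eta, dens, fluxx.
  replace (- (ux t x * press g (h t x) + u t x * (Rpower (h t x) (g - 1) * hx t x)))
    with (/ 2 * (2 * u t x * (v t x - Rpower (h t x) (g - 1) * hx t x) + 2 * v t x * (- u t x))
      + (- (h t x) ^ 2 * ux t x) * (/ g * (Rpower (h t x) (g - 2) - Rpower (h t x) (- 2)))).
  - apply (D_plus (fun s => / 2 * (u s x ^ 2 + v s x ^ 2)) (fun s => Qpot g (h s x))).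
    + apply D_scal. apply (D_plus (fun s => u s x ^ 2) (fun s => v s x ^ 2)).
      * apply (D_sq (fun s => u s x)), (flow_u_t S); auto.
      * apply (D_sq (fun s => v s x)), (flow_v_t S); auto.
    + apply (D_comp (Qpot g) (fun s => h s x)); [ now apply is_derive_Qpot | ].
      apply (flow_h_t S); auto.
  - rewrite Rpower_minus2, Rpower_m2 by auto. unfold press. field; lra.
Qed.

Lemma flux_x (t x : R) : t < T -> is_derive (fun y => flux t y) x (fluxx t x).
Proof.
  intros Ht. unfold flux, fluxx.
  apply (D_mult (fun y => u t y) (fun y => press g (h t y))).
  - apply (flow_u_x S); auto.
  - rewrite Rmult_comm. apply (D_comp (press g) (fun y => h t y)).
    + apply is_derive_press; [ lra | apply (flow_pos S); auto ].
    + apply (flow_h_x S); auto.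
Qed.

Lemma continuity_2d_h (F dF : R -> R) (t x : R) : t < T ->
  (forall z, 0 < z -> is_derive F z (dF z)) -> continuity_2d_pt (fun t x => F (h t x)) t x.
Proof.
  intros Ht HF. apply continuity_2d_comp; [ | apply (flow_h_c S); auto ].
  eapply is_derive_continuity_pt, HF, (flow_pos S); auto.
Qed.

Lemma dens_continuity (t x : R) : t < T -> continuity_2d_pt eta t x.
Proof.
  intros Ht. unfold eta, dens. apply continuity_2d_pt_plus.
  - apply continuity_2d_pt_mult; [ apply continuity_2d_pt_const | ].
    apply continuity_2d_pt_plus; apply continuity_2d_pow2;
      [ apply (flow_u_c S) | apply (flow_v_c S) ]; auto.
  - eapply continuity_2d_h; auto. intros z Hz; now apply is_derive_Qpot.
Qed.

Lemma fluxx_continuity (t x : R) : t < T -> continuity_2d_pt fluxx t x.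
Proof.
  intros Ht. unfold fluxx.
  apply continuity_2d_pt_plus; apply continuity_2d_pt_mult.
  - apply (flow_ux_c S); auto.
  - eapply continuity_2d_h; auto. intros z Hz; apply is_derive_press; auto; lra.
  - apply (flow_u_c S); auto.
  - apply continuity_2d_pt_mult; [ | apply (flow_hx_c S); auto ].
    eapply (continuity_2d_h (fun z => Rpower z (g - 1))); auto.
    intros z Hz; now apply is_derive_Rpower.
Qed.

Lemma ex_RInt_slice (f : R -> R -> R) (t a b : R) :
  (forall x, continuity_2d_pt f t x) -> ex_RInt (f t) a b.
Proof.
  intros Hf. apply (ex_RInt_continuous (V := R_CompleteNormedModule)). intros z _.
  apply continuity_pt_filterlim. apply (continuity_2d_pt_slice2 f), Hf.
Qed.

Lemma RInt_dens_t (t a b : R) : 0 < t < T ->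
  is_derive (fun s => RInt (eta s) a b) t (flux t a - flux t b).
Proof.
  intros Ht.
  assert (Hloc : locally t (fun s => 0 < s < T)).
  { assert (Hm : 0 < Rmin t (T - t)) by (apply Rmin_glb_lt; lra).
    exists (mkposreal _ Hm); intros s Hs. change (Rabs (s - t) < Rmin t (T - t)) in Hs.
    assert (K1 := Rmin_l t (T - t)). assert (K2 := Rmin_r t (T - t)).
    apply Rabs_def2 in Hs. lra. }
  assert (K : is_derive (fun s => RInt (eta s) a b) t
    (RInt (fun x => Derive (fun s => eta s x) t) a b)).
  { apply (is_derive_RInt_param eta a b t).
    - apply (filter_imp _ _ (fun s (Hs : 0 < s < T) x _ => ex_intro _ _ (dens_t s x Hs)) Hloc).
    - intros x _.
      apply (continuity_2d_pt_ext_loc (fun s y => - fluxx s y)).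
      + destruct Hloc as [d Hd]. exists d; intros s y Hs Hy.
        symmetry. apply is_derive_unique, dens_t, Hd, Hs.
      + apply continuity_2d_pt_opp, fluxx_continuity; lra.
    - apply (filter_imp (fun s => 0 < s < T)); auto.
      intros s Hs; apply ex_RInt_slice; intros; apply dens_continuity; lra. }
  replace (flux t a - flux t b) with (RInt (fun x => Derive (fun s => eta s x) t) a b); [ exact K | ].
  apply (is_RInt_unique (V := R_CompleteNormedModule)).
  replace (flux t a - flux t b) with ((fun y => - flux t y) b - (fun y => - flux t y) a) by (simpl; ring).
  apply (is_RInt_ext (fun x => - fluxx t x)).
  { intros x _. symmetry. now apply is_derive_unique, dens_t. }
  apply (is_RInt_derive (V := R_CompleteNormedModule) (fun y => - flux t y) (fun x => - fluxx t x)).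
  - intros x _. apply (is_derive_opp (fun y => flux t y)), flux_x; lra.
  - intros x _. apply (continuous_opp (V := R_NormedModule) (fun x => fluxx t x)).
    apply continuity_pt_filterlim. apply (continuity_2d_pt_slice2 fluxx), fluxx_continuity; lra.
Qed.

(* The energy behind ([e = 1]) or ahead of ([e = -1]) the point [x]. *)
Definition een (L e t x : R) : R := e * RInt (dens g h u v t) (- e * L) x.

Lemma een_t (L e t x : R) : 0 < t < T -> u t (- e * L) = 0 ->
  is_derive (fun s => een L e s x) t (- e * (u t x * press g (h t x))).
Proof.
  intros Ht HL. unfold een.
  replace (- e * (u t x * press g (h t x))) with (e * (flux t (- e * L) - flux t x)).
  - apply D_scal, RInt_dens_t; auto.
  - unfold flux. rewrite HL. ring.
Qed.

Lemma een_x (L e t x : R) : t < T ->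
  is_derive (fun y => een L e t y) x (e * dens g h u v t x).
Proof.
  intros Ht. unfold een. apply D_scal.
  assert (Hc : forall y, continuity_pt (eta t) y)
    by (intros; apply continuity_2d_pt_slice2, dens_continuity; auto).
  apply (is_derive_RInt (eta t) (fun y => RInt (eta t) (- e * L) y) (- e * L) x).
  - exists (mkposreal 1 Rlt_0_1); intros y _.
    apply (RInt_correct (V := R_CompleteNormedModule)), ex_RInt_slice.
    intros; apply dens_continuity; auto.
  - apply continuity_pt_filterlim, Hc.
Qed.

Lemma een_continuity (L e t x T2 : R) : 0 < t < T2 -> T2 <= T ->
  (forall s, 0 < s < T2 -> u s (- e * L) = 0) -> continuity_2d_pt (een L e) t x.
Proof.
  intros Ht HT2 HL.
  assert (Hm : 0 < Rmin t (T2 - t)) by (apply Rmin_glb_lt; lra).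
  assert (Hloc : forall s, Rabs (s - t) < Rmin t (T2 - t) -> 0 < s < T2).
  { intros s Hs. assert (K1 := Rmin_l t (T2 - t)). assert (K2 := Rmin_r t (T2 - t)).
    apply Rabs_def2 in Hs. lra. }
  apply continuity_2d_pt_filterlim.
  apply (filterdiff_continuous (fun p : R * R => een L e (fst p) (snd p)) (t, x)).
  eexists. apply (is_derive_filterdiff (een L e) t x (fun s y => - e * flux s y) (e * dens g h u v t x)).
  - exists (mkposreal _ Hm); intros [s y] [Hs _]; simpl.
    assert (K := Hloc s Hs). apply een_t; auto; lra.
  - apply een_x; lra.
  - apply (continuity_2d_pt_filterlim (fun s y => - e * flux s y) t x).
    apply continuity_2d_pt_mult; [ apply continuity_2d_pt_const | ].
    unfold flux. apply continuity_2d_pt_mult; [ apply (flow_u_c S); lra | ].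
    eapply continuity_2d_h; [ lra | ]. intros z Hz; apply is_derive_press; auto; lra.
Qed.

Lemma een_sum (L e t x : R) : e = 1 \/ e = - 1 -> t < T ->
  een L e t x + een L (- e) t x = RInt (dens g h u v t) (- L) L.
Proof.
  intros He Ht. unfold een. fold eta.
  assert (Hex : forall a b, ex_RInt (eta t) a b)
    by (intros; apply ex_RInt_slice; intros; apply dens_continuity; auto).
  assert (C := RInt_Chasles (V := R_CompleteNormedModule) (eta t) (- L) x L (Hex _ _) (Hex _ _)).
  assert (O := opp_RInt_swap (V := R_CompleteNormedModule) (eta t) x L (Hex _ _)).
  unfold plus, opp in C, O; simpl in C, O.
  destruct He as [-> | ->].
  - replace (- (1) * L) with (- L) by ring. replace (- - (1) * L) with L by ring. lra.
  - replace (- -1 * L) with L by ring. replace (- - -1 * L) with (- L) by ring. lra.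
Qed.

(** The time derivative is available only for positive times. The energy is thus constant on (0, t],
    and uniform continuity of the density extends this to time 0. *)
Lemma energy_constant (L T1 t : R) : 0 <= L -> T1 < T ->
  (forall s, 0 <= s <= T1 -> u s (- L) = 0 /\ u s L = 0) -> 0 <= t <= T1 ->
  RInt (eta t) (- L) L = RInt (eta 0) (- L) L.
Proof.
  intros HL HT1 Hu Ht.
  destruct (Req_dec t 0) as [-> | Hne]; [ reflexivity | ].
  assert (Hconst : forall s, 0 < s <= t -> RInt (eta s) (- L) L = RInt (eta t) (- L) L).
  { intros s Hs. destruct (MVT_gen (fun s => RInt (eta s) (- L) L) s t (fun s => 0)) as [c [_ Hc]];
      rewrite ?Rmin_left, ?Rmax_right in * by lra.
    - intros z Hz. replace 0 with (flux z (- L) - flux z L).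
      + apply RInt_dens_t; lra.
      + destruct (Hu z ltac:(lra)) as [E1 E2]. unfold flux; rewrite E1, E2; ring.
    - intros z Hz. eapply is_derive_continuity_pt, RInt_dens_t; lra.
    - lra. }
  apply Rminus_diag_uniq, Rabs_eq_0. apply Rle_antisym; [ | apply Rabs_pos ].
  apply Rnot_lt_le; intros Hlt.
  set (A := Rabs (RInt (eta t) (- L) L - RInt (eta 0) (- L) L)) in *.
  set (ep := A / (2 * (2 * L + 1))).
  assert (Hep : 0 < ep) by (apply Rdiv_lt_0_compat; lra).
  destruct (uniform_continuity_2d eta 0 T1 (- L) L) with (eps := mkposreal _ Hep) as [d Hd].
  { intros; apply dens_continuity; lra. }
  set (s := Rmin t (d / 2)).
  assert (Hs : 0 < s <= t /\ s < d).
  { assert (K := cond_pos d). assert (K1 := Rmin_l t (d / 2)). assert (K2 := Rmin_r t (d / 2)).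
    assert (0 < Rmin t (d / 2)) by (apply Rmin_glb_lt; lra). unfold s; lra. }
  assert (Hex : forall s, s < T -> ex_RInt (eta s) (- L) L)
    by (intros; apply ex_RInt_slice; intros; apply dens_continuity; auto).
  assert (K : Rabs (RInt (fun x => eta s x - eta 0 x) (- L) L) <= (L - - L) * ep).
  { apply abs_RInt_le_const; [ lra | | ].
    - apply (ex_RInt_minus (V := R_NormedModule)); apply Hex; lra.
    - intros x Hx. left. apply Hd; try lra.
      + rewrite Rabs_right; lra.
      + rewrite Rminus_diag, Rabs_R0; apply cond_pos. }
  rewrite (RInt_minus (V := R_CompleteNormedModule) (eta s) (eta 0)) in K by (apply Hex; lra).
  unfold minus, plus, opp in K; simpl in K. rewrite (Hconst s ltac:(lra)) in K.
  fold (RInt (eta t) (- L) L - RInt (eta 0) (- L) L) in K. fold A in K.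
  assert (E : (2 * (2 * L + 1)) * ep = A) by (unfold ep; field; lra). lra.
Qed.
End Energy.

(** * A minimum principle along characteristics *)

Definition is_sign (e : R) : Prop := e = 1 \/ e = - 1.

Lemma is_sign_sq (e : R) : is_sign e -> e * e = 1.
Proof. intros [-> | ->]; ring. Qed.

Lemma is_sign_opp (e : R) : is_sign e -> is_sign (- e).
Proof. intros [-> | ->]; [ right | left ]; ring. Qed.

Lemma is_sign_abs (e : R) : is_sign e -> Rabs e = 1.
Proof. intros [-> | ->]; [ apply Rabs_R1 | rewrite Rabs_left; lra ]. Qed.

Lemma right_min_derive (f : R -> R) (t l d : R) : 0 < d -> is_derive f t l ->
  (forall s, t <= s <= t + d -> f t <= f s) -> 0 <= l.
Proof.
  intros Hd Hl Hm.
  assert (K : is_derive (fun s => - f (- s)) (- t) l).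
  { replace l with (- (- 1 * l)) by ring. apply (is_derive_opp (fun s => f (- s))).
    apply (D_comp f (fun s => - s)); [ rewrite Ropp_involutive; auto | ].
    auto_derive; [ trivial | toR; ring ]. }
  apply (left_max_derive _ _ _ d Hd K). intros s Hs. specialize (Hm (- s) ltac:(lra)).
  rewrite Ropp_involutive. lra.
Qed.

(* The functions [Z e] only satisfy [Z_t + kap Z_x = rhs] in a weak sense: they are uniform
   limits of differentiable functions whose directional derivatives converge uniformly. *)
Definition transported (a b L : R) (Z kap rhs : R -> R -> R -> R) : Prop :=
  forall eta, 0 < eta -> exists W Wt Wx : R -> R -> R -> R,
    forall e t x, is_sign e -> a <= t <= b -> - L <= x <= L ->
      continuity_2d_pt (W e) t x /\
      is_derive (fun s => W e s x) t (Wt e t x) /\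
      is_derive (fun y => W e t y) x (Wx e t x) /\
      Rabs (W e t x - Z e t x) <= eta /\
      Rabs (Wt e t x + kap e t x * Wx e t x - rhs e t x) <= eta.

Lemma transported_opp (a b L : R) (Z kap rhs : R -> R -> R -> R) :
  transported a b L Z kap rhs ->
  transported a b L (fun e t x => - Z e t x) kap (fun e t x => - rhs e t x).
Proof.
  intros H eta Heta. destruct (H eta Heta) as [W [Wt [Wx HW]]].
  exists (fun e t x => - W e t x), (fun e t x => - Wt e t x), (fun e t x => - Wx e t x).
  intros e t x He Ht Hx. destruct (HW e t x He Ht Hx) as [K1 [K2 [K3 [K4 K5]]]].
  split; [ | split; [ | split; [ | split ] ] ].
  - now apply continuity_2d_pt_opp.
  - now apply (is_derive_opp (fun s => W e s x)).
  - now apply (is_derive_opp (fun y => W e t y)).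
  - replace (- W e t x - - Z e t x) with (- (W e t x - Z e t x)) by ring. now rewrite Rabs_Ropp.
  - replace (- Wt e t x + kap e t x * - Wx e t x - - rhs e t x)
      with (- (Wt e t x + kap e t x * Wx e t x - rhs e t x)) by ring. now rewrite Rabs_Ropp.
Qed.

(** An approximation W within eta/2 is minimized instead of Z. Since W - w is differentiable, the
    exact first order conditions hold at its minimizer: the x-derivative vanishes inside, and the
    time derivative has a sign away from the corresponding end of [a, b]. Minimizing over both signs
    at once also compares Z e with Z (- e) at that point. *)
Lemma near_minimizer (a b L : R) (Z kap rhs w wt wx : R -> R -> R -> R) (eta : R) :
  a <= b -> 0 <= L -> 0 < eta -> transported a b L Z kap rhs ->
  (forall e t x, is_sign e -> a <= t <= b -> - L <= x <= L ->
     continuity_2d_pt (w e) t x /\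
     is_derive (fun s => w e s x) t (wt e t x) /\
     is_derive (fun y => w e t y) x (wx e t x)) ->
  exists e t x, is_sign e /\ a <= t <= b /\ - L <= x <= L /\
    (forall e' t' x', is_sign e' -> a <= t' <= b -> - L <= x' <= L ->
       Z e t x - w e t x <= Z e' t' x' - w e' t' x' + eta) /\
    (- L < x < L ->
       (t < b -> - eta <= rhs e t x - (wt e t x + kap e t x * wx e t x)) /\
       (a < t -> rhs e t x - (wt e t x + kap e t x * wx e t x) <= eta)).
Proof.
  intros Hab HL Heta HZ Hw.
  destruct (HZ (eta / 2) ltac:(lra)) as [W [Wt [Wx HW]]].
  set (Phi := fun e t x => W e t x - w e t x).
  assert (Hc : forall e, is_sign e -> forall t x, a <= t <= b -> - L <= x <= L ->
    continuity_2d_pt (Phi e) t x).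
  { intros e He t x Ht Hx. apply continuity_2d_pt_minus; [ now apply HW | now apply Hw ]. }
  assert (Hmin : exists e t x, is_sign e /\ a <= t <= b /\ - L <= x <= L /\
    forall e' t' x', is_sign e' -> a <= t' <= b -> - L <= x' <= L -> Phi e t x <= Phi e' t' x').
  { destruct (rectangle_min (Phi 1) a b (- L) L Hab ltac:(lra) (Hc 1 ltac:(left; auto)))
      as [t1 [x1 [K1 [K2 K3]]]].
    destruct (rectangle_min (Phi (- 1)) a b (- L) L Hab ltac:(lra) (Hc (- 1) ltac:(right; auto)))
      as [t2 [x2 [K4 [K5 K6]]]].
    destruct (Rle_dec (Phi 1 t1 x1) (Phi (- 1) t2 x2)) as [Hl | Hl].
    - exists 1, t1, x1. split; [ left; auto | split; [ auto | split; auto ] ].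
      intros e' t' x' [-> | ->] Ht' Hx'; auto. specialize (K6 t' x' Ht' Hx'); lra.
    - exists (- 1), t2, x2. split; [ right; auto | split; [ auto | split; auto ] ].
      intros e' t' x' [-> | ->] Ht' Hx'; auto. specialize (K3 t' x' Ht' Hx'); lra. }
  destruct Hmin as [e [t [x [He [Ht [Hx Hmin]]]]]].
  exists e, t, x. split; [ auto | split; [ auto | split; [ auto | split ] ] ].
  - intros e' t' x' He' Ht' Hx'. specialize (Hmin e' t' x' He' Ht' Hx'). unfold Phi in Hmin.
    destruct (HW e t x He Ht Hx) as [_ [_ [_ [K1 _]]]].
    destruct (HW e' t' x' He' Ht' Hx') as [_ [_ [_ [K2 _]]]].
    apply Rabs_le_between in K1. apply Rabs_le_between in K2. lra.
  - intros Hin. destruct (HW e t x He Ht Hx) as [_ [K1 [K2 [_ K3]]]].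
    destruct (Hw e t x He Ht Hx) as [_ [K4 K5]].
    apply Rabs_le_between in K3.
    assert (Kx : Wx e t x - wx e t x = 0).
    { assert (Z0 : - (Wx e t x - wx e t x) = 0); [ | lra ].
      apply (interior_max_derive (fun y => - Phi e t y) (- L) L x); auto.
      - apply (is_derive_opp (fun y => Phi e t y)). now apply D_minus.
      - intros y Hy. specialize (Hmin e t y He Ht ltac:(lra)). lra. }
    assert (Kt : is_derive (fun s => Phi e s x) t (Wt e t x - wt e t x)) by now apply D_minus.
    assert (Ksum : kap e t x * Wx e t x - kap e t x * wx e t x = 0)
      by (replace (Wx e t x) with (wx e t x) by lra; ring).
    split; intros Hlt.
    + assert (0 <= Wt e t x - wt e t x); [ | lra ].
      apply (right_min_derive _ t _ (b - t) ltac:(lra) Kt). intros s Hs; apply Hmin; auto; lra.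
    + assert (0 <= - (Wt e t x - wt e t x)); [ | lra ].
      apply (left_max_derive (fun s => - Phi e s x) t _ (t - a)); [ lra | | ].
      * now apply (is_derive_opp (fun s => Phi e s x)).
      * intros s Hs. assert (K := Hmin e s x He ltac:(lra) Hx). lra.
Qed.

(** * Uniform limits of difference quotients *)

Definition unif (a b c d : R) (F : R -> R -> R -> R) (f : R -> R -> R) : Prop :=
  forall eta, 0 < eta -> exists d0, 0 < d0 /\ forall del t x,
    0 < del < d0 -> a <= t <= b -> c <= x <= d -> Rabs (F del t x - f t x) <= eta.

Section Unif.
Variables (a b c d : R).

Lemma unif_const (f : R -> R -> R) : unif a b c d (fun _ => f) f.
Proof.
  intros eta Heta; exists 1; split; [ lra | ]. intros. rewrite Rminus_diag, Rabs_R0; lra.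
Qed.

Lemma unif_plus (F G : R -> R -> R -> R) (f g : R -> R -> R) :
  unif a b c d F f -> unif a b c d G g ->
  unif a b c d (fun del t x => F del t x + G del t x) (fun t x => f t x + g t x).
Proof.
  intros HF HG eta Heta.
  destruct (HF (eta / 2) ltac:(lra)) as [d1 [Hd1 K1]].
  destruct (HG (eta / 2) ltac:(lra)) as [d2 [Hd2 K2]].
  exists (Rmin d1 d2); split; [ now apply Rmin_glb_lt | ].
  intros del t x Hdel Ht Hx. assert (M1 := Rmin_l d1 d2). assert (M2 := Rmin_r d1 d2).
  specialize (K1 del t x ltac:(lra) Ht Hx). specialize (K2 del t x ltac:(lra) Ht Hx).
  apply Rabs_le_between in K1. apply Rabs_le_between in K2. apply Rabs_le. lra.
Qed.

Lemma unif_mult (F G : R -> R -> R -> R) (f g : R -> R -> R) :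
  unif a b c d F f -> unif a b c d G g ->
  (forall t x, a <= t <= b -> c <= x <= d -> continuity_2d_pt f t x) ->
  (forall t x, a <= t <= b -> c <= x <= d -> continuity_2d_pt g t x) ->
  unif a b c d (fun del t x => F del t x * G del t x) (fun t x => f t x * g t x).
Proof.
  intros HF HG Hf Hg eta Heta.
  destruct (rectangle_bounded f a b c d Hf) as [M1 [HM1 B1]].
  destruct (rectangle_bounded g a b c d Hg) as [M2 [HM2 B2]].
  set (ep := Rmin 1 (eta / (M1 + M2 + 1))).
  assert (Hep : 0 < ep) by (apply Rmin_glb_lt; [ lra | apply Rdiv_lt_0_compat; lra ]).
  destruct (HF ep Hep) as [d1 [Hd1 K1]]. destruct (HG ep Hep) as [d2 [Hd2 K2]].
  exists (Rmin d1 d2); split; [ now apply Rmin_glb_lt | ].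
  intros del t x Hdel Ht Hx. assert (N1 := Rmin_l d1 d2). assert (N2 := Rmin_r d1 d2).
  specialize (K1 del t x ltac:(lra) Ht Hx). specialize (K2 del t x ltac:(lra) Ht Hx).
  specialize (B1 t x Ht Hx). specialize (B2 t x Ht Hx).
  replace (F del t x * G del t x - f t x * g t x)
    with ((F del t x - f t x) * (G del t x - g t x) + (F del t x - f t x) * g t x
          + f t x * (G del t x - g t x)) by ring.
  assert (E1 : ep <= 1) by apply Rmin_l.
  assert (E2 : ep * (M1 + M2 + 1) <= eta).
  { apply Rle_trans with (eta / (M1 + M2 + 1) * (M1 + M2 + 1)); [ | right; field; lra ].
    apply Rmult_le_compat_r; [ lra | apply Rmin_r ]. }
  eapply Rle_trans; [ apply Rabs_triang | ].
  eapply Rle_trans; [ apply Rplus_le_compat_r, Rabs_triang | ].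
  rewrite !Rabs_mult.
  assert (A1 := Rabs_pos (F del t x - f t x)). assert (A2 := Rabs_pos (G del t x - g t x)).
  assert (A3 := Rabs_pos (f t x)). assert (A4 := Rabs_pos (g t x)).
  assert (Rabs (F del t x - f t x) * Rabs (G del t x - g t x) <= ep * 1)
    by (apply Rmult_le_compat; lra).
  assert (Rabs (F del t x - f t x) * Rabs (g t x) <= ep * M2) by (apply Rmult_le_compat; lra).
  assert (Rabs (f t x) * Rabs (G del t x - g t x) <= M1 * ep) by (apply Rmult_le_compat; lra).
  lra.
Qed.

Lemma unif_dq (f fx : R -> R -> R) :
  (forall t x, a <= t <= b -> is_derive (fun y => f t y) x (fx t x)) ->
  (forall t x, a <= t <= b -> continuity_2d_pt fx t x) ->
  unif a b c d (fun del => dq del f) fx.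
Proof.
  intros Hd Hc eta Heta. destruct (dq_uniform f fx a b c d eta Hd Hc Heta) as [d0 [Hd0 K]].
  exists d0; split; [ lra | ]. intros del t x Hdel Ht Hx. now apply K.
Qed.

Lemma unif_shift (f : R -> R -> R) :
  (forall t x, a <= t <= b -> continuity_2d_pt f t x) ->
  unif a b c d (fun del t x => f t (x + del)) f.
Proof.
  intros Hc eta Heta.
  destruct (uniform_continuity_2d f a b c (d + 1)) with (eps := mkposreal _ Heta) as [d1 Hd1].
  { intros; apply Hc; lra. }
  exists (Rmin d1 1). assert (K := cond_pos d1).
  assert (K1 := Rmin_l d1 1). assert (K2 := Rmin_r d1 1).
  split; [ apply Rmin_glb_lt; lra | ].
  intros del t x Hdel Ht Hx. left. apply (Hd1 t x t (x + del)); try lra.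
  - rewrite Rminus_diag, Rabs_R0; lra.
  - rewrite Rabs_right; lra.
Qed.

Lemma unif_ext (F : R -> R -> R -> R) (f g : R -> R -> R) :
  (forall t x, a <= t <= b -> c <= x <= d -> f t x = g t x) ->
  unif a b c d F f -> unif a b c d F g.
Proof.
  intros He H eta Heta. destruct (H eta Heta) as [d0 [Hd0 K]]. exists d0; split; auto.
  intros. rewrite <- He by auto. now apply K.
Qed.
End Unif.

(** * Evolution of the weighted gradients *)

Lemma is_derive_cf (g h : R) : 0 < h -> is_derive (cf g) h ((g + 1) / 2 * (h * kf g h)).
Proof.
  intros Hh. unfold cf.
  replace ((g + 1) / 2 * (h * kf g h))
    with (2 * h * kf g h + h ^ 2 * ((g - 3) / 2 * kf g h / h)) by (field; lra).
  apply (D_mult (fun z => z ^ 2) (kf g)); [ | now apply is_derive_Rpower ].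
  auto_derive; [ trivial | toR; ring ].
Qed.

Lemma is_derive_sqrt' (h : R) : 0 < h -> is_derive sqrt h (/ (2 * sqrt h)).
Proof. intros; apply is_derive_Reals, derivable_pt_lim_sqrt; auto. Qed.

Definition riemx (g e : R) (h hx ux : R -> R -> R) (t x : R) : R :=
  ux t x + e * (kf g (h t x) * hx t x).
Definition Zc (g : R) (h hx ux : R -> R -> R) (e t x : R) : R :=
  sqrt (h t x) * riemx g e h hx ux t x.
(** Here v_x at time t has been replaced by the conserved vorticity minus 1/h. *)
Definition Zrhs (g : R) (h hx ux vx : R -> R -> R) (e t x : R) : R :=
  sqrt (h t x) * (vx 0 x + / h 0 x - / h t x - (g + 1) / 4 * Zc g h hx ux e t x ^ 2
    + (g - 1) / 4 * (Zc g h hx ux e t x * Zc g h hx ux (- e) t x)).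

Section Transport.
Variables (g T : R) (h u v hx ux vx : R -> R -> R).
Hypothesis S : smooth_flow g T h u v hx ux vx.
Let Hpos := flow_pos S.

Lemma riemx_continuity (e t x : R) : t < T -> continuity_2d_pt (riemx g e h hx ux) t x.
Proof.
  intros Ht. unfold riemx.
  apply continuity_2d_pt_plus; [ apply (flow_ux_c S); auto | ].
  apply continuity_2d_pt_mult; [ apply continuity_2d_pt_const | ].
  apply continuity_2d_pt_mult; [ | apply (flow_hx_c S); auto ].
  apply continuity_2d_comp; [ apply kf_continuity; auto | ].
  apply (flow_h_c S); auto.
Qed.

Lemma sqrt_h_continuity (t x : R) : t < T -> continuity_2d_pt (fun t x => sqrt (h t x)) t x.
Proof.
  intros Ht. apply continuity_2d_comp; [ | apply (flow_h_c S); auto ].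
  eapply is_derive_continuity_pt, is_derive_sqrt'; auto.
Qed.

Lemma Zc_continuity (e t x : R) : t < T -> continuity_2d_pt (Zc g h hx ux e) t x.
Proof.
  intros Ht. unfold Zc.
  apply continuity_2d_pt_mult; [ now apply sqrt_h_continuity | now apply riemx_continuity ].
Qed.

(** Derivative of sqrt h in the direction (1, e c) of the characteristic. *)
Let A (e t x : R) : R := - (h t x ^ 2 * / (2 * sqrt (h t x))) * riemx g (- e) h hx ux t x.

Lemma A_continuity (e t x : R) : t < T -> continuity_2d_pt (A e) t x.
Proof.
  intros Ht. unfold A. assert (Hs := sqrt_lt_R0 _ (Hpos t x Ht)).
  apply continuity_2d_pt_mult; [ apply continuity_2d_pt_opp | now apply riemx_continuity ].
  apply continuity_2d_pt_mult; [ apply continuity_2d_pow2, (flow_h_c S); auto | ].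
  apply continuity_2d_pt_inv; [ | lra ].
  apply continuity_2d_pt_mult; [ apply continuity_2d_pt_const | now apply sqrt_h_continuity ].
Qed.

Let cx (t x : R) : R := hx t x * ((g + 1) / 2 * (h t x * kf g (h t x))).

Lemma cx_continuity (t x : R) : t < T -> continuity_2d_pt cx t x.
Proof.
  intros Ht. unfold cx. apply continuity_2d_pt_mult; [ apply (flow_hx_c S); auto | ].
  apply continuity_2d_pt_mult; [ apply continuity_2d_pt_const | ].
  apply continuity_2d_pt_mult; [ apply (flow_h_c S); auto | ].
  apply continuity_2d_comp; [ apply kf_continuity; auto | ].
  apply (flow_h_c S); auto.
Qed.

(** Directional derivative of sqrt h times the difference quotient of the Riemann invariant. In the
    quotient of c r_x the discrete product rule leaves only the quotient of c times the shifted r_x: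
    the quotients of r_x, which need not converge, cancel against the transport term. Every
    remaining factor converges uniformly. *)
Let Qd (e del t x : R) : R :=
  A e t x * dq del (riem g e h u) t x
  + sqrt (h t x) * (dq del v t x
      + - e * (dq del (fun t x => cf g (h t x)) t x * riemx g e h hx ux t (x + del))).

Lemma Qd_limit (e a b c d : R) : is_sign e -> 0 <= a -> b < T ->
  unif a b c d (Qd e) (Zrhs g h hx ux vx e).
Proof.
  intros He Ha Hb.
  apply (unif_ext a b c d (Qd e) (fun t x => A e t x * riemx g e h hx ux t x
    + sqrt (h t x) * (vx t x + - e * (cx t x * riemx g e h hx ux t x)))).
  - intros t x Ht _. unfold Zrhs.
    assert (Hh := Hpos t x ltac:(lra)). assert (Hs := sqrt_lt_R0 _ Hh).
    assert (Hss := sqrt_sqrt (h t x) ltac:(lra)).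
    rewrite <- (vorticity_conserved g T h u v hx ux vx S t x ltac:(lra)).
    unfold A, cx, Zc, riemx.
    set (s := sqrt (h t x)) in *. set (k := kf g (h t x)). rewrite <- Hss.
    replace ((s * s) ^ 2 * / (2 * s)) with (s ^ 3 / 2) by (field; lra).
    set (X := e * (k * hx t x)).
    replace (- e * (k * hx t x)) with (- X) by (unfold X; ring).
    replace (- e * (hx t x * ((g + 1) / 2 * (s * s * k)) * (ux t x + X)))
      with (- ((g + 1) / 2 * (s * s) * X * (ux t x + X))) by (unfold X; field).
    field; lra.
  - assert (Hr : unif a b c d (fun del => dq del (riem g e h u)) (riemx g e h hx ux)).
    { apply unif_dq; intros t x Ht.
      - apply (riem_x g T h u v hx ux vx S); lra.
      - apply riemx_continuity; lra. }
    assert (Cr : forall t x, a <= t <= b -> c <= x <= d -> continuity_2d_pt (riemx g e h hx ux) t x)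
      by (intros; apply riemx_continuity; lra).
    assert (Ccx : forall t x, a <= t <= b -> c <= x <= d -> continuity_2d_pt cx t x)
      by (intros; apply cx_continuity; lra).
    apply (unif_plus a b c d (fun del t x => A e t x * dq del (riem g e h u) t x)).
    { apply (unif_mult a b c d (fun _ => A e)); auto; [ apply unif_const | ].
      intros; apply A_continuity; lra. }
    apply (unif_mult a b c d (fun _ t x => sqrt (h t x))).
    + apply (unif_const a b c d (fun t x => sqrt (h t x))).
    + apply (unif_plus a b c d (fun del => dq del v)).
      { apply unif_dq; intros t x Ht.
        - apply (flow_v_x S); lra.
        - apply (flow_vx_c S); lra. }
      apply (unif_mult a b c d (fun _ _ _ => - e)).
      * apply (unif_const a b c d (fun _ _ => - e)).
      * apply (unif_mult a b c d (fun del => dq del (fun t x => cf g (h t x)))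
          (fun del t x => riemx g e h hx ux t (x + del))); auto.
        -- apply unif_dq; intros t x Ht; [ | apply cx_continuity; lra ].
           apply (D_comp (cf g) (fun y => h t y)); [ apply is_derive_cf, Hpos; lra | ].
           apply (flow_h_x S); lra.
        -- apply unif_shift. intros; apply riemx_continuity; lra.
      * intros; apply continuity_2d_pt_const.
      * intros; apply continuity_2d_pt_mult; auto.
    + intros; apply sqrt_h_continuity; lra.
    + intros t x Ht Hx. apply continuity_2d_pt_plus; [ apply (flow_vx_c S); lra | ].
      apply continuity_2d_pt_mult; [ apply continuity_2d_pt_const | ].
      apply continuity_2d_pt_mult; auto.
Qed.

(** The approximations are sqrt h times the difference quotients of the Riemann invariants, with one
    step [del] small enough for both signs. *)
Lemma Z_transported (a b L : R) : 0 < a -> b < T ->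
  transported a b L (Zc g h hx ux) (fun e t x => e * cf g (h t x)) (Zrhs g h hx ux vx).
Proof.
  intros Ha Hb eta Heta.
  assert (HW : forall e, is_sign e -> unif a b (- L) L
     (fun del t x => sqrt (h t x) * dq del (riem g e h u) t x) (Zc g h hx ux e)).
  { intros e He. apply (unif_mult a b (- L) L (fun _ t x => sqrt (h t x))).
    - apply (unif_const a b (- L) L (fun t x => sqrt (h t x))).
    - apply unif_dq; intros t x Ht.
      + apply (riem_x g T h u v hx ux vx S); lra.
      + apply riemx_continuity; lra.
    - intros; apply sqrt_h_continuity; lra.
    - intros; apply riemx_continuity; lra. }
  assert (H1 : is_sign 1) by (left; auto). assert (H2 : is_sign (- 1)) by (right; auto).
  destruct (HW 1 H1 eta Heta) as [d1 [Hd1 K1]].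
  destruct (HW (- 1) H2 eta Heta) as [d2 [Hd2 K2]].
  destruct (Qd_limit 1 a b (- L) L H1 ltac:(lra) Hb eta Heta) as [d3 [Hd3 K3]].
  destruct (Qd_limit (- 1) a b (- L) L H2 ltac:(lra) Hb eta Heta) as [d4 [Hd4 K4]].
  assert (Hdel : exists del, 0 < del /\ del < d1 /\ del < d2 /\ del < d3 /\ del < d4).
  { exists (Rmin (Rmin d1 d2) (Rmin d3 d4) / 2).
    assert (M1 := Rmin_l d1 d2). assert (M2 := Rmin_r d1 d2).
    assert (M3 := Rmin_l d3 d4). assert (M4 := Rmin_r d3 d4).
    assert (M5 := Rmin_l (Rmin d1 d2) (Rmin d3 d4)). assert (M6 := Rmin_r (Rmin d1 d2) (Rmin d3 d4)).
    assert (0 < Rmin (Rmin d1 d2) (Rmin d3 d4)) by (repeat apply Rmin_glb_lt; lra). lra. }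
  destruct Hdel as [del [Hdel [D1 [D2 [D3 D4]]]]].
  set (Rt := fun e t x => v t x - e * cf g (h t x) * riemx g e h hx ux t x).
  exists (fun e t x => sqrt (h t x) * dq del (riem g e h u) t x).
  exists (fun e t x => (- h t x ^ 2 * ux t x * / (2 * sqrt (h t x))) * dq del (riem g e h u) t x
    + sqrt (h t x) * ((Rt e t (x + del) - Rt e t x) / del)).
  exists (fun e t x => (hx t x * / (2 * sqrt (h t x))) * dq del (riem g e h u) t x
    + sqrt (h t x) * ((riemx g e h hx ux t (x + del) - riemx g e h hx ux t x) / del)).
  intros e t x He Ht Hx.
  assert (Hh := Hpos t x ltac:(lra)). assert (Hs := sqrt_lt_R0 _ Hh).
  assert (Hdiv : forall p q : R, (p - q) / del = / del * (p - q)) by (intros; field; lra).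
  split; [ | split; [ | split; [ | split ] ] ].
  - apply continuity_2d_pt_mult; [ apply sqrt_h_continuity; lra | ].
    unfold dq. apply (continuity_2d_pt_ext (fun t x => / del * (riem g e h u t (x + del) - riem g e h u t x))).
    { intros; now rewrite Hdiv. }
    apply continuity_2d_pt_mult; [ apply continuity_2d_pt_const | ].
    apply continuity_2d_pt_minus; [ | apply (riem_continuity g T h u v hx ux vx S); lra ].
    intros ep. destruct (riem_continuity g T h u v hx ux vx S e t (x + del) ltac:(lra) ep) as [d Hd].
    exists d; intros s y Hs1 Hy. apply Hd; auto.
    replace (y + del - (x + del)) with (y - x) by ring. auto.
  - apply (D_mult (fun s => sqrt (h s x)) (fun s => dq del (riem g e h u) s x)).
    + apply (D_comp sqrt (fun s => h s x)); [ now apply is_derive_sqrt' | ].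
      apply (flow_h_t S); lra.
    + unfold dq. rewrite Hdiv.
      apply (is_derive_ext (fun s => / del * (riem g e h u s (x + del) - riem g e h u s x))).
      { intros; now rewrite Hdiv. }
      apply D_scal, D_minus; apply (riem_t g T h u v hx ux vx S); try apply is_sign_sq; auto; lra.
  - apply (D_mult (fun y => sqrt (h t y)) (fun y => dq del (riem g e h u) t y)).
    + apply (D_comp sqrt (fun y => h t y)); [ now apply is_derive_sqrt' | ].
      apply (flow_h_x S); lra.
    + unfold dq. rewrite Hdiv.
      apply (is_derive_ext (fun y => / del * (riem g e h u t (y + del) - riem g e h u t y))).
      { intros; now rewrite Hdiv. }
      apply D_scal, D_minus; [ | apply (riem_x g T h u v hx ux vx S); lra ].
      rewrite <- (Rmult_1_l (riemx g e h hx ux t (x + del))).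
      apply (D_comp (riem g e h u t) (fun y => y + del)).
      * apply (riem_x g T h u v hx ux vx S); lra.
      * auto_derive; [ trivial | toR; ring ].
  - destruct He as [-> | ->]; [ apply K1 | apply K2 ]; lra.
  - assert (K : Rabs (Qd e del t x - Zrhs g h hx ux vx e t x) <= eta)
      by (destruct He as [-> | ->]; [ apply K3 | apply K4 ]; lra).
    match goal with |- Rabs (?E - _) <= _ => replace E with (Qd e del t x); [ exact K | ] end.
    unfold Qd, A, Rt.
    replace (riemx g (- e) h hx ux t x) with (ux t x - e * (kf g (h t x) * hx t x))
      by (unfold riemx; ring).
    set (D := dq del (riem g e h u) t x). unfold dq.
    set (r := riemx g e h hx ux t x). set (r' := riemx g e h hx ux t (x + del)).
    set (c' := cf g (h t (x + del))). unfold cf.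
    set (k := kf g (h t x)). set (s := sqrt (h t x)) in *. field; lra.
Qed.
End Transport.

(** * Upper bound for the weighted gradients *)

Section Bounds.
Variables (g T : R) (h u v hx ux vx : R -> R -> R).
Hypothesis Hg : 1 <= g.
Hypothesis S : smooth_flow g T h u v hx ux vx.
Let Hpos := flow_pos S.
Let Z := Zc g h hx ux.
Variables (T1 L : R).
Hypothesis HT1 : 0 < T1 < T.
Hypothesis HL : 1 < L.
Hypothesis Hrest : forall t x, 0 <= t <= T1 -> L - 1 <= Rabs x -> hx t x = 0 /\ ux t x = 0.

Lemma Zc_rest (e t x : R) : 0 <= t <= T1 -> L - 1 <= Rabs x -> Z e t x = 0.
Proof.
  intros Ht Hx. destruct (Hrest t x Ht Hx) as [E1 E2].
  unfold Z, Zc, riemx. rewrite E1, E2. ring.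
Qed.

(** The transport equation is available only for positive times; this carries initial bounds to a
    small positive time. *)
Lemma Zc_start (ep : R) : 0 < ep -> exists d, 0 < d /\
  forall e t x, is_sign e -> 0 <= t <= T1 -> t < d -> - L <= x <= L ->
    Rabs (Z e t x - Z e 0 x) <= ep.
Proof.
  intros Hep.
  assert (K : forall e, is_sign e -> exists d, 0 < d /\ forall t x, 0 <= t <= T1 -> t < d ->
    - L <= x <= L -> Rabs (Z e t x - Z e 0 x) <= ep).
  { intros e He.
    destruct (uniform_continuity_2d (Z e) 0 T1 (- L) L) with (eps := mkposreal _ Hep) as [d Hd].
    { intros; apply (Zc_continuity g T h u v hx ux vx S); lra. }
    exists d; split; [ apply cond_pos | ]. intros t x Ht Htd Hx. left. apply Hd; try lra.
    - rewrite Rabs_right; lra.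
    - rewrite Rminus_diag, Rabs_R0; apply cond_pos. }
  destruct (K 1 ltac:(left; auto)) as [d1 [Hd1 K1]].
  destruct (K (- 1) ltac:(right; auto)) as [d2 [Hd2 K2]].
  exists (Rmin d1 d2); split; [ now apply Rmin_glb_lt | ].
  assert (M1 := Rmin_l d1 d2). assert (M2 := Rmin_r d1 d2).
  intros e t x [-> | ->] Ht Htd Hx; [ apply K1 | apply K2 ]; lra.
Qed.

Lemma Zc_bounded : exists C, 0 < C /\ forall e t x, is_sign e -> 0 <= t <= T1 ->
  - L <= x <= L -> Rabs (Z e t x) <= C /\ sqrt (h t x) <= C.
Proof.
  assert (K : forall e, exists M, 0 < M /\ forall t x, 0 <= t <= T1 -> - L <= x <= L ->
    Rabs (Z e t x) <= M).
  { intros e. apply rectangle_bounded. intros; apply (Zc_continuity g T h u v hx ux vx S); lra. }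
  destruct (K 1) as [C1 [HC1 B1]]. destruct (K (- 1)) as [C2 [HC2 B2]].
  destruct (rectangle_bounded (fun t x => sqrt (h t x)) 0 T1 (- L) L) as [C3 [HC3 B3]].
  { intros; apply (sqrt_h_continuity g T h u v hx ux vx S); lra. }
  exists (C1 + C2 + C3). split; [ lra | ]. intros e t x He Ht Hx.
  specialize (B1 t x Ht Hx). specialize (B2 t x Ht Hx). specialize (B3 t x Ht Hx).
  assert (A := Rle_abs (sqrt (h t x))).
  split; [ destruct He as [-> | ->] | ]; lra.
Qed.

Variables (w M : R).
Hypothesis Hw : forall x, vx 0 x + / h 0 x <= w.

(** At a maximum z over both signs the other gradient is at most z up to the error, so the quadratic
    terms reduce to - z^2/2, and the right-hand side is nonpositive, up to the error, once z >= M
    and M^2 >= 2 w. The small slope [beta] makes the contradiction strict. *)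
Lemma Z_upper : 0 <= M -> 2 * w <= M ^ 2 -> (forall e x, is_sign e -> Z e 0 x <= M) ->
  forall e t x, is_sign e -> 0 <= t <= T1 -> Z e t x <= M.
Proof.
  intros HM HwM Hini e t x He Ht.
  destruct (Rle_dec (L - 1) (Rabs x)) as [Hx | Hx]; [ rewrite Zc_rest by auto; lra | ].
  assert (Hx' : - L <= x <= L).
  { apply Rnot_le_lt in Hx. assert (Hxx : Rabs x <= L) by lra. now apply Rabs_le_between in Hxx. }
  destruct (Req_dec t 0) as [-> | Ht0]; [ now apply Hini | ].
  apply Rnot_lt_le; intros Hlt. set (ep := Z e t x - M). assert (Hep : 0 < ep) by (unfold ep; lra).
  destruct (Zc_start (ep / 4) ltac:(lra)) as [d [Hd Hst]].
  destruct Zc_bounded as [C [HC HB]].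
  set (a := Rmin t (d / 2)).
  assert (Ha : 0 < a <= t /\ a < d).
  { assert (K1 := Rmin_l t (d / 2)). assert (K2 := Rmin_r t (d / 2)).
    assert (0 < Rmin t (d / 2)) by (apply Rmin_glb_lt; lra). unfold a; lra. }
  set (beta := ep / (4 * T1)). assert (Hbeta : 0 < beta) by (apply Rdiv_lt_0_compat; lra).
  assert (HbT : beta * T1 = ep / 4) by (unfold beta; field; lra).
  (* [q * eta] bounds the total approximation error, so eta q <= beta/2 leaves it below the slope
     [beta]. *)
  set (q := 1 + C * ((g - 1) / 4 * C)).
  assert (Hq : 1 <= q).
  { unfold q. assert (0 <= C * ((g - 1) / 4 * C)); [ | lra ].
    apply Rmult_le_pos; [ lra | apply Rmult_le_pos; lra ]. }
  set (eta := Rmin (ep / 8) (beta / (2 * q))).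
  assert (Heta : 0 < eta) by (apply Rmin_glb_lt; [ lra | apply Rdiv_lt_0_compat; lra ]).
  assert (Heta1 : eta <= ep / 8) by apply Rmin_l.
  assert (Heta2 : eta * q <= beta / 2).
  { apply Rle_trans with (beta / (2 * q) * q); [ apply Rmult_le_compat_r; [ lra | apply Rmin_r ] | ].
    right; field; lra. }
  destruct (near_minimizer a T1 L (fun e t x => - Z e t x) (fun e t x => e * cf g (h t x))
    (fun e t x => - Zrhs g h hx ux vx e t x) (fun _ t _ => - beta * t) (fun _ _ _ => - beta)
    (fun _ _ _ => 0) eta) as [e1 [t1 [x1 [He1 [Ht1 [Hx1 [Hmin Hcrit]]]]]]]; auto; try lra.
  { apply transported_opp, (Z_transported g T h u v hx ux vx S); lra. }
  { intros e' t' x' _ _ _. split; [ | split ].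
    - apply continuity_2d_pt_mult; [ apply continuity_2d_pt_const | apply continuity_2d_pt_id1 ].
    - assert (K := D_scal (fun z => z) (- beta) t' 1 (D_id t')). rewrite Rmult_1_r in K. exact K.
    - apply D_const. }
  assert (HZ1 : Z e1 t1 x1 <= M + ep / 4).
  { destruct (Req_dec t1 a) as [E | Hne].
    { rewrite E. assert (K := Hst e1 a x1 He1 ltac:(lra) ltac:(lra) Hx1).
      assert (K2 := Hini e1 x1 He1). apply Rabs_le_between in K. lra. }
    destruct (Rle_dec (Z e1 t1 x1) M) as [Hle | Hgt]; [ lra | exfalso ].
    apply Rnot_le_lt in Hgt.
    assert (Hin : - L < x1 < L).
    { destruct (Rlt_dec (Rabs x1) (L - 1)) as [K | K]; [ apply Rabs_def2 in K; lra | ].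
      rewrite (Zc_rest e1 t1 x1) in Hgt by lra. lra. }
    destruct (Hcrit Hin) as [_ K]. specialize (K ltac:(lra)). rewrite Rmult_0_r in K.
    assert (K2 := Hmin (- e1) t1 x1 (is_sign_opp e1 He1) Ht1 Hx1).
    destruct (HB e1 t1 x1 He1 ltac:(lra) Hx1) as [B1 B2].
    unfold Zrhs in K. fold Z in K. specialize (Hw x1).
    assert (Hh := Hpos t1 x1 ltac:(lra)).
    assert (Hi := Rinv_0_lt_compat _ Hh). assert (Hs := sqrt_lt_R0 _ Hh).
    set (z := Z e1 t1 x1) in *. set (zb := Z (- e1) t1 x1) in *.
    apply Rabs_le_between in B1.
    assert (Kz : z * zb <= z * (z + eta)) by (apply Rmult_le_compat_l; lra).
    assert (Kz2 : M ^ 2 <= z ^ 2) by (apply pow_incr; lra).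
    assert (Kb : vx 0 x1 + / h 0 x1 - / h t1 x1 - (g + 1) / 4 * z ^ 2 + (g - 1) / 4 * (z * zb)
       <= (g - 1) / 4 * C * eta).
    { assert ((g - 1) / 4 * (z * zb) <= (g - 1) / 4 * (z * (z + eta)))
        by (apply Rmult_le_compat_l; lra).
      assert ((g - 1) / 4 * eta * z <= (g - 1) / 4 * eta * C)
        by (apply Rmult_le_compat_l; [ apply Rmult_le_pos; lra | lra ]).
      lra. }
    assert (Kc := Rmult_le_compat_l _ _ _ (Rlt_le _ _ Hs) Kb).
    assert (sqrt (h t1 x1) * ((g - 1) / 4 * C * eta) <= C * ((g - 1) / 4 * C * eta)).
    { apply Rmult_le_compat_r; [ | lra ]. apply Rmult_le_pos; [ apply Rmult_le_pos | ]; lra. }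
    unfold q in Heta2. lra. }
  assert (K := Hmin e t x He ltac:(lra) Hx').
  assert (beta * t <= beta * T1) by (apply Rmult_le_compat_l; lra).
  assert (0 <= beta * t1) by (apply Rmult_le_pos; lra).
  unfold ep in *. lra.
Qed.
End Bounds.

(** * Volume and velocity against energy *)

(** The squared negative part of f does not increase. The derivative therefore has to be controlled
    only where f is negative. *)
Lemma stay_nonneg (f df : R -> R) (a b : R) : a <= b ->
  (forall x, a <= x <= b -> is_derive f x (df x)) -> 0 <= f a ->
  (forall x, a <= x <= b -> f x < 0 -> 0 <= df x) -> 0 <= f b.
Proof.
  intros Hab Hd Ha Hp. apply Rnot_lt_le; intros Hb.
  assert (K : sqpos (- f b) <= sqpos (- f a)).
  { apply (derive_nonpos_ge (fun x => sqpos (- f x)) (fun x => - df x * sqpos' (- f x)) a b Hab).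
    - intros x Hx. apply (D_comp sqpos (fun x => - f x)); [ apply is_derive_sqpos | ].
      now apply (is_derive_opp f), Hd.
    - intros x Hx. destruct (Rlt_dec (f x) 0) as [Hl | Hl].
      + assert (0 <= df x * sqpos' (- f x)); [ | lra ].
        apply Rmult_le_pos; [ now apply Hp | apply sqpos'_ge0 ].
      + unfold sqpos'. rewrite Rmax_left by lra. right; ring. }
  unfold sqpos in K at 2. rewrite Rmax_left in K by lra.
  assert (K2 := sqpos_pos (- f b) ltac:(lra)). lra.
Qed.

Lemma qint_ge0 (p y : R) : 0 < p <= 2 -> 0 < y -> 0 <= qint p y.
Proof.
  intros Hp Hy. destruct (Rle_dec 1 y); [ now apply qint_nonneg | apply qint_nonneg_lt1; lra ].
Qed.

Lemma theta_bounds (p : R) : 0 < theta p <= 1.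
Proof. unfold theta; destruct (Rle_dec p 1); lra. Qed.

Section Static.
Variables (g T : R) (h u v hx ux vx : R -> R -> R).
Hypothesis Hg : 1 <= g.
Hypothesis S : smooth_flow g T h u v hx ux vx.
Let Hpos := flow_pos S.
Let Z := Zc g h hx ux.
Let Y t x := yvar g (h t x).
Let p := 2 / g.
Variables (L M s t : R).
Hypothesis HL : 0 < L.
Hypothesis HsM : 0 < s <= M.
Hypothesis Ht : t < T.
Hypothesis HZ : forall e x, is_sign e -> - s <= Z e t x <= M.
Hypothesis Hbd : forall e, is_sign e -> h t (e * L) = 1 /\ u t (e * L) = 0.
(** The inverse of the Lipschitz constant of Y: its slope is g/4 times a difference of two gradients
    in [- s, M]. *)
Let kappa := 4 / (g * (M + s)).

Lemma exponent_range : 0 < p <= 2.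
Proof.
  unfold p. split; [ apply Rdiv_lt_0_compat; lra | ].
  apply Rle_trans with (2 / 1); [ | lra ]. apply Rmult_le_compat_l; [ lra | ].
  apply Rinv_le_contravar; lra.
Qed.
Let Hp := exponent_range.

Lemma kappa_pos : 0 < kappa.
Proof. apply Rdiv_lt_0_compat; [ lra | apply Rmult_lt_0_compat; lra ]. Qed.

Lemma Y_x (x : R) : is_derive (fun x => Y t x) x (g / 4 * (Z 1 t x - Z (- 1) t x)).
Proof.
  assert (Hh := Hpos t x Ht).
  replace (g / 4 * (Z 1 t x - Z (- 1) t x)) with (hx t x * (g / 2 * yvar g (h t x) / h t x)).
  - apply (D_comp (yvar g) (fun x => h t x)); [ now apply is_derive_yvar | ].
    apply (flow_h_x S); auto.
  - unfold Z, Zc, riemx. assert (K := sqrt_kf g (h t x) Hh).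
    replace (g / 4 * (sqrt (h t x) * (ux t x + 1 * (kf g (h t x) * hx t x)) -
      sqrt (h t x) * (ux t x + -1 * (kf g (h t x) * hx t x))))
      with (g / 2 * (sqrt (h t x) * kf g (h t x)) * hx t x) by field.
    rewrite K. field; lra.
Qed.

Lemma Y_x_bound (e x : R) : is_sign e ->
  Rabs (kappa * (e * (g / 4 * (Z 1 t x - Z (- 1) t x)))) <= 1.
Proof.
  intros He. assert (H1 := HZ 1 x ltac:(left; auto)). assert (H2 := HZ (- 1) x ltac:(right; auto)).
  replace (kappa * (e * (g / 4 * (Z 1 t x - Z (- 1) t x))))
    with (e * ((Z 1 t x - Z (- 1) t x) * / (M + s))) by (unfold kappa; field; lra).
  rewrite Rabs_mult, (is_sign_abs e He), Rmult_1_l, Rabs_mult, (Rabs_right (/ (M + s))).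
  - apply (Rmult_le_reg_r (M + s)); [ lra | ].
    rewrite Rmult_assoc, Rinv_l, Rmult_1_r, Rmult_1_l by lra. apply Rabs_le. lra.
  - left. apply Rinv_0_lt_compat; lra.
Qed.

Lemma een_start (e : R) : een g h u v L e t (- e * L) = 0.
Proof. unfold een. rewrite (RInt_point (V := R_CompleteNormedModule)). apply Rmult_0_r. Qed.

Lemma dens_ge (x : R) : / 2 * u t x ^ 2 + 2 / g ^ 2 * qint p (Y t x) <= dens g h u v t x.
Proof.
  unfold dens. rewrite Qpot_qint by (try apply Hpos; lra).
  assert (0 <= v t x ^ 2) by apply pow2_ge_0. unfold p, Y. lra.
Qed.

Lemma D_rescale (f : R -> R) (e r l : R) : is_derive f (e * r) l ->
  is_derive (fun r => f (e * r)) r (e * l).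
Proof.
  intros H. apply (D_comp f (fun r => e * r)); auto. auto_derive; [ trivial | toR; ring ].
Qed.

Lemma g2_pos : 0 < 2 / g ^ 2.
Proof. apply Rdiv_lt_0_compat; [ lra | apply pow_lt; lra ]. Qed.

Lemma sign_range (e x : R) : is_sign e -> - L <= x <= L -> - L <= e * x <= L.
Proof. intros [-> | ->]; lra. Qed.

(** Integrated from the end of the interval, where y = 1 and both sides vanish: the density is at
    least 2/g^2 [qint], while [Qint] of Y varies at rate at most [qint] / kappa. The sign e' covers
    both y > 1 and y < 1. *)
Lemma een_ge_Qint (e e' x : R) : is_sign e -> is_sign e' -> - L <= x <= L ->
  kappa * (2 / g ^ 2) * (e' * Qint p (Y t x)) <= een g h u v L e t x.
Proof.
  intros He He' Hx. assert (Hee := is_sign_sq e He).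
  set (k := kappa * (2 / g ^ 2)).
  assert (Hg2 := g2_pos).
  set (f := fun r => een g h u v L e t (e * r) - k * e' * Qint p (Y t (e * r))).
  enough (0 <= f (e * x)).
  { unfold f in H. rewrite <- Rmult_assoc, Hee, Rmult_1_l in H. lra. }
  set (yx := fun r => g / 4 * (Z 1 t (e * r) - Z (- 1) t (e * r))).
  apply (stay_nonneg f (fun r => e * (e * dens g h u v t (e * r))
    - k * e' * (e * yx r * qint p (Y t (e * r)))) (- L) (e * x)).
  - assert (K := sign_range e x He Hx); lra.
  - intros r Hr. apply (D_minus (fun r => een g h u v L e t (e * r))
      (fun r => k * e' * Qint p (Y t (e * r)))).
    + apply (D_rescale (fun y => een g h u v L e t y)). apply (een_x g T h u v hx ux vx S); auto.
    + apply D_scal. apply (D_comp (Qint p) (fun r => Y t (e * r))).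
      * apply is_derive_Qint, yvar_pos.
      * apply (D_rescale (fun y => Y t y)), Y_x.
  - unfold f. replace (e * - L) with (- e * L) by ring. rewrite een_start.
    unfold Y. destruct (Hbd (- e) (is_sign_opp e He)) as [E1 _].
    rewrite E1, yvar_1, Qint_1. lra.
  - intros r Hr _. rewrite <- Rmult_assoc, Hee, Rmult_1_l.
    assert (Hd := dens_ge (e * r)). assert (Hq := qint_ge0 p (Y t (e * r)) Hp (yvar_pos _ _)).
    assert (Hb := Y_x_bound (e * e') (e * r) ltac:(destruct He as [-> | ->], He' as [-> | ->];
      [ left | right | right | left ]; ring)).
    fold (yx r) in Hb. apply Rabs_le_between in Hb.
    assert (0 <= u t (e * r) ^ 2) by apply pow2_ge_0.
    assert (K : 2 / g ^ 2 * qint p (Y t (e * r)) * (kappa * (e * e' * yx r)) <=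
       2 / g ^ 2 * qint p (Y t (e * r)) * 1).
    { apply Rmult_le_compat_l; [ apply Rmult_le_pos; lra | lra ]. }
    unfold k. lra.
Qed.

Lemma een_ge_0 (e x : R) : is_sign e -> - L <= x <= L -> 0 <= een g h u v L e t x.
Proof.
  intros He Hx. assert (K1 := een_ge_Qint e 1 x He ltac:(left; auto) Hx).
  assert (K2 := een_ge_Qint e (- 1) x He ltac:(right; auto) Hx). lra.
Qed.

(** The velocity enters through the squared positive part of - e u, which is C^1 and vanishes at the
    starting end. The derivative is controlled only where Y < 1, which is why [stay_nonneg] is used:
    where Y >= 1, [een_ge_Qint] already gives f >= 0. *)
Lemma een_ge_velocity (e x : R) : is_sign e -> - L <= x <= L -> e * u t x <= 0 -> Y t x < 1 ->
  kappa * (2 / g ^ 2) * (theta p * (g * u t x / 2) ^ 2 * (1 - Y t x) - Qint p (Y t x))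
  <= een g h u v L e t x.
Proof.
  intros He Hx Hu Hy. assert (Hee := is_sign_sq e He).
  assert (Hk := kappa_pos). assert (Hg2 := g2_pos). assert (Hth := theta_bounds p).
  set (k := kappa * (2 / g ^ 2)).
  set (U := fun r => sqpos (- e * u t (e * r))).
  set (f := fun r => een g h u v L e t (e * r) - (kappa * (theta p / 2) * (U r * (1 - Y t (e * r)))
     - k * Qint p (Y t (e * r)))).
  enough (0 <= f (e * x)).
  { unfold f, U in H. rewrite <- Rmult_assoc, Hee, Rmult_1_l in H.
    assert (E : sqpos (- e * u t x) = u t x ^ 2).
    { unfold sqpos. rewrite Rmax_right by lra.
      replace ((- e * u t x) ^ 2) with ((e * e) * u t x ^ 2) by ring. rewrite Hee; ring. }
    rewrite E in H.
    replace (k * (theta p * (g * u t x / 2) ^ 2 * (1 - Y t x) - Qint p (Y t x)))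
      with (kappa * (theta p / 2) * (u t x ^ 2 * (1 - Y t x)) - k * Qint p (Y t x))
      by (unfold k; field; lra).
    lra. }
  set (yx := fun r => g / 4 * (Z 1 t (e * r) - Z (- 1) t (e * r))).
  set (Ux := fun r => e * (- e * ux t (e * r)) * sqpos' (- e * u t (e * r))).
  apply (stay_nonneg f (fun r => e * (e * dens g h u v t (e * r))
    - (kappa * (theta p / 2) * (Ux r * (1 - Y t (e * r)) + U r * (0 - e * yx r))
       - k * (e * yx r * qint p (Y t (e * r))))) (- L) (e * x)).
  - assert (K := sign_range e x He Hx); lra.
  - intros r Hr.
    assert (HY : is_derive (fun r => Y t (e * r)) r (e * yx r))
      by (apply (D_rescale (fun y => Y t y)), Y_x).
    apply (D_minus (fun r => een g h u v L e t (e * r))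
      (fun r => kappa * (theta p / 2) * (U r * (1 - Y t (e * r))) - k * Qint p (Y t (e * r)))).
    + apply (D_rescale (fun y => een g h u v L e t y)). apply (een_x g T h u v hx ux vx S); auto.
    + apply (D_minus (fun r => kappa * (theta p / 2) * (U r * (1 - Y t (e * r))))
        (fun r => k * Qint p (Y t (e * r)))); apply D_scal.
      * apply (D_mult U (fun r => 1 - Y t (e * r))).
        -- unfold U, Ux. apply (D_comp sqpos (fun r => - e * u t (e * r))); [ apply is_derive_sqpos | ].
           replace (e * (- e * ux t (e * r))) with (- e * (e * ux t (e * r))) by ring.
           apply D_scal, (D_rescale (fun y => u t y)), (flow_u_x S); auto.
        -- apply D_minus; [ apply D_const | exact HY ].
      * apply (D_comp (Qint p) (fun r => Y t (e * r))); [ apply is_derive_Qint, yvar_pos | exact HY ].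
  - unfold f, U. replace (e * - L) with (- e * L) by ring. rewrite een_start.
    unfold Y. destruct (Hbd (- e) (is_sign_opp e He)) as [E1 E2].
    rewrite E1, E2, yvar_1, Qint_1. lra.
  - intros r Hr Hneg.
    assert (Hr' : - L <= e * r <= L).
    { apply sign_range; auto. assert (K := sign_range e x He Hx). lra. }
    assert (HUge : 0 <= U r) by apply sqpos_ge0.
    assert (Hy1 : Y t (e * r) < 1).
    { apply Rnot_le_lt; intros Hge.
      assert (K := een_ge_Qint e (- 1) (e * r) He ltac:(right; auto) Hr'). fold k in K.
      assert (0 <= kappa * (theta p / 2) * (U r * (Y t (e * r) - 1))).
      { apply Rmult_le_pos; [ apply Rmult_le_pos; lra | apply Rmult_le_pos; lra ]. }
      unfold f in Hneg. lra. }
    assert (Hh := Hpos t (e * r) Ht). assert (Hy0 := yvar_pos g (h t (e * r))). fold (Y t (e * r)) in Hy0.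
    assert (Hd := dens_ge (e * r)).
    assert (Hq := qint_ge0 p (Y t (e * r)) Hp Hy0).
    assert (Hb := Y_x_bound e (e * r) He). fold (yx r) in Hb.
    set (rho := Rabs (kappa * (e * yx r))) in *.
    assert (Hrho : - rho <= kappa * (e * yx r)) by (assert (K := Rle_abs (- (kappa * (e * yx r))));
      rewrite Rabs_Ropp in K; unfold rho; lra).
    assert (Hs := sqrt_lt_R0 _ Hh).
    (* both characteristic gradients are at least [- s], so compression is limited
       by the part of [M + s] not used by the gradient of [Y] *)
    assert (Hux : - (2 / g * (1 - rho) * / sqrt (h t (e * r))) <= kappa * ux t (e * r)).
    { assert (H1 := HZ 1 (e * r) ltac:(left; auto)). assert (H2 := HZ (- 1) (e * r) ltac:(right; auto)).
      assert (E1 : sqrt (h t (e * r)) * ux t (e * r) = (Z 1 t (e * r) + Z (- 1) t (e * r)) / 2)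
        by (unfold Z, Zc, riemx; field).
      assert (E2 : rho * (M + s) = Rabs (Z 1 t (e * r) - Z (- 1) t (e * r))).
      { unfold rho, yx, kappa.
        replace (4 / (g * (M + s)) * (e * (g / 4 * (Z 1 t (e * r) - Z (- 1) t (e * r)))))
          with (e * ((Z 1 t (e * r) - Z (- 1) t (e * r)) * / (M + s))) by (field; lra).
        rewrite Rabs_mult, (is_sign_abs e He), Rmult_1_l, Rabs_mult, (Rabs_right (/ (M + s)))
          by (left; apply Rinv_0_lt_compat; lra).
        field; lra. }
      assert (E3 : - ((M + s) / 2 * (1 - rho)) <= sqrt (h t (e * r)) * ux t (e * r)).
      { rewrite E1. unfold Rabs in E2. destruct Rcase_abs in E2; lra. }
      apply (Rmult_le_reg_l (sqrt (h t (e * r)))); auto.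
      replace (sqrt (h t (e * r)) * - (2 / g * (1 - rho) * / sqrt (h t (e * r))))
        with (kappa * - ((M + s) / 2 * (1 - rho))) by (unfold kappa; field; lra).
      replace (sqrt (h t (e * r)) * (kappa * ux t (e * r)))
        with (kappa * (sqrt (h t (e * r)) * ux t (e * r))) by ring.
      apply Rmult_le_compat_l; lra. }
    set (W := Rmax 0 (- e * u t (e * r))).
    assert (HW : 0 <= W) by apply Rmax_l.
    assert (EU : U r = W ^ 2) by reflexivity.
    assert (EUx : Ux r = - ux t (e * r) * (2 * W)).
    { unfold Ux, sqpos'. fold W.
      replace (e * (- e * ux t (e * r))) with (- (e * e) * ux t (e * r)) by ring. rewrite Hee; ring. }
    assert (HWu : W ^ 2 <= u t (e * r) ^ 2).
    { unfold W, Rmax. destruct (Rle_dec 0 (- e * u t (e * r))).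
      - replace ((- e * u t (e * r)) ^ 2) with ((e * e) * u t (e * r) ^ 2) by ring. rewrite Hee; lra.
      - assert (K := pow2_ge_0 (u t (e * r))). lra. }
    rewrite EU, EUx, <- Rmult_assoc, Hee, Rmult_1_l.
    set (q := qint p (Y t (e * r))) in *. set (y := Y t (e * r)) in *.
    set (B := theta p * (1 - y) * / sqrt (h t (e * r))).
    assert (HB : B ^ 2 <= q).
    { assert (K := theta_qint p y Hp ltac:(lra)). fold q in K.
      unfold y at 2, Y, p at 2 in K. rewrite yvar_neg_power in K by lra.
      assert (Hss := sqrt_sqrt (h t (e * r)) ltac:(lra)).
      assert (E : / h t (e * r) = / sqrt (h t (e * r)) * / sqrt (h t (e * r)))
        by (rewrite <- Rinv_mult, Hss; auto).
      rewrite E in K.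
      assert (Hi := Rinv_0_lt_compat _ Hs). set (i := / sqrt (h t (e * r))) in *.
      assert (theta p * (theta p * (1 - y) ^ 2 * (i * i)) <= 1 * (theta p * (1 - y) ^ 2 * (i * i))).
      { apply Rmult_le_compat_r; [ | lra ]. repeat apply Rmult_le_pos; lra. }
      unfold B. fold i. apply Rle_trans with (1 * (theta p * (1 - y) ^ 2 * (i * i))); [ | lra ].
      replace ((theta p * (1 - y) * i) ^ 2) with (theta p * (theta p * (1 - y) ^ 2 * (i * i))) by ring.
      auto. }
    assert (Hrho0 : 0 <= rho) by apply Rabs_pos.
    (* The share 1 - rho of the density pays for compression, by AM-GM and B^2 <= q; the share rho
       pays for the slope of Y. *)
    set (e1 := / 2 * W ^ 2 + 2 / g ^ 2 * q).
    assert (K1 : 0 <= (1 - rho) * (e1 - 2 / g * W * B)).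
    { apply Rmult_le_pos; [ lra | ].
      assert (0 <= / 2 * (W - 2 / g * B) ^ 2) by (apply Rmult_le_pos; [ lra | apply pow2_ge_0 ]).
      assert (2 / g ^ 2 * B ^ 2 <= 2 / g ^ 2 * q) by (apply Rmult_le_compat_l; lra).
      replace (/ 2 * (W - 2 / g * B) ^ 2) with (/ 2 * W ^ 2 - 2 / g * W * B + 2 / g ^ 2 * B ^ 2)
        in H by (field; lra).
      unfold e1; lra. }
    assert (K2 : W * (theta p * (1 - y)) * - (2 / g * (1 - rho) * / sqrt (h t (e * r)))
       <= W * (theta p * (1 - y)) * (kappa * ux t (e * r))).
    { apply Rmult_le_compat_l; auto. repeat apply Rmult_le_pos; lra. }
    assert (K3 : (/ 2 * W ^ 2 * theta p + 2 / g ^ 2 * q) * - rho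
       <= (/ 2 * W ^ 2 * theta p + 2 / g ^ 2 * q) * (kappa * (e * yx r))).
    { apply Rmult_le_compat_l; auto.
      apply Rplus_le_le_0_compat; repeat apply Rmult_le_pos; lra. }
    assert (K4 : rho * (/ 2 * W ^ 2 * theta p) <= rho * (/ 2 * W ^ 2 * 1)).
    { apply Rmult_le_compat_l; auto. apply Rmult_le_compat_l; [ | lra ].
      lra. }
    unfold B, e1 in K1. unfold k. lra.
Qed.
End Static.

(** * Decline of the weighted minimum *)

(** Here z stands for - Z_e and d for the weight plus the error. Replacing zb by - z - d turns the
    quadratic part into - z^2/2 + (g - 1)/4 z d, which decreases on z >= mu - d because (g + 3)/4 d
    <= mu; its value at mu - d gives the bound. *)
Lemma riccati_bound (g mu w0 w d z zb : R) : 1 <= g -> 0 < mu -> 0 <= d ->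
  (g + 3) / 4 * d <= mu -> w0 <= w -> mu - d <= z -> - z - d <= zb ->
  w0 - (g + 1) / 4 * z ^ 2 - (g - 1) / 4 * (z * zb) <= w - mu ^ 2 / 2 + (g + 3) / 4 * mu * d.
Proof.
  intros Hg Hmu Hd Hgd Hw Hz Hzb.
  assert (Hdmu : d <= mu) by nra.
  assert (K1 : z * (- z - d) <= z * zb) by (apply Rmult_le_compat_l; lra).
  set (r := z - (mu - d)).
  replace z with (r + (mu - d)) in * by (unfold r; ring). nra.
Qed.

(** The factor sqrt h could destroy a uniform rate when h is small. The reserve 1/100 (1/h - 1)
    prevents this: sqrt h (1/h - 1) = (1 - h)/sqrt h is at least 1/2 for h <= 1/2. *)
Lemma decline_sqrt (h sigma B : R) : 0 < h -> 0 < sigma ->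
  (1 <= h /\ B <= - (sigma / 2)) \/ (h <= 1 /\ B <= - (sigma / 2) - / 100 * (/ h - 1)) ->
  sqrt h * B <= - Rmin (sigma / 4) (/ 200).
Proof.
  intros Hh Hs HB.
  assert (M1 := Rmin_l (sigma / 4) (/ 200)). assert (M2 := Rmin_r (sigma / 4) (/ 200)).
  assert (Hsq := sqrt_lt_R0 _ Hh). assert (Hss := sqrt_sqrt h ltac:(lra)).
  set (q := sqrt h) in *.
  destruct HB as [[Hh1 HB] | [Hh1 HB]].
  - nra.
  - assert (Hi : 1 <= / h) by (rewrite <- Rinv_1; apply Rinv_le_contravar; lra).
    assert (Hq1 : q <= 1) by nra.
    destruct (Rle_dec (/ 2) h) as [Hh2 | Hh2].
    + nra.
    + assert (E : q * (/ h - 1) = (1 - h) / q).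
      { rewrite <- Hss. field; lra. }
      assert (/ 2 <= (1 - h) / q).
      { apply (Rmult_le_reg_r q); auto. unfold Rdiv; rewrite Rmult_assoc, Rinv_l, Rmult_1_r by lra. lra. }
      assert (q * B <= q * (- (sigma / 2) - / 100 * (/ h - 1))) by (apply Rmult_le_compat_l; lra).
      assert (0 <= q * (sigma / 2)) by (apply Rmult_le_pos; lra). lra.
Qed.

(** The right-hand side is the derivative of E_e in the direction (1, e c); the left-hand side is
    its lower bound in the variables y and g u / 2. *)
Lemma een_flux_ge (g h u e d : R) : 1 <= g -> 0 < h ->
  / 2 * u ^ 2 + 2 / g ^ 2 * qint (2 / g) (yvar g h) <= d ->
  sqrt h * (2 / g ^ 2 * (yvar g h * (g * u / 2) ^ 2 + yvar g h * qint (2 / g) (yvar g h)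
     - e * (g * u / 2) * (yvar g h ^ 2 - 1) * Rpower (yvar g h) (- (2 / g / 2))))
  <= cf g h * d - e * u * press g h.
Proof.
  intros Hg Hh Hd. rewrite cf_sqrt, yvar_neg_half_power by lra.
  assert (Hs := sqrt_lt_R0 _ Hh). assert (Hy := yvar_pos g h).
  unfold press. rewrite <- yvar_sq.
  set (y := yvar g h) in *. set (q := qint (2 / g) y) in *. set (r := sqrt h) in *.
  assert (K : r * y * (/ 2 * u ^ 2 + 2 / g ^ 2 * q) <= r * y * d).
  { apply Rmult_le_compat_l; auto. apply Rmult_le_pos; lra. }
  replace (r * (2 / g ^ 2 * (y * (g * u / 2) ^ 2 + y * q - e * (g * u / 2) * (y ^ 2 - 1) * / r)))
    with (r * y * (/ 2 * u ^ 2 + 2 / g ^ 2 * q) - e * u * ((y ^ 2 - 1) / g)) by (field; lra).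
  lra.
Qed.

(** Completing the square in [nu]: the minimum is attained at nu = (y^2 - 1) y^(-p/2) / (2 y), and
    [jfun] is its value. *)
Lemma jfun_le_flux (p y nu : R) : 0 < y ->
  jfun p y <= y * nu ^ 2 + y * qint p y - nu * (y ^ 2 - 1) * Rpower y (- (p / 2)).
Proof.
  intros Hy. unfold jfun.
  assert (E : Rpower y (- p) = Rpower y (- (p / 2)) ^ 2).
  { simpl. rewrite Rmult_1_r, <- Rpower_plus. f_equal; field. }
  rewrite E. set (r := Rpower y (- (p / 2))). set (q := qint p y).
  assert (K : 0 <= y * (nu - (y ^ 2 - 1) * r / (2 * y)) ^ 2)
    by (apply Rmult_le_pos; [ lra | apply pow2_ge_0 ]).
  replace (y * (nu - (y ^ 2 - 1) * r / (2 * y)) ^ 2)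
    with (y * nu ^ 2 - nu * (y ^ 2 - 1) * r + (y ^ 2 - 1) ^ 2 * r ^ 2 / (4 * y)) in K by (field; lra).
  lra.
Qed.

(** The factor a times the absolute slope of y^(-p) at 1 + a, that is, the linearised change of 1/h
    between y = 1 and y = 1 + a. *)
Definition slack (p a : R) : R := p * a * Rpower (1 + a) (- p) / (1 + a).

(** For y < 1 and nu > 0 the flux term is favourable, so the case nu = 0 suffices and the velocity
    hypothesis is required only for nu <= 0. *)
Lemma weight_bound (p a x y nu : R) : 0 < p <= 2 -> 0 < a -> 0 <= x <= 2 -> 0 < y ->
  (forall e, is_sign e -> e * Qint p y <= Ffun p (1 + a) * x) ->
  (forall e, is_sign e -> e * Qint p y <= Ffun p (1 + a) * (2 - x)) ->
  (y < 1 -> nu <= 0 -> theta p * nu ^ 2 * (1 - y) - Qint p y <= Ffun p (1 + a) * x) ->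
  let W := Rpower (1 + a) (- p) + 27 / 200 * slack p a * x ^ 2 - Rpower y (- p) in
  let B := y * nu ^ 2 + y * qint p y - nu * (y ^ 2 - 1) * Rpower y (- (p / 2)) in
  (1 <= y /\ (/ 2 + 3 / 4 * p) * Ffun p (1 + a) * W <= 2 * (27 / 200) * x * slack p a * B) \/
  (y < 1 /\ (/ 2 + 3 / 4 * p) * Ffun p (1 + a) * (W + / 100 * (Rpower y (- p) - 1))
     <= 2 * (27 / 200) * x * slack p a * B).
Proof.
  intros Hp Ha Hx Hy H1 H2 H3 W B.
  assert (Hsl : 0 < slack p a).
  { unfold slack. assert (K := Rpower_pos (1 + a) (- p)).
    apply Rdiv_lt_0_compat; [ | lra ]. apply Rmult_lt_0_compat; [ | lra ].
    apply Rmult_lt_0_compat; lra. }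
  assert (Hc : 0 <= 2 * (27 / 200) * x * slack p a)
    by (apply Rmult_le_pos; [ apply Rmult_le_pos | ]; lra).
  assert (S1 : is_sign 1) by (left; auto). assert (S2 : is_sign (- 1)) by (right; auto).
  assert (A1 := H1 1 S1). assert (A2 := H1 (- 1) S2). assert (A3 := H2 1 S1). assert (A4 := H2 (- 1) S2).
  destruct (Rle_dec 1 y) as [Hy1 | Hy1]; [ left | right ]; (split; [ lra | ]).
  - eapply Rle_trans; [ apply (weight_ineq_ge1 p a x y); auto; lra | ].
    apply Rmult_le_compat_l; auto. now apply jfun_le_flux.
  - apply Rnot_le_lt in Hy1. destruct (Rle_dec nu 0) as [Hnu | Hnu].
    + eapply Rle_trans; [ apply (weight_ineq_lt1 p a x y (- nu)); auto; lra | ].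
      apply Rmult_le_compat_l; auto. unfold B. right; ring.
    + eapply Rle_trans; [ apply (weight_ineq_lt1 p a x y 0); auto; lra | ].
      apply Rmult_le_compat_l; auto. unfold B.
      assert (0 <= y * nu ^ 2) by (apply Rmult_le_pos; [ lra | apply pow2_ge_0 ]).
      assert (0 <= nu * (1 - y ^ 2) * Rpower y (- (p / 2))).
      { apply Rmult_le_pos; [ apply Rmult_le_pos; [ lra | nra ] | left; apply Rpower_pos ]. }
      lra.
Qed.

(* The constant [N] is chosen so that [2 N E] times the energy flux matches the left-hand side
   of [weight_bound], and so that [(g + 3) / 4 * mu * N E ^ 2] is its [x ^ 2] term. *)
Lemma decline_rate (g a M s mu w w0 sigma eta h u d E E2 z zb : R) :
  let p := 2 / g in
  let E' := 4 / (g * (M + s)) * (2 / g ^ 2) * (2 * Ffun p (1 + a)) in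
  let N := 32 * (27 / 200) * slack p a / ((M + s) * (g + 3) * E' ^ 2) in
  let k := 4 / (g * (M + s)) * (2 / g ^ 2) in
  let y := yvar g h in
  1 <= g -> 0 < a -> 0 < mu <= s -> s <= M -> 0 < sigma -> 0 <= eta ->
  (g + 3) / 4 * (N * E ^ 2 + eta) <= mu -> (g + 3) / 4 * mu * eta <= sigma / 2 ->
  w - mu ^ 2 / 2 <= Rpower (1 + a) (- p) - sigma -> w0 <= w ->
  0 < h -> / 2 * u ^ 2 + 2 / g ^ 2 * qint p y <= d -> 0 <= E -> 0 <= E2 -> E + E2 <= E' ->
  forall e, is_sign e ->
  (forall e', is_sign e' -> k * (e' * Qint p y) <= E) ->
  (forall e', is_sign e' -> k * (e' * Qint p y) <= E2) ->
  (e * u <= 0 -> y < 1 -> k * (theta p * (g * u / 2) ^ 2 * (1 - y) - Qint p y) <= E) ->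
  mu - (N * E ^ 2 + eta) <= z -> - z - (N * E ^ 2 + eta) <= zb ->
  sqrt h * (w0 - / h - (g + 1) / 4 * z ^ 2 - (g - 1) / 4 * (z * zb))
  - 2 * N * E * (cf g h * d - e * u * press g h) <= - Rmin (sigma / 4) (/ 200).
Proof.
  intros p E' N k y Hg Ha Hmu HsM Hsig Heta Hd Hmueta Hw Hw0 Hh Hdens HE HE2 Hsum e He HQ HQ2 HVel Hz Hzb.
  assert (Hp : 0 < p <= 2) by (apply exponent_range; auto).
  assert (HF : 0 < Ffun p (1 + a)) by (apply Ffun_pos; lra). set (F := Ffun p (1 + a)) in *.
  assert (Hg2 : 0 < 2 / g ^ 2) by now apply g2_pos.
  assert (Hk : 0 < k).
  { apply Rmult_lt_0_compat; auto. apply Rdiv_lt_0_compat; [ lra | apply Rmult_lt_0_compat; lra ]. }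
  assert (HE' : E' = k * (2 * F)) by reflexivity.
  assert (HE'0 : 0 < E') by (rewrite HE'; apply Rmult_lt_0_compat; lra).
  assert (HD : 0 < slack p a).
  { unfold slack. assert (K := Rpower_pos (1 + a) (- p)).
    apply Rdiv_lt_0_compat; [ | lra ]. apply Rmult_lt_0_compat; [ | lra ].
    apply Rmult_lt_0_compat; lra. }
  set (D := slack p a) in *.
  (* In these units the energies behind and ahead have sum at most 2, by the definition of E'. *)
  set (x := E / (k * F)). assert (HkF : 0 < k * F) by now apply Rmult_lt_0_compat.
  assert (HEx : E = k * (F * x)) by (unfold x; field; lra).
  assert (Hx : 0 <= x <= 2).
  { split; [ apply Rdiv_le_0_compat; lra | ].
    apply (Rmult_le_reg_l (k * F)); auto. replace (k * F * x) with E by (rewrite HEx; ring). lra. }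
  assert (Hy : 0 < y) by apply yvar_pos.
  assert (HN : 0 < N).
  { apply Rdiv_lt_0_compat; [ lra | ]. apply Rmult_lt_0_compat; [ apply Rmult_lt_0_compat; lra | ].
    apply pow_lt; auto. }
  assert (Hee := is_sign_sq e He).
  assert (Hu2 : (e * (g * u / 2)) ^ 2 = (g * u / 2) ^ 2).
  { replace ((e * (g * u / 2)) ^ 2) with ((e * e) * (g * u / 2) ^ 2) by ring. rewrite Hee; ring. }
  assert (Hj := een_flux_ge g h u e d Hg Hh Hdens). fold p y in Hj.
  set (B := y * (e * (g * u / 2)) ^ 2 + y * qint p y
    - e * (g * u / 2) * (y ^ 2 - 1) * Rpower y (- (p / 2))).
  assert (EB : y * (g * u / 2) ^ 2 + y * qint p y
    - e * (g * u / 2) * (y ^ 2 - 1) * Rpower y (- (p / 2)) = B) by (unfold B; rewrite Hu2; ring).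
  rewrite EB in Hj.
  set (W := Rpower (1 + a) (- p) + 27 / 200 * D * x ^ 2 - / h).
  assert (Hyh : Rpower y (- p) = / h) by (apply yvar_neg_power; lra).
  set (V := 2 * (27 / 200) * x * D * B * / ((/ 2 + 3 / 4 * p) * F)).
  assert (HHF : 0 < (/ 2 + 3 / 4 * p) * F) by (apply Rmult_lt_0_compat; lra).
  assert (HV : (1 <= h /\ W <= V) \/ (h <= 1 /\ W + / 100 * (/ h - 1) <= V)).
  { destruct (weight_bound p a x y (e * (g * u / 2))) as [[Hy1 HB] | [Hy1 HB]]; auto; fold F D.
    - intros e' He'. apply (Rmult_le_reg_l k); auto. rewrite <- HEx. auto.
    - intros e' He'. apply (Rmult_le_reg_l k); auto.
      apply Rle_trans with E2; [ auto | ].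
      replace (k * (F * (2 - x))) with (E' - E) by (rewrite HEx, HE'; ring). lra.
    - intros Hy1 Hnu. apply (Rmult_le_reg_l k); auto. rewrite <- HEx, Hu2. apply HVel; auto.
      assert (0 < g) by lra. apply Rnot_lt_le; intros Hc. assert (0 < g / 2 * (e * u)) by nra. lra.
    - left. fold F D B in HB. rewrite Hyh in HB. fold W in HB. split.
      + assert (K := Rpower_neg_le p 1 y ltac:(lra) ltac:(lra)). rewrite Hyh, Rpower_one in K.
        apply (Rmult_le_reg_r (/ h)); [ now apply Rinv_0_lt_compat | ]. rewrite Rinv_r; lra.
      + apply (Rmult_le_reg_l _ _ _ HHF). eapply Rle_trans; [ exact HB | ].
        right; unfold V; field; lra.
    - right. fold F D B in HB. rewrite Hyh in HB. fold W in HB. split.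
      + assert (K := Rpower_neg_ge1 p y ltac:(lra) ltac:(lra)). rewrite Hyh in K.
        apply (Rmult_le_reg_r (/ h)); [ now apply Rinv_0_lt_compat | ]. rewrite Rinv_r; lra.
      + apply (Rmult_le_reg_l _ _ _ HHF). eapply Rle_trans; [ exact HB | ].
        right; unfold V; field; lra. }
  assert (HNE : 0 <= N * E ^ 2) by (apply Rmult_le_pos; [ lra | apply pow2_ge_0 ]).
  assert (HR := riccati_bound g mu w0 w (N * E ^ 2 + eta) z zb Hg ltac:(lra) ltac:(lra) Hd Hw0 Hz Hzb).
  assert (HNx : (g + 3) / 4 * mu * (N * E ^ 2) <= 27 / 200 * D * x ^ 2).
  { replace ((g + 3) / 4 * mu * (N * E ^ 2)) with (27 / 200 * D * x ^ 2 * (2 * mu * / (M + s))).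
    - rewrite <- (Rmult_1_r (27 / 200 * D * x ^ 2)) at 2. apply Rmult_le_compat_l.
      + apply Rmult_le_pos; [ lra | apply pow2_ge_0 ].
      + apply (Rmult_le_reg_r (M + s)); [ lra | ]. rewrite Rmult_assoc, Rinv_l; lra.
    - unfold N. rewrite HE', HEx. field. lra. }
  assert (HNV : 2 * N * E * (sqrt h * (2 / g ^ 2 * B)) = sqrt h * V).
  { unfold V, N. rewrite HE', HEx. unfold k, p. field. lra. }
  assert (HJ : 2 * N * E * (sqrt h * (2 / g ^ 2 * B)) <= 2 * N * E * (cf g h * d - e * u * press g h)).
  { apply Rmult_le_compat_l; auto. apply Rmult_le_pos; lra. }
  rewrite HNV in HJ. assert (Hs := sqrt_lt_R0 _ Hh).
  assert (HS : sqrt h * (w0 - / h - (g + 1) / 4 * z ^ 2 - (g - 1) / 4 * (z * zb))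
    <= sqrt h * (W - sigma / 2)).
  { apply Rmult_le_compat_l; [ lra | ]. unfold W. lra. }
  apply Rle_trans with (sqrt h * (W - sigma / 2 - V)); [ lra | ].
  apply decline_sqrt; auto. lra.
Qed.

Lemma slack_pos (p a : R) : 0 < p -> 0 < a -> 0 < slack p a.
Proof.
  intros Hp Ha. unfold slack. assert (K := Rpower_pos (1 + a) (- p)).
  apply Rdiv_lt_0_compat; [ | lra ]. apply Rmult_lt_0_compat; [ | lra ].
  now apply Rmult_lt_0_compat.
Qed.

Lemma slack_le (p a : R) : 0 < p -> 0 < a -> slack p a <= 1 - Rpower (1 + a) (- p).
Proof.
  intros Hp Ha. assert (K := Rpower_neg_tangent p (1 + a) 1 ltac:(lra) ltac:(lra) ltac:(lra)).
  rewrite Rpower_one in K. unfold slack.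
  replace (Rpower (1 + a) (- p) * (1 - p * (1 - (1 + a)) / (1 + a)))
    with (Rpower (1 + a) (- p) + p * a * Rpower (1 + a) (- p) / (1 + a)) in K by (field; lra).
  lra.
Qed.

Section Decline.
Variables (g T : R) (h u v hx ux vx : R -> R -> R).
Hypothesis Hg : 1 <= g.
Hypothesis S : smooth_flow g T h u v hx ux vx.
Variables (T1 T2 L : R).
Hypothesis HT1 : 0 < T1 < T2.
Hypothesis HT2 : T2 < T.
Hypothesis HL : 1 < L.
Hypothesis Hrest : forall t x, 0 <= t <= T2 -> L - 1 <= Rabs x ->
  at_rest h u v t x /\ hx t x = 0 /\ ux t x = 0.
Let Z := Zc g h hx ux.

Variables (w M s mu sigma a : R).
Let p := 2 / g.
Let E' := 4 / (g * (M + s)) * (2 / g ^ 2) * (2 * Ffun p (1 + a)).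
Hypothesis Hw : forall x, vx 0 x + / h 0 x <= w.
Hypothesis Hw1 : 1 <= w.
Hypothesis Hmu : 0 < mu <= s.
Hypothesis HsM : s <= M.
Hypothesis Ha : 0 < a.
Hypothesis Hsigma : 0 < sigma.
Hypothesis Hgap : w - mu ^ 2 / 2 <= Rpower (1 + a) (- p) - sigma.
Hypothesis HZ : forall e t x, is_sign e -> 0 <= t <= T1 -> - s < Z e t x <= M.
Hypothesis Henergy : RInt (dens g h u v 0) (- L) L <= E'.
Hypothesis Hini : exists e x, is_sign e /\ - L <= x <= L /\ Z e 0 x < - mu.

(** The function Z_e - N E_e^2 + (r/2) t is minimized, where r is the rate from [decline_rate].
    Before the final time its directional derivative is at most - r/2, which contradicts minimality;
    so the minimum is reached at T1, where - s < Z_e limits how far it can have fallen. *)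
Lemma decline_time : T1 * Rmin (sigma / 4) (/ 200) < 4 * s.
Proof.
  set (r := Rmin (sigma / 4) (/ 200)).
  assert (Hr : 0 < r) by (apply Rmin_glb_lt; lra).
  apply Rnot_le_lt; intros Hlong.
  assert (Hp : 0 < p <= 2) by (apply exponent_range; auto).
  assert (HF : 0 < Ffun p (1 + a)) by (apply Ffun_pos; lra).
  assert (Hg2 : 0 < 2 / g ^ 2) by now apply g2_pos.
  assert (Hk : 0 < 4 / (g * (M + s)))
    by (apply Rdiv_lt_0_compat; [ lra | apply Rmult_lt_0_compat; lra ]).
  assert (HE' : 0 < E').
  { unfold E'. apply Rmult_lt_0_compat; [ now apply Rmult_lt_0_compat | lra ]. }
  set (N := 32 * (27 / 200) * slack p a / ((M + s) * (g + 3) * E' ^ 2)).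
  assert (HD : 0 < slack p a) by (apply slack_pos; lra).
  assert (HE2 : 0 < E' ^ 2) by (apply pow_lt; auto).
  assert (HN : 0 < N).
  { apply Rdiv_lt_0_compat; [ lra | ]. apply Rmult_lt_0_compat; auto.
    apply Rmult_lt_0_compat; lra. }
  (* Follows from w >= 1: [Hgap] then gives 1 - (1 + a)^(-p) <= mu^2/2. *)
  assert (HD2 : slack p a <= mu ^ 2 / 2) by (assert (K := slack_le p a ltac:(lra) Ha); lra).
  (* The weight never exceeds 27/100 mu, so that mu - N E^2 - eta stays positive and the level - mu
     remains visible behind the weight. *)
  assert (HNmax : forall E, 0 <= E <= E' -> (g + 3) / 4 * (N * E ^ 2) <= 27 / 100 * mu).
  { intros E HE. apply Rle_trans with ((g + 3) / 4 * (N * E' ^ 2)).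
    - apply Rmult_le_compat_l; [ lra | ]. apply Rmult_le_compat_l; [ lra | ].
      apply pow_incr; lra.
    - replace ((g + 3) / 4 * (N * E' ^ 2)) with (108 / 100 * slack p a / (M + s))
        by (unfold N; field; lra).
      apply (Rmult_le_reg_r (M + s)); [ lra | ]. unfold Rdiv at 1.
      rewrite Rmult_assoc, Rinv_l, Rmult_1_r by lra. nra. }
  destruct Hini as [e0 [x0 [He0 [Hx0 HZ0]]]].
  assert (Hr1 : forall t x, 0 <= t <= T1 -> L - 1 <= Rabs x -> hx t x = 0 /\ ux t x = 0)
    by (intros t x Ht Hx; destruct (Hrest t x ltac:(lra) Hx) as [_ K]; exact K).
  destruct (Zc_start g T h u v hx ux vx S T1 L ltac:(lra) (- mu - Z e0 0 x0) ltac:(lra))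
    as [d [Hd Hst]].
  (* A positive starting time, as the transport equation requires; at most half of the available
     time is given up. *)
  set (t0 := Rmin (T1 / 2) (d / 2)).
  assert (Ht0 : 0 < t0 <= T1 / 2 /\ t0 < d).
  { assert (K1 := Rmin_l (T1 / 2) (d / 2)). assert (K2 := Rmin_r (T1 / 2) (d / 2)).
    assert (0 < Rmin (T1 / 2) (d / 2)) by (apply Rmin_glb_lt; lra). unfold t0; lra. }
  assert (HZt0 : Z e0 t0 x0 <= - mu).
  { assert (K := Hst e0 t0 x0 He0 ltac:(lra) ltac:(lra) Hx0). apply Rabs_le_between in K.
    fold Z in K. lra. }
  assert (Heta : exists eta, 0 < eta /\ (g + 3) / 4 * eta <= mu / 10 /\
    (g + 3) / 4 * mu * eta <= sigma / 2 /\ eta <= r / 4).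
  { assert (Hgm : 0 < (g + 3) / 4 * mu) by (apply Rmult_lt_0_compat; lra).
    exists (Rmin (Rmin (mu / 10 / ((g + 3) / 4)) (sigma / 2 / ((g + 3) / 4 * mu))) (r / 4)).
    set (k1 := mu / 10 / ((g + 3) / 4)). set (k2 := sigma / 2 / ((g + 3) / 4 * mu)).
    assert (0 < k1) by (apply Rdiv_lt_0_compat; lra). assert (0 < k2) by (apply Rdiv_lt_0_compat; lra).
    assert (M1 := Rmin_l (Rmin k1 k2) (r / 4)). assert (M2 := Rmin_r (Rmin k1 k2) (r / 4)).
    assert (M3 := Rmin_l k1 k2). assert (M4 := Rmin_r k1 k2).
    split; [ repeat apply Rmin_glb_lt; lra | ]. split; [ | split; auto ].
    - apply Rle_trans with ((g + 3) / 4 * k1); [ apply Rmult_le_compat_l; lra | ].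
      right; unfold k1; field; lra.
    - apply Rle_trans with ((g + 3) / 4 * mu * k2); [ apply Rmult_le_compat_l; lra | ].
      right; unfold k2; field; lra. }
  destruct Heta as [eta [Heta [He1 [He2 He3]]]].
  set (E := fun e t x => een g h u v L e t x).
  assert (Hu0 : forall e t, is_sign e -> 0 <= t <= T2 -> h t (e * L) = 1 /\ u t (e * L) = 0).
  { intros e t He Ht. destruct (Hrest t (e * L) Ht) as [[K1 [K2 _]] _]; auto.
    rewrite Rabs_mult, (is_sign_abs e He), (Rabs_right L) by lra. lra. }
  assert (Hsl : forall e t, is_sign e -> 0 <= t <= T2 -> u t (- e * L) = 0).
  { intros e t He Ht. exact (proj2 (Hu0 (- e) t (is_sign_opp e He) Ht)). }
  assert (Hest : forall e t x, is_sign e -> 0 <= t <= T1 -> - L <= x <= L -> 0 <= E e t x).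
  { intros e t x He Ht Hx. apply (een_ge_0 g T h u v hx ux vx Hg S L M s t); auto; try lra.
    - intros e' x' He'. assert (K := HZ e' t x' He' Ht). fold Z; lra.
    - intros e' He'. apply Hu0; auto; lra. }
  assert (Hsum : forall e t x, is_sign e -> 0 <= t <= T1 -> E e t x + E (- e) t x <= E').
  { intros e t x He Ht. unfold E. rewrite (een_sum g T h u v hx ux vx S) by (auto; lra).
    rewrite (energy_constant g T h u v hx ux vx Hg S L T1 t); auto; try lra.
    intros t' Ht'. split.
    - replace (- L) with (- 1 * L) by ring. exact (proj2 (Hu0 (- 1) t' ltac:(right; auto) ltac:(lra))).
    - replace L with (1 * L) by ring. exact (proj2 (Hu0 1 t' ltac:(left; auto) ltac:(lra))). }
  destruct (near_minimizer t0 T1 L Z (fun e t x => e * cf g (h t x))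
    (Zrhs g h hx ux vx) (fun e t x => N * E e t x ^ 2 - r / 2 * t)
    (fun e t x => N * (2 * E e t x * (- e * (u t x * press g (h t x)))) - r / 2)
    (fun e t x => N * (2 * E e t x * (e * dens g h u v t x)) - 0) eta)
    as [e [t [x [He [Ht [Hx [Hmin Hcrit]]]]]]]; try lra.
  { apply (Z_transported g T h u v hx ux vx S); lra. }
  { intros e t x He Ht Hx.
    assert (Ke : is_derive (fun s => E e s x) t (- e * (u t x * press g (h t x))))
      by (apply (een_t g T h u v hx ux vx Hg S); [ lra | apply Hsl; auto; lra ]).
    assert (Kx : is_derive (fun y => E e t y) x (e * dens g h u v t x))
      by (apply (een_x g T h u v hx ux vx S); lra).
    split; [ | split ].
    - apply continuity_2d_pt_minus.
      + apply continuity_2d_pt_mult; [ apply continuity_2d_pt_const | ]. apply continuity_2d_pow2.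
        apply (een_continuity g T h u v hx ux vx Hg S L e t x T2); try lra.
        intros t' Ht'; apply Hsl; auto; lra.
      + apply continuity_2d_pt_mult; [ apply continuity_2d_pt_const | apply continuity_2d_pt_id1 ].
    - apply (D_minus (fun s => N * E e s x ^ 2) (fun s => r / 2 * s)).
      + apply D_scal. now apply (D_sq (fun s => E e s x)).
      + assert (K := D_scal (fun z => z) (r / 2) t 1 (D_id t)). rewrite Rmult_1_r in K. exact K.
    - apply (D_minus (fun y => N * E e t y ^ 2) (fun _ => r / 2 * t)); [ | apply D_const ].
      apply D_scal. now apply (D_sq (fun y => E e t y)). }
  assert (Ht' : 0 <= t <= T1) by lra.
  assert (HEx := Hest e t x He Ht' Hx).
  assert (HEx2 := Hest (- e) t x (is_sign_opp e He) Ht' Hx).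
  assert (HEs := Hsum e t x He Ht').
  assert (HNE := HNmax (E e t x) ltac:(lra)).
  assert (HNE0 : 0 <= N * E e t x ^ 2) by (apply Rmult_le_pos; [ lra | apply pow2_ge_0 ]).
  assert (HNE1 : N * E e t x ^ 2 <= 27 / 100 * mu) by nra.
  assert (Heta1 : eta <= mu / 10) by nra.
  assert (Hrt : 0 <= r / 2 * (t - t0)) by (apply Rmult_le_pos; lra).
  assert (HA : mu - (N * E e t x ^ 2 + eta) + r / 2 * (t - t0) <= - Z e t x).
  { assert (K := Hmin e0 t0 x0 He0 ltac:(lra) Hx0).
    assert (0 <= N * E e0 t0 x0 ^ 2) by (apply Rmult_le_pos; [ lra | apply pow2_ge_0 ]). lra. }
  assert (HB : Z e t x - (N * E e t x ^ 2 + eta) <= Z (- e) t x).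
  { assert (K := Hmin (- e) t x (is_sign_opp e He) Ht Hx).
    assert (0 <= N * E (- e) t x ^ 2) by (apply Rmult_le_pos; [ lra | apply pow2_ge_0 ]). lra. }
  assert (Hin : - L < x < L).
  { destruct (Rlt_dec (Rabs x) (L - 1)) as [K | K]; [ apply Rabs_def2 in K; lra | ].
    assert (K0 := Zc_rest g h hx ux T1 L Hr1 e t x Ht' ltac:(lra)). fold Z in K0. lra. }
  destruct (Hcrit Hin) as [Hc _].
  (* At t = T1 the accumulated slope is at least r T1/4, hence at least s, which the strict bound Z
     > - s excludes. *)
  destruct (Req_dec t T1) as [E1 | Hne].
  - assert (K := HZ e t x He Ht').
    assert (r / 2 * (T1 / 2) <= r / 2 * (t - t0)) by (apply Rmult_le_compat_l; lra). lra.
  - specialize (Hc ltac:(lra)).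
    assert (HZs : forall e x, is_sign e -> - s <= Z e t x <= M)
      by (intros e' x' He'; assert (K := HZ e' t x' He' Ht'); lra).
    assert (Hbd : forall e, is_sign e -> h t (e * L) = 1 /\ u t (e * L) = 0)
      by (intros; apply Hu0; auto; lra).
    assert (HsM' : 0 < s <= M) by lra. assert (HtT : t < T) by lra.
    assert (K := decline_rate g a M s mu w (vx 0 x + / h 0 x) sigma eta (h t x) (u t x)
      (dens g h u v t x) (E e t x) (E (- e) t x) (- Z e t x) (Z (- e) t x) Hg Ha Hmu HsM Hsigma
      ltac:(lra)). cbv zeta in K.
    fold p in K. fold E' in K. fold N in K.
    specialize (K ltac:(lra) He2 Hgap (Hw x) (flow_pos S t x HtT)
      (dens_ge g T h u v hx ux vx Hg S t HtT x) HEx HEx2 HEs e He).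
    specialize (K (fun e' He' => een_ge_Qint g T h u v hx ux vx Hg S L M s t HsM' HtT HZs Hbd
      e e' x He He' Hx)).
    specialize (K (fun e' He' => een_ge_Qint g T h u v hx ux vx Hg S L M s t HsM' HtT HZs Hbd
      (- e) e' x (is_sign_opp e He) He' Hx)).
    specialize (K (fun Hu Hy => een_ge_velocity g T h u v hx ux vx Hg S L M s t HsM' HtT HZs Hbd
      e x He Hx Hu Hy)).
    specialize (K ltac:(lra) ltac:(lra)). fold r in K.
    unfold Zrhs in Hc. fold Z in Hc.
    replace (- Z e t x) with (- (Z e t x)) in K by ring.
    assert (Es : (- Z e t x) ^ 2 = Z e t x ^ 2) by ring. rewrite Es in K.
    replace (- Z e t x * Z (- e) t x) with (- (Z e t x * Z (- e) t x)) in K by ring.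
    assert (Hflux : N * (2 * E e t x * (- e * (u t x * press g (h t x)))) - r / 2 +
      e * cf g (h t x) * (N * (2 * E e t x * (e * dens g h u v t x)) - 0)
      = 2 * N * E e t x * (cf g (h t x) * dens g h u v t x - e * u t x * press g (h t x)) - r / 2).
    { replace (e * cf g (h t x) * (N * (2 * E e t x * (e * dens g h u v t x)) - 0))
        with ((e * e) * (2 * N * E e t x * (cf g (h t x) * dens g h u v t x))) by ring.
      rewrite (is_sign_sq e He). ring. }
    rewrite Hflux in Hc. lra.
Qed.
End Decline.

(** * The inverse of the threshold function *)

Lemma Fgamma_Ffun (g a : R) : 1 <= g -> 0 < a ->
  Fgamma g a = 16 / g ^ 3 * Ffun (2 / g) (1 + a).
Proof.
  intros Hg Ha. unfold Fgamma, Ffun. rewrite (Rplus_comm a 1).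
  replace (3 - 2 / g) with (1 + (1 + 1) + - (2 / g)) by ring.
  replace (2 - 2 / g) with (1 + 1 + - (2 / g)) by ring.
  rewrite !Rpower_plus, Rpower_1 by lra. field. lra.
Qed.

Lemma Ffun_incr (p y z : R) : 0 < p <= 2 -> 1 < y < z -> Ffun p y < Ffun p z.
Proof.
  intros Hp Hyz.
  destruct (MVT_gen (Ffun p) y z (fun y => Rpower y (- p) *
    ((y - 1) ^ 2 * (1 + / y) - (y - 1) ^ 3 / (3 * y ^ 2)
     - p / 3 * (y - 1) ^ 3 * (1 + / y) / y))) as [c [Hc E]];
    rewrite ?Rmin_left, ?Rmax_right in * by lra.
  - intros x Hx; apply is_derive_Ffun; lra.
  - intros x Hx; eapply is_derive_continuity_pt, is_derive_Ffun; lra.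
  - assert (HR := Rpower_pos c (- p)).
    assert (K : (c - 1) ^ 2 * (1 + / c) - (c - 1) ^ 3 / (3 * c ^ 2)
       - p / 3 * (c - 1) ^ 3 * (1 + / c) / c
       = (c - 1) ^ 2 * ((2 - p) / 3 * ((c - 1) * (c + 1) / c ^ 2) + (c ^ 2 + 4 * c + 3 - 2 * c) / (3 * c ^ 2)))
      by (field; lra).
    rewrite K in E.
    assert (0 < (c - 1) ^ 2) by (apply pow_lt; lra).
    assert (Hc2 : 0 < c ^ 2) by (apply pow_lt; lra).
    assert (0 <= (2 - p) / 3 * ((c - 1) * (c + 1) / c ^ 2)).
    { apply Rmult_le_pos; [ lra | ]. apply Rdiv_le_0_compat; auto. apply Rmult_le_pos; lra. }
    assert (0 < (c ^ 2 + 4 * c + 3 - 2 * c) / (3 * c ^ 2)) by (apply Rdiv_lt_0_compat; lra).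
    assert (0 < Rpower c (- p) * ((c - 1) ^ 2 * ((2 - p) / 3 * ((c - 1) * (c + 1) / c ^ 2) +
       (c ^ 2 + 4 * c + 3 - 2 * c) / (3 * c ^ 2))) * (z - y)).
    { apply Rmult_lt_0_compat; [ | lra ]. apply Rmult_lt_0_compat; auto.
      apply Rmult_lt_0_compat; lra. }
    lra.
Qed.

Lemma Fgamma_incr (g x y : R) : 1 <= g -> 0 < x < y -> Fgamma g x < Fgamma g y.
Proof.
  intros Hg Hxy. rewrite !Fgamma_Ffun by lra.
  apply Rmult_lt_compat_l; [ apply Rdiv_lt_0_compat; [ lra | apply pow_lt; lra ] | ].
  apply Ffun_incr; [ now apply exponent_range | lra ].
Qed.

(** Linear growth makes the supremum defining the inverse finite. It holds because 2/g <= 2 and a >=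
    1. *)
Lemma Fgamma_growth (g a : R) : 1 <= g -> 1 <= a -> 16 / g ^ 3 * (a / 12) <= Fgamma g a.
Proof.
  intros Hg Ha. rewrite Fgamma_Ffun by lra.
  apply Rmult_le_compat_l; [ left; apply Rdiv_lt_0_compat; [ lra | apply pow_lt; lra ] | ].
  assert (Hp := exponent_range g Hg). unfold Ffun.
  assert (K : / (1 + a) ^ 2 <= Rpower (1 + a) (- (2 / g))).
  { replace (/ (1 + a) ^ 2) with (Rpower (1 + a) (- (1 + 1)))
      by (rewrite Rpower_Ropp, Rpower_plus, Rpower_1 by lra; field; lra).
    apply Rle_Rpower; lra. }
  assert (Hi : 0 < / (1 + a)) by (apply Rinv_0_lt_compat; lra).
  replace (1 + a - 1) with a by ring.
  assert (Ha3 : 0 <= a ^ 3) by (apply pow_le; lra).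
  apply Rle_trans with (a ^ 3 * / (1 + a) ^ 2 * 1 / 3).
  - apply (Rmult_le_reg_r ((1 + a) ^ 2)); [ apply pow_lt; lra | ].
    replace (a ^ 3 * / (1 + a) ^ 2 * 1 / 3 * (1 + a) ^ 2) with (a ^ 3 / 3) by (field; lra). nra.
  - unfold Rdiv. apply Rmult_le_compat_r; [ lra | ].
    apply Rmult_le_compat; [ | lra | apply Rmult_le_compat_l; lra | lra ].
    apply Rmult_le_pos; [ lra | ]. left; apply Rinv_0_lt_compat, pow_lt; lra.
Qed.

(** These three facts, which also cover values y that are not attained, are all that is used of the
    inverse. *)
Lemma Fgamma_inv_cases (g y : R) : 1 <= g ->
  0 <= Fgamma_inv g y /\
  (forall a, 0 < a -> Fgamma g a <= y -> a <= Fgamma_inv g y) /\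
  (forall a, 0 < a < Fgamma_inv g y -> Fgamma g a <= y).
Proof.
  intros Hg. unfold Fgamma_inv.
  set (P := fun a => 0 < a /\ Fgamma g a <= y).
  assert (HL := Lub_Rbar_correct P). destruct HL as [Hub Hlub].
  set (l := Lub_Rbar P) in *.
  set (C := Rmax 1 (12 * y * g ^ 3 / 16)).
  assert (Hb : Rbar_le l (Finite C)).
  { apply Hlub. intros a [Ha Hy]. simpl. unfold C.
    destruct (Rle_dec a 1) as [H1 | H1]; [ eapply Rle_trans; [ exact H1 | apply Rmax_l ] | ].
    eapply Rle_trans; [ | apply Rmax_r ].
    assert (K := Fgamma_growth g a Hg ltac:(lra)).
    assert (Hg3 : 0 < g ^ 3) by (apply pow_lt; lra).
    assert (K2 : g ^ 3 * (16 / g ^ 3 * (a / 12)) <= g ^ 3 * y) by (apply Rmult_le_compat_l; lra).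
    replace (g ^ 3 * (16 / g ^ 3 * (a / 12))) with (16 * a / 12) in K2 by (field; lra). lra. }
  clearbody l. destruct l as [l | | ]; simpl real.
  - split; [ | split ].
    + apply Rnot_lt_le; intros Hl.
      assert (K : Rbar_le (Finite l) m_infty).
      { apply Hlub. intros a [Ha Hy]. assert (K := Hub a (conj Ha Hy)). simpl in K. lra. }
      exact K.
    + intros a Ha Hy. exact (Hub a (conj Ha Hy)).
    + intros a Ha. apply Rnot_lt_le; intros Hlt.
      assert (K : Rbar_le (Finite l) (Finite a)).
      { apply Hlub. intros b [Hb0 Hby]. simpl. apply Rnot_lt_le; intros Hab.
        assert (K := Fgamma_incr g a b Hg ltac:(lra)). lra. }
      simpl in K. lra.
  - destruct Hb.
  (* The set is empty: its supremum is minus infinity and [real] returns 0, so the inverse is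
     extended by 0. *)
  - split; [ lra | split ].
    + intros a Ha Hy. destruct (Hub a (conj Ha Hy)).
    + intros a Ha. lra.
Qed.

Lemma Fgamma_inv_lt (g y a : R) : 1 <= g -> 0 < a -> Fgamma_inv g y < a -> y < Fgamma g a.
Proof.
  intros Hg Ha Hlt. destruct (Fgamma_inv_cases g y Hg) as [_ [K _]].
  apply Rnot_le_lt; intros Hle. specialize (K a Ha Hle). lra.
Qed.

(** Strict monotonicity of [Fgamma] excludes flat pieces, hence jumps of the inverse. *)
Lemma Fgamma_inv_continuity (g y : R) : 1 <= g -> continuity_pt (Fgamma_inv g) y.
Proof.
  intros Hg. apply continuity_pt_locally. intros eps. assert (He := cond_pos eps).
  destruct (Fgamma_inv_cases g y Hg) as [H0 [H1 H2]]. set (al := Fgamma_inv g y) in *.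
  assert (Hup : y < Fgamma g (al + eps / 2)) by (apply Fgamma_inv_lt; auto; fold al; lra).
  assert (Hlow : exists z, z < y /\ forall y', z < y' -> al - eps < Fgamma_inv g y').
  { destruct (Rlt_dec (al - eps / 2) 0) as [Hs | Hs].
    - exists (y - 1). split; [ lra | ]. intros y' _.
      destruct (Fgamma_inv_cases g y' Hg) as [K _]. lra.
    - destruct (Rle_dec al 0) as [ | Hal ]; [ lra | ].
      exists (Fgamma g (al - eps / 2 + eps / 8)). split.
      + apply Rlt_le_trans with (Fgamma g (al - eps / 2 + eps / 4)).
        * apply Fgamma_incr; auto; lra.
        * apply H2; lra.
      + intros y' Hy'. destruct (Fgamma_inv_cases g y' Hg) as [_ [K _]].
        specialize (K (al - eps / 2 + eps / 8) ltac:(lra) ltac:(lra)). lra. }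
  destruct Hlow as [z [Hz Hlow]].
  assert (Hd : 0 < Rmin (y - z) (Fgamma g (al + eps / 2) - y)) by (apply Rmin_glb_lt; lra).
  exists (mkposreal _ Hd). intros y' Hy'. change (Rabs (y' - y) < Rmin (y - z) (Fgamma g (al + eps / 2) - y)) in Hy'.
  assert (M1 := Rmin_l (y - z) (Fgamma g (al + eps / 2) - y)).
  assert (M2 := Rmin_r (y - z) (Fgamma g (al + eps / 2) - y)).
  apply Rabs_def2 in Hy'. specialize (Hlow y' ltac:(lra)).
  apply Rabs_def1; [ | fold al; lra ].
  apply Rle_lt_trans with (al + eps / 2 - al); [ | lra ].
  apply Rplus_le_compat_r. apply Rnot_lt_le; intros Hlt.
  destruct (Fgamma_inv_cases g y' Hg) as [_ [_ K]].
  specialize (K (al + eps / 2) ltac:(lra)). lra.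
Qed.

(** * The time bound and its continuity *)

Definition near4 (G E w m d G' E' w' m' : R) : Prop :=
  Rabs (G' - G) < d /\ Rabs (E' - E) < d /\ Rabs (w' - w) < d /\ Rabs (m' - m) < d.

Definition cont4 (f : R -> R -> R -> R -> R) (G E w m : R) : Prop :=
  forall eps : posreal, exists d : posreal, forall G' E' w' m',
    near4 G E w m d G' E' w' m' -> Rabs (f G' E' w' m' - f G E w m) < eps.

Lemma cont4_comp2 (F : R -> R -> R) (f k : R -> R -> R -> R -> R) (G E w m : R) :
  continuity_2d_pt F (f G E w m) (k G E w m) -> cont4 f G E w m -> cont4 k G E w m ->
  cont4 (fun G E w m => F (f G E w m) (k G E w m)) G E w m.
Proof.
  intros HF Hf Hk eps. destruct (HF eps) as [d Hd].
  destruct (Hf d) as [d1 H1]. destruct (Hk d) as [d2 H2].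
  assert (Hm : 0 < Rmin d1 d2) by (apply Rmin_glb_lt; apply cond_pos).
  exists (mkposreal _ Hm); simpl; intros G' E' w' m' [K1 [K2 [K3 K4]]].
  assert (M1 := Rmin_l d1 d2). assert (M2 := Rmin_r d1 d2).
  apply Hd; [ apply H1 | apply H2 ]; repeat split; lra.
Qed.

Lemma cont4_comp (F : R -> R) (f : R -> R -> R -> R -> R) (G E w m : R) :
  continuity_pt F (f G E w m) -> cont4 f G E w m ->
  cont4 (fun G E w m => F (f G E w m)) G E w m.
Proof.
  intros HF Hf. apply (cont4_comp2 (fun x _ => F x) f f); auto.
  intros eps. destruct (proj1 (continuity_pt_locally F (f G E w m)) HF eps) as [d Hd].
  exists d; intros x y Hx _. now apply Hd.
Qed.

Lemma cont4_const (c G E w m : R) : cont4 (fun _ _ _ _ => c) G E w m.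
Proof.
  intros eps; exists eps; intros. rewrite Rminus_diag, Rabs_R0. apply cond_pos.
Qed.

(** The margin by which m^2/2 exceeds the threshold quantity under the second square root of the
    theorem. *)
Definition gap (g G E w m : R) : R :=
  m ^ 2 / 2 - w + Rpower (Fgamma_inv g (G * E) + 1) (- 2 / g).

(** [decline_time] is applied with sigma = gap/2, that is, with rate min (gap/8, 1/200). The
    resulting time 4 s / rate is the larger of 32 s / gap and 800 s, both covered by this formula,
    which is continuous in the data. *)
Definition time_bound (g G E w m : R) : R := 800 * sqrt (2 * w) * (1 + / gap g G E w m).

Lemma gap_pos (g G E w m : R) :
  m < - sqrt 2 * sqrt (w - Rpower (Fgamma_inv g (G * E) + 1) (- 2 / g)) -> 0 < gap g G E w m.
Proof.
  unfold gap. set (X := w - Rpower (Fgamma_inv g (G * E) + 1) (- 2 / g)). intros Hm.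
  enough (X < m ^ 2 / 2) by (unfold X in *; lra).
  assert (H2 := sqrt_pos 2). assert (HX := sqrt_pos X).
  assert (0 <= sqrt 2 * sqrt X) by (apply Rmult_le_pos; auto).
  destruct (Rle_dec 0 X) as [Hp | Hp].
  - assert (E2 := sqrt_sqrt 2 ltac:(lra)). assert (EX := sqrt_sqrt X Hp).
    nra.
  - nra.
Qed.

Lemma time_bound_continuous (g : R) : 1 <= g -> continuous_on_admissible g (time_bound g).
Proof.
  intros Hg G E w m [Hw [_ Hm]] eps Heps.
  assert (Hgap := gap_pos g G E w m Hm).
  assert (HG : cont4 (fun G _ _ _ => G) G E w m) by (intros e; exists e; intros ? ? ? ? [K _]; exact K).
  assert (HE : cont4 (fun _ E _ _ => E) G E w m) by (intros e; exists e; intros ? ? ? ? [_ [K _]]; exact K).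
  assert (HW : cont4 (fun _ _ w _ => w) G E w m) by (intros e; exists e; intros ? ? ? ? [_ [_ [K _]]]; exact K).
  assert (HM : cont4 (fun _ _ _ m => m) G E w m) by (intros e; exists e; intros ? ? ? ? [_ [_ [_ K]]]; exact K).
  assert (Hmult : forall f k, cont4 f G E w m -> cont4 k G E w m ->
    cont4 (fun G E w m => f G E w m * k G E w m) G E w m).
  { intros f k Hf Hk. apply (cont4_comp2 Rmult); auto.
    apply continuity_2d_pt_mult; [ apply continuity_2d_pt_id1 | apply continuity_2d_pt_id2 ]. }
  assert (Hplus : forall f k, cont4 f G E w m -> cont4 k G E w m ->
    cont4 (fun G E w m => f G E w m + k G E w m) G E w m).
  { intros f k Hf Hk. apply (cont4_comp2 Rplus); auto.
    apply continuity_2d_pt_plus; [ apply continuity_2d_pt_id1 | apply continuity_2d_pt_id2 ]. }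
  assert (HK : cont4 (time_bound g) G E w m).
  { unfold time_bound. apply Hmult; [ apply Hmult; [ apply cont4_const | ] | ].
    - apply (cont4_comp sqrt (fun _ _ w _ => 2 * w)).
      + apply continuity_pt_sqrt; lra.
      + apply Hmult; auto. apply cont4_const.
    - apply Hplus; [ apply cont4_const | ].
      apply (cont4_comp Rinv (gap g)).
      + apply (is_derive_continuity_pt Rinv _ (- 1 / (gap g G E w m) ^ 2)).
        apply (is_derive_inv (fun z => z)); [ apply D_id | lra ].
      + unfold gap. apply Hplus.
        * apply (cont4_comp2 Rminus).
          { apply continuity_2d_pt_minus; [ apply continuity_2d_pt_id1 | apply continuity_2d_pt_id2 ]. }
          { apply Hmult; [ | apply cont4_const ].
            apply (cont4_comp (fun z => z ^ 2) (fun _ _ _ m => m)); auto.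
            apply derivable_continuous_pt, derivable_pt_pow. }
          { auto. }
        * apply (cont4_comp (fun z => Rpower z (- 2 / g)) (fun G E _ _ => Fgamma_inv g (G * E) + 1)).
          { destruct (Fgamma_inv_cases g (G * E) Hg) as [K _].
            eapply is_derive_continuity_pt, is_derive_Rpower; lra. }
          { apply Hplus; [ | apply cont4_const ].
            apply (cont4_comp (Fgamma_inv g) (fun G E _ _ => G * E)).
            - now apply Fgamma_inv_continuity.
            - now apply Hmult. } }
  destruct (HK (mkposreal _ Heps)) as [d Hd]. exists d; split; [ apply cond_pos | ].
  intros G' E' w' m' _ K1 K2 K3 K4. apply Hd. repeat split; auto.
Qed.

(** * Passing from the data of the theorem to the estimates *)

Lemma is_RInt_zero (f : R -> R) (a b : R) : a <= b -> (forall x, a < x < b -> f x = 0) ->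
  is_RInt f a b 0.
Proof.
  intros Hab Hf. apply (is_RInt_ext (fun _ => 0)).
  - rewrite Rmin_left, Rmax_right by lra. intros x Hx. symmetry; now apply Hf.
  - assert (K := is_RInt_const (V := R_NormedModule) a b 0).
    change (is_RInt (fun _ : R => 0) a b ((b - a) * 0)) in K. rewrite Rmult_0_r in K.
    exact K.
Qed.

Lemma RInt_gen_compact (f : R -> R) (L : R) : 0 <= L -> ex_RInt f (- L) L ->
  (forall x, L <= Rabs x -> f x = 0) ->
  RInt_gen f (Rbar_locally m_infty) (Rbar_locally p_infty) = RInt f (- L) L.
Proof.
  intros HL Hex Hf. apply (is_RInt_gen_unique (V := R_CompleteNormedModule)).
  intros P HP.
  apply (Filter_prod _ _ _ (fun a => a < - L) (fun b => L < b)).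
  - exists (- L); auto.
  - exists L; auto.
  - intros a b Ha Hb. exists (RInt f (- L) L). split; [ | now apply locally_singleton ].
    simpl. replace (RInt f (- L) L) with (plus 0 (plus (RInt f (- L) L) 0))
      by (unfold plus; simpl; ring).
    apply (is_RInt_Chasles (V := R_NormedModule) f a (- L) b).
    + apply is_RInt_zero; [ lra | ]. intros x Hx; apply Hf. rewrite Rabs_left; lra.
    + apply (is_RInt_Chasles (V := R_NormedModule) f (- L) L b).
      * now apply (RInt_correct (V := R_CompleteNormedModule)).
      * apply is_RInt_zero; [ lra | ]. intros x Hx; apply Hf. rewrite Rabs_right; lra.
Qed.

(** [real] sends infinite bounds to 0, so a nonzero value certifies that the supremum is finite.
    [Glb_approx] uses the same device for the infimum. *)
Lemma Lub_finite (P : R -> Prop) (y : R) : P y -> real (Lub_Rbar P) <> 0 ->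
  forall z, P z -> z <= real (Lub_Rbar P).
Proof.
  intros Hy Hne z Hz. destruct (Lub_Rbar_correct P) as [Hub _].
  destruct (Lub_Rbar P) as [l | | ]; simpl in *; try lra. exact (Hub z Hz).
Qed.

Lemma Lub_finite_bounded (P : R -> Prop) (C : R) : (forall z, P z -> z <= C) ->
  forall z, P z -> z <= real (Lub_Rbar P).
Proof.
  intros HC z Hz. destruct (Lub_Rbar_correct P) as [Hub Hlub].
  assert (K : Rbar_le (Lub_Rbar P) (Finite C)) by (apply Hlub; intros y Hy; exact (HC y Hy)).
  specialize (Hub z Hz).
  destruct (Lub_Rbar P) as [l | | ]; simpl in *; tauto.
Qed.

Lemma Glb_approx (P : R -> Prop) (z : R) : real (Glb_Rbar P) <> 0 -> real (Glb_Rbar P) < z ->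
  exists y, P y /\ y < z.
Proof.
  intros Hne Hlt. apply NNPP; intros Hno. destruct (Glb_Rbar_correct P) as [_ Hglb].
  assert (K : Rbar_le (Finite z) (Glb_Rbar P)).
  { apply Hglb. intros y Hy. simpl. apply Rnot_lt_le; intros Hyz. apply Hno; exists y; auto. }
  destruct (Glb_Rbar P) as [l | | ]; simpl in *; lra.
Qed.

Lemma Zfun_Zc (g : R) (h hx ux : R -> R -> R) (t x : R) :
  Zfun g 1 (h t x) (ux t x) (hx t x) = Zc g h hx ux (- 1) t x /\
  Zfun g 2 (h t x) (ux t x) (hx t x) = Zc g h hx ux 1 t x.
Proof. unfold Zfun, Zc, riemx, kf. split; ring. Qed.

(** The level - mu lies strictly above the infimum m, so some initial gradient is below it; the cost
    in mu^2/2 is at most sg. *)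
Lemma choose_level (m s sg : R) : 0 < sg -> - s < m < 0 ->
  exists mu, 0 < mu <= s /\ m < - mu /\ m ^ 2 / 2 - sg <= mu ^ 2 / 2.
Proof.
  intros Hsg Hm. set (ep := Rmin (- m / 2) (sg / - m)).
  assert (E1 : ep <= - m / 2) by apply Rmin_l. assert (E2 : ep <= sg / - m) by apply Rmin_r.
  assert (E3 : 0 < ep) by (apply Rmin_glb_lt; [ lra | apply Rdiv_lt_0_compat; lra ]).
  assert (E4 : ep * - m <= sg).
  { apply Rle_trans with (sg / - m * - m); [ apply Rmult_le_compat_r; lra | right; field; lra ]. }
  exists (- m - ep). split; [ lra | split; [ lra | ] ].
  nra.
Qed.

(** Going slightly beyond the inverse value makes the energy inequality strict; by continuity the
    cost in (1 + a)^(-2/g) is at most sg. *)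
Lemma choose_volume (g y sg : R) : 1 <= g -> 0 < sg ->
  exists a, 0 < a /\ y < Fgamma g a /\
    Rpower (Fgamma_inv g y + 1) (- 2 / g) - sg <= Rpower (1 + a) (- (2 / g)).
Proof.
  intros Hg Hsg. destruct (Fgamma_inv_cases g y Hg) as [K _]. set (al := Fgamma_inv g y) in *.
  assert (Hc : continuity_pt (fun z => Rpower z (- (2 / g))) (al + 1))
    by (eapply is_derive_continuity_pt, is_derive_Rpower; lra).
  destruct (proj1 (continuity_pt_locally _ _) Hc (mkposreal _ Hsg)) as [d Hd].
  assert (Hd0 := cond_pos d). exists (al + d / 2). split; [ lra | split ].
  - apply Fgamma_inv_lt; auto; fold al; lra.
  - assert (Hb : Rabs (1 + (al + d / 2) - (al + 1)) < d) by (rewrite Rabs_right; lra).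
    specialize (Hd _ Hb). simpl in Hd. apply Rabs_def2 in Hd.
    replace (- 2 / g) with (- (2 / g)) by (field; lra). lra.
Qed.

Theorem theorem3p3 (gamma : R) (hgamma : 1 <= gamma) :
  exists B : R -> R -> R -> R -> R,
    continuous_on_admissible gamma B /\
    forall h0 u0 v0 : R -> R,
      C01 (fun x => h0 x - 1) -> C01 u0 -> C01 v0 ->
      Rbar_lt (Finite 0) (inf_xi h0) ->
      - sqrt (2 * omega0sharp h0 v0) < infZ0 gamma h0 u0 ->
      infZ0 gamma h0 u0 <
        - sqrt 2 * sqrt (omega0sharp h0 v0 -
            Rpower (Fgamma_inv gamma (G0 gamma h0 u0 v0 * E0 gamma h0 u0 v0) + 1)
                   (- 2 / gamma)) ->
      exists Tstar : R,
        0 <= Tstar /\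
        Tstar <= B (G0 gamma h0 u0 v0) (E0 gamma h0 u0 v0)
                   (omega0sharp h0 v0) (infZ0 gamma h0 u0) /\
        forall (T : R) (h u v : R -> R -> R),
          Tstar < T ->
          classical_solution gamma T h u v h0 u0 v0 ->
          exists t, 0 <= t <= Tstar /\
            Rbar_le (inf_xi (fun x => minZ gamma h u t x))
                    (Finite (- sqrt (2 * omega0sharp h0 v0))).
Proof.
  exists (time_bound gamma). split; [ now apply time_bound_continuous | ].
  intros h0 u0 v0 [_ [_ [Mh Hh0]]] [_ [_ [Mu Hu0]]] [_ [_ [Mv Hv0]]] _ Hlow Hup.
  set (w := omega0sharp h0 v0) in *. set (m := infZ0 gamma h0 u0) in *.
  set (G := G0 gamma h0 u0 v0) in *. set (En := E0 gamma h0 u0 v0) in *.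
  set (s := sqrt (2 * w)) in *.
  assert (Hgap := gap_pos gamma G En w m Hup). set (sg := gap gamma G En w m) in *.
  assert (Hm0 : m < 0).
  { assert (K : 0 <= sqrt 2 * sqrt (w - Rpower (Fgamma_inv gamma (G * En) + 1) (- 2 / gamma)))
      by (apply Rmult_le_pos; apply sqrt_pos). lra. }
  assert (Hs : 0 < s) by lra.
  assert (Hw0 : 0 < w).
  { apply Rnot_le_lt; intros Hw. unfold s in Hs. rewrite sqrt_neg_0 in Hs by lra. lra. }
  assert (Hss : s ^ 2 = 2 * w) by (simpl; rewrite Rmult_1_r; apply sqrt_sqrt; lra).
  assert (HB : 0 < time_bound gamma G En w m).
  { unfold time_bound. fold s sg. assert (K := Rinv_0_lt_compat _ Hgap).
    apply Rmult_lt_0_compat; lra. }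
  (* The bound itself serves as [Tstar]. *)
  exists (time_bound gamma G En w m). split; [ lra | split; [ lra | ] ].
  intros T h u v HT Hsol. set (T1 := time_bound gamma G En w m) in *.
  (* If the infimum never reaches - s up to [T1], then every weighted gradient stays strictly above
     - s there. *)
  apply NNPP; intros Hno.
  assert (HZlow : forall t x, 0 <= t <= T1 -> - s < minZ gamma h u t x).
  { intros t x Ht. apply Rnot_le_lt; intros Hle. apply Hno. exists t; split; auto.
    destruct (Glb_Rbar_correct (fun y => exists x, y = minZ gamma h u t x)) as [Hlb _].
    apply (Rbar_le_trans _ (Finite (minZ gamma h u t x))); [ | exact Hle ].
    apply Hlb. now exists x. }
  assert (S := classical_flow gamma T h u v h0 u0 v0 hgamma ltac:(lra) Hsol).
  destruct Hsol as [_ [_ [_ [_ [Hini _]]]]].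
  set (H := from0 h) in *. set (U := from0 u) in *. set (V := from0 v) in *.
  set (Hx := from0 (d_x h)) in *. set (Ux := from0 (d_x u)) in *. set (Vx := from0 (d_x v)) in *.
  set (T2 := (T1 + T) / 2).
  assert (Hat0 : forall x, H 0 x = h0 x /\ U 0 x = u0 x /\ V 0 x = v0 x /\
    Hx 0 x = Derive h0 x /\ Ux 0 x = Derive u0 x /\ Vx 0 x = Derive v0 x).
  { intros x. unfold H, U, V, Hx, Ux, Vx. rewrite !from0_pos by lra. unfold d_x.
    destruct (Hini x) as [E1 [E2 E3]].
    repeat split; auto; apply Derive_ext; intros y; apply (Hini y). }
  destruct (rest_outside gamma T H U V Hx Ux Vx S (Rmax Mh (Rmax Mu Mv)) T2) as [L [HL Hrest]].
  { unfold T2; lra. }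
  { intros x Hx0. assert (M1 := Rmax_l Mh (Rmax Mu Mv)). assert (M2 := Rmax_r Mh (Rmax Mu Mv)).
    assert (M3 := Rmax_l Mu Mv). assert (M4 := Rmax_r Mu Mv).
    destruct (Hat0 x) as [E1 [E2 [E3 _]]]. unfold at_rest. rewrite E1, E2, E3.
    assert (K := Hh0 x ltac:(lra)). repeat split; [ lra | apply Hu0; lra | apply Hv0; lra ]. }
  assert (Hw : forall x, Vx 0 x + / H 0 x <= w).
  { intros x. destruct (Hat0 x) as [E1 [_ [_ [_ [_ E6]]]]]. rewrite E1, E6, Rplus_comm.
    apply (Lub_finite (fun y => exists x, y = / h0 x + Derive v0 x) (/ h0 0 + Derive v0 0)).
    - now exists 0.
    - change (w <> 0). lra.
    - now exists x. }
  (* In the outer region at rest the vorticity v_x + 1/h equals 1. *)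
  assert (Hw1 : 1 <= w).
  { destruct (Hrest 0 L ltac:(unfold T2; lra) ltac:(rewrite Rabs_right; lra)) as [[K1 _] [_ [_ K2]]].
    specialize (Hw L). rewrite K1, K2, Rinv_1 in Hw. lra. }
  set (M := Rmax (Z0sharp gamma h0 u0) s).
  assert (HsM : s <= M) by apply Rmax_r.
  assert (HG : G = s + M) by reflexivity.
  assert (Hrest1 : forall t x, 0 <= t <= T2 -> L - 1 <= Rabs x -> Hx t x = 0 /\ Ux t x = 0)
    by (intros t x Ht Hx0; destruct (Hrest t x Ht Hx0) as [_ [K1 [K2 _]]]; auto).
  assert (HZini : forall x, Z0j gamma 1 h0 u0 x = Zc gamma H Hx Ux (- 1) 0 x /\
    Z0j gamma 2 h0 u0 x = Zc gamma H Hx Ux 1 0 x).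
  { intros x. destruct (Hat0 x) as [E1 [_ [_ [E4 [E5 _]]]]]. unfold Z0j.
    rewrite <- E1, <- E4, <- E5. apply Zfun_Zc. }
  assert (HT2 : 0 < T2 < T) by (unfold T2; lra).
  (* Nothing shows that [Z0sharp] is nonzero, so its finiteness is derived from the boundedness of
     the gradients at time 0. *)
  assert (HZ0 : forall e x, is_sign e -> Zc gamma H Hx Ux e 0 x <= M).
  { destruct (Zc_bounded gamma T H U V Hx Ux Vx S T2 L HT2) as [C [HC HCb]].
    set (P := fun y => exists x, y = Rmax (Z0j gamma 1 h0 u0 x) (Z0j gamma 2 h0 u0 x)).
    assert (HP : forall z, P z -> z <= real (Lub_Rbar P)).
    { apply (Lub_finite_bounded P C). intros z [x ->]. destruct (HZini x) as [-> ->].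
      assert (Hb : forall e, is_sign e -> Zc gamma H Hx Ux e 0 x <= C).
      { intros e He. destruct (Rle_dec (L - 1) (Rabs x)) as [Hx0 | Hx0].
        - rewrite (Zc_rest gamma H Hx Ux T2 L Hrest1 e 0 x); auto; lra.
        - assert (K : Rabs x <= L) by lra. apply Rabs_le_between in K.
          destruct (HCb e 0 x He ltac:(lra) K) as [K1 _].
          assert (K2 := Rle_abs (Zc gamma H Hx Ux e 0 x)). lra. }
      apply Rmax_lub; apply Hb; [ right | left ]; auto. }
    intros e x He. assert (K := HP _ (ex_intro _ x eq_refl)).
    destruct (HZini x) as [E1 E2]. rewrite E1, E2 in K.
    assert (K1 := Rmax_l (Zc gamma H Hx Ux (- 1) 0 x) (Zc gamma H Hx Ux 1 0 x)).
    assert (K2 := Rmax_r (Zc gamma H Hx Ux (- 1) 0 x) (Zc gamma H Hx Ux 1 0 x)).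
    assert (K3 : real (Lub_Rbar P) <= M) by apply Rmax_l.
    destruct He as [-> | ->]; lra. }
  assert (HT1 : 0 < T1 < T) by lra.
  assert (HT12 : T1 < T2) by (unfold T2; lra).
  assert (HZ : forall e t x, is_sign e -> 0 <= t <= T1 -> - s < Zc gamma H Hx Ux e t x <= M).
  { intros e t x He Ht. split.
    - assert (K := HZlow t x Ht). unfold minZ in K.
      destruct (Zfun_Zc gamma H Hx Ux t x) as [E1 E2].
      unfold H, Hx, Ux in E1, E2. rewrite !from0_pos in E1, E2 by lra. rewrite E1, E2 in K.
      fold H Hx Ux in K.
      assert (K1 := Rmin_l (Zc gamma H Hx Ux (- 1) t x) (Zc gamma H Hx Ux 1 t x)).
      assert (K2 := Rmin_r (Zc gamma H Hx Ux (- 1) t x) (Zc gamma H Hx Ux 1 t x)).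
      destruct He as [-> | ->]; lra.
    - apply (Z_upper gamma T H U V Hx Ux Vx hgamma S T1 L HT1 HL) with (w := w); auto; try lra.
      + intros t' x' Ht'; apply Hrest1; lra.
      + rewrite <- Hss. apply pow_incr; lra. }
  (* The gap [sg] is spent as follows: one quarter for the level mu, one quarter for the volume a,
     and one half is left as sigma. *)
  destruct (choose_level m s (sg / 4) ltac:(lra) ltac:(lra)) as [mu [Hmu [Hmmu Hmu2]]].
  destruct (choose_volume gamma (G * En) (sg / 4) hgamma ltac:(lra)) as [a [Ha [HFa Hqa]]].
  assert (Hsg : m ^ 2 / 2 - w + Rpower (Fgamma_inv gamma (G * En) + 1) (- 2 / gamma) = sg)
    by reflexivity.
  assert (Hlevel : exists e x, is_sign e /\ - L <= x <= L /\ Zc gamma H Hx Ux e 0 x < - mu).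
  { destruct (Glb_approx (fun y => exists x, y = Rmin (Z0j gamma 1 h0 u0 x) (Z0j gamma 2 h0 u0 x))
      (- mu)) as [y [[x ->] Hy]].
    - change (m <> 0). lra.
    - exact Hmmu.
    - destruct (HZini x) as [E1 E2]. rewrite E1, E2 in Hy.
      assert (He : exists e, is_sign e /\ Zc gamma H Hx Ux e 0 x < - mu).
      { unfold Rmin in Hy. destruct Rle_dec; [ exists (- 1) | exists 1 ];
          (split; [ | exact Hy ]); [ right | left ]; auto. }
      destruct He as [e [He HZe]]. exists e, x. split; [ auto | split; [ | auto ] ].
      destruct (Rle_dec (L - 1) (Rabs x)) as [Hx0 | Hx0].
      + rewrite (Zc_rest gamma H Hx Ux T2 L Hrest1 e 0 x) in HZe; auto; lra.
      + assert (K : Rabs x <= L) by lra. now apply Rabs_le_between in K. }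
  assert (Hen : En = RInt (dens gamma H U V 0) (- L) L).
  { unfold En, E0. rewrite <- (RInt_gen_compact (dens gamma H U V 0) L).
    - f_equal. apply functional_extensionality. intros x. unfold dens.
      destruct (Hat0 x) as [E1 [E2 [E3 _]]]. now rewrite E1, E2, E3.
    - lra.
    - apply ex_RInt_slice. intros; apply (dens_continuity gamma T H U V Hx Ux Vx S); lra.
    - intros x Hx0. destruct (Hrest 0 x ltac:(lra) ltac:(lra)) as [[E1 [E2 E3]] _].
      unfold dens. rewrite E1, E2, E3, Qpot_1. ring. }
  assert (K := decline_time gamma T H U V Hx Ux Vx hgamma S T1 T2 L ltac:(lra) ltac:(lra) HL).
  specialize (K (fun t x Ht Hx0 => conj (proj1 (Hrest t x Ht Hx0)) (Hrest1 t x Ht Hx0))).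
  specialize (K w M s mu (sg / 2) a Hw Hw1 Hmu HsM Ha ltac:(lra) ltac:(lra) HZ).
  (* Since G = M + s, the strict inequality G En < [Fgamma gamma a] is exactly the energy bound E'
     multiplied by M + s. *)
  assert (HEn : RInt (dens gamma H U V 0) (- L) L
    <= 4 / (gamma * (M + s)) * (2 / gamma ^ 2) * (2 * Ffun (2 / gamma) (1 + a))).
  { rewrite <- Hen. rewrite Fgamma_Ffun in HFa by lra.
    apply (Rmult_le_reg_l (M + s)); [ lra | ].
    replace ((M + s) * (4 / (gamma * (M + s)) * (2 / gamma ^ 2) * (2 * Ffun (2 / gamma) (1 + a))))
      with (16 / gamma ^ 3 * Ffun (2 / gamma) (1 + a)) by (field; lra).
    rewrite HG in HFa. lra. }
  specialize (K HEn Hlevel). revert K. apply Rle_not_lt.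
  unfold T1, time_bound. fold s sg.
  assert (Hi := Rinv_0_lt_compat _ Hgap).
  replace (4 * s) with (800 * s * / 200) by field.
  rewrite (Rmult_assoc (800 * s)). apply Rmult_le_compat_l; [ lra | ].
  unfold Rmin. destruct Rle_dec.
  - rewrite Rmult_plus_distr_r.
    replace (/ sg * (sg / 2 / 4)) with (/ 8) by (field; lra). lra.
  - lra.
Qed.
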